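(* Let $\mathcal{H}=(\mathcal{H}_{\mathbb{Z}},F^\bullet\mathcal{H}_{\mathcal{O}})$ be a polarizable $\mathbb{Z}$-VHS of rank $r$ and weight $w=r-1$ on $C^\circ=C-D$ with generic cyclic vector $\omega\in H^0(C^\circ,F^w\mathcal{H}_{\mathcal{O}})$ and exponents $\mu_1^u\le\dots\le\mu_r^u$, $u\in C$. Assume $\mu_r^u-\mu_1^u\in[0,1)$ for all $u\in D_s$. Then for $k=0,\dots,w$ the parabolic degree of $\hat{E}^k=\hat{E}^{w-k,k}=\hat{F}^{w-k}/\hat{F}^{w-k+1}$ with respect to the induced parabolic structure is $$\mathrm{pdeg}(\hat{E}^{k})=\deg(\hat{E}^{k})-\sum_{u\in D_s}\nu_{k+1}^u .$$
   Context: $C$ is a compact (connected) Riemann surface, $D\subset C$ a reduced divisor, $C^\circ=C-D$. A $\mathbb{Z}$-VHS of weight $w$ on $C^\circ$ is a locally constant sheaf $\mathcal{H}_{\mathbb{Z}}$ of free abelian groups of finite rank $r$ with a decreasing filtration $F^\bullet$ of $\mathcal{H}_{\mathcal{O}}=\mathcal{H}_{\mathbb{Z}}\otimes\mathcal{O}$ by holomorphic subbundles which fiberwise gives a Hodge structure of weight $w$ and satisfies Griffiths transversality $\nabla F^p\subset F^{p-1}\otimes\Omega^1$ for the holomorphic Gauss--Manin connection $\nabla$ (the flat connection with flat sections $\mathcal{H}_{\mathbb{Z}}\otimes\mathbb{C}$). It is polarizable if there is a morphism $Q:\mathcal{H}_{\mathbb{Z}}\otimes\mathcal{H}_{\mathbb{Z}}\to\underline{\mathbb{Z}}$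 restricting to a polarization on each fiber. Its local monodromies around points of $D$ are quasi-unipotent. Cyclic vectors: a holomorphic section $\omega$ is a cyclic vector if for each point $u$ and each local holomorphic vector field $X$ with $X(u)\ne0$, the sections $\nabla_X^k\omega$, $k=0,\dots,r-1$, form a local frame around $u$. A non-zero meromorphic section $\omega$ is a generic cyclic vector if its restriction to the complement of its zeros and poles is a cyclic vector. It is assumed that $\omega$ extends meromorphically to $C$ (as a section of $\hat{F}^w$ defined below). The existence of a generic cyclic vector in $F^w$ makes all $F^p/F^{p+1}$, $0\le p\le w$, line bundles. Deligne's canonical extension: $(\hat{\mathcal{H}},\hat\nabla)$ is the unique extension of $(\mathcal{H}_{\mathcal{O}},\nabla)$ to a holomorphic bundle on $C$ with a connection with logarithmic poles along $D$ whose residues at the points of $D$ have eigenvalues in $[0,1)$. The subbundles $F^p$ extend to holomorphic subbundles $\hat{F}^p\subset\hat{\mathcal{H}}$. Put $\hat{E}=\bigoplus_{p+q=w}\hat{E}^{p,q}$, $\hat{E}^{p,q}=\hat{F}^p/\hat{F}^{p+1}$. Exponents: for $u\in C$ and a local coordinate $z$ centered at $u$, write on a punctured disk around $u$ $$\nabla_{z\,d/dz}^r\omega+b_{r-1}(z)\nabla_{z\,d/dz}^{r-1}\omega+\dots+b_0(z)\omega=0$$ with $b_j$ extending holomorphically to $z=0$. The exponents $\mu_1^u\le\dots\le\mu_r^u$ are the (real) roots, with multiplicity, of $X^r+b_{r-1}(0)X^{r-1}+\dots+b_0(0)$. Define $\nu_j^u\in(-1,0]$ by $\mu_j^u+\nu_j^u=\lfloor\mu_j^u\rfloor$;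 the numbers $-\nu_j^u$ are the eigenvalues of the residue of $\hat\nabla$ at $u\in D$. $D_a\subset D$ is the divisor of apparent singularities of the Picard--Fuchs equations (those $u\in D$ at which all exponents are integers and the local monodromy is trivial), and $D_s=D-D_a$ is the divisor of (genuine) regular singularities. Parabolic structure: for $d\in D$ and $\alpha\in[0,1)$ let $\hat{\mathcal{H}}_d(\alpha)\subset\hat{\mathcal{H}}_d$ be the sum of the generalized eigenspaces of $\mathrm{res}_d(\hat\nabla)$ for eigenvalues $\ge\alpha$, and $$\hat{E}_d(\alpha)=\bigoplus_p\frac{\hat{\mathcal{H}}_d(\alpha)\cap\hat{F}^p_d}{\hat{\mathcal{H}}_d(\alpha)\cap\hat{F}^{p+1}_d}\subset\hat{E}_d .$$ The distinct eigenvalues $0\le\alpha_1<\dots<\alpha_s<1$ of the residue are the parabolic weights, with filtration $\hat{E}_d=\hat{E}_d(\alpha_1)\supsetneq\dots\supsetneq\hat{E}_d(\alpha_s)\supsetneq0$. The induced parabolic structure on the line subbundle $\hat{E}^k\subset\hat{E}$ has at $d$ the single weight $\alpha_j$, where $j$ is the largest index with $\hat{E}^k_d\subset\hat{E}_d(\alpha_j)$. The parabolic degree is $\deg(\hat{E}^k)$ plus the sum over $d\in D$ of these weights. *)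

(* Defs.v *)
From HB Require Import structures.
From mathcomp Require Import all_boot all_order all_algebra.
From mathcomp Require Import complex.
From mathcomp Require Import all_classical all_reals all_analysis.

Set Implicit Arguments.
Unset Strict Implicit.
Unset Printing Implicit Defensive.

Import Order.TTheory GRing.Theory Num.Theory.
Import numFieldNormedType.Exports.

Local Open Scope classical_set_scope.
Local Open Scope ring_scope.
Local Open Scope complex_scope.

(* [R[i]^o] is the normed (hence topological) copy of the field [R[i]].
   Holomorphic functions of one variable are the complex-analytic ones: near
   [z0] the function is the sum of a power series centred at [z0]. *)
Definition analytic_at (R : realType) (f : R[i] -> R[i]) (z0 : R[i]) : Prop :=
  exists a : nat -> R[i], \forall z \near (z0 : R[i]^o),
    (fun n => \sum_(k < n) a k * (z - z0) ^+ k : R[i]^o) @ \oo --> (f z : R[i]^o).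

(* A chart is a coordinate [ccoord] on [cdom] with inverse [cparam]; both are
   total functions, with irrelevant values outside [cdom] and its image. *)
Record chart (R : realType) (X : topologicalType) := Chart {
  cdom : set X;
  ccoord : X -> R[i];
  cparam : R[i] -> X }.

Record is_chart (R : realType) (X : topologicalType) (c : chart R X) : Prop := {
  chart_open : open (cdom c);
  chart_image_open : open ((ccoord c : X -> R[i]^o) @` cdom c);
  chart_coordK : forall x, cdom c x -> cparam c (ccoord c x) = x;
  chart_coord_continuous : forall x, cdom c x ->
    {for x, continuous (ccoord c : X -> R[i]^o)};
  chart_param_continuous : forall x, cdom c x ->
    {for (ccoord c x : R[i]^o), continuous (cparam c : R[i]^o -> X)} }.

Definition chart_compatible (R : realType) (X : topologicalType)
    (c c' : chart R X) : Prop :=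
  forall x, cdom c x -> cdom c' x ->
    analytic_at (ccoord c' \o cparam c) (ccoord c x) /\
    analytic_at (ccoord c \o cparam c') (ccoord c' x).

(* The atlas is the maximal one, so its charts are all the local coordinates. *)
Record riemannSurface (R : realType) := RiemannSurface {
  rs_space :> topologicalType;
  rs_atlas : set (chart R rs_space);
  rs_hausdorff : hausdorff_space rs_space;
  rs_connected : connected [set: rs_space];
  rs_chart : forall c, rs_atlas c -> is_chart c;
  rs_cover : forall x, exists2 c, rs_atlas c & cdom c x;
  rs_compatible : forall c c', rs_atlas c -> rs_atlas c' -> chart_compatible c c';
  rs_maximal : forall c, is_chart c ->
    (forall c', rs_atlas c' -> chart_compatible c c') -> rs_atlas c }.

Definition coordinate_at (R : realType) (X : riemannSurface R) (u : X)
    (c : chart R X) : Prop :=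
  [/\ rs_atlas c, cdom c u & ccoord c u = 0].

Definition hol_at (R : realType) (X : riemannSurface R) (f : X -> R[i]) (x : X)
    : Prop :=
  forall c : chart R X, rs_atlas c -> cdom c x ->
    analytic_at (f \o cparam c) (ccoord c x).

Definition hol_mx (R : realType) (X : riemannSurface R) (m n : nat)
    (A : X -> 'M[R[i]]_(m, n)) (x : X) : Prop :=
  forall i j, hol_at (fun y => A y i j) x.

(* The fibres of all bundles of rank [r] are identified, point by point and with
   no compatibility between different points, with [R[i]^r] (row vectors), and
   the stalks of a local system with [int^r].  The actual structure is carried
   by a family of local frames: pairs [(V, e)] where the rows of [e x] are the
   values at [x] in [V] of the vectors of a frame over the open set [V].  A
   tuple of [m] sections is a function [s : X -> 'M_(m, r)]; its coordinates in
   the frame [(V, e)] are [s x *m invmx (e x)]. *)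
Definition frame (T : Type) (X : topologicalType) (r : nat) : Type :=
  (set X * (X -> 'M[T]_r))%type.

Record is_local_system (X : topologicalType) (r : nat) (U : set X)
    (L : set (frame int X r)) : Prop := {
  ls_open : forall e, L e -> open e.1 /\ e.1 `<=` U;
  ls_basis : forall e x, L e -> e.1 x -> e.2 x \in unitmx;
  ls_cover : forall x, U x -> exists2 e, L e & e.1 x;
  ls_transition : forall e e' x, L e -> L e' -> e.1 x -> e'.1 x ->
    \forall y \near x, e.2 y *m invmx (e'.2 y) = e.2 x *m invmx (e'.2 x) }.

Record is_hol_bundle (R : realType) (X : riemannSurface R) (r : nat)
    (U : set X) (B : set (frame R[i] X r)) : Prop := {
  hb_open : forall e, B e -> open e.1 /\ e.1 `<=` U;
  hb_basis : forall e x, B e -> e.1 x -> e.2 x \in unitmx;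
  hb_cover : forall x, U x -> exists2 e, B e & e.1 x;
  hb_transition : forall e e' x, B e -> B e' -> e.1 x -> e'.1 x ->
    hol_mx (fun y => e.2 y *m invmx (e'.2 y)) x }.

Definition hol_section (R : realType) (X : riemannSurface R) (r m : nat)
    (B : set (frame R[i] X r)) (s : X -> 'M[R[i]]_(m, r)) (x : X) : Prop :=
  forall e, B e -> e.1 x -> hol_mx (fun y => s y *m invmx (e.2 y)) x.

Definition is_hol_frame (R : realType) (X : riemannSurface R) (r : nat)
    (U : set X) (B : set (frame R[i] X r)) (e : frame R[i] X r) : Prop :=
  [/\ open e.1, e.1 `<=` U &
      forall y, e.1 y -> e.2 y \in unitmx /\ hol_section B e.2 y].

(* Families of subspaces of the fibres are given by matrices, through their row
   spaces. *)
Definition is_subbundle (R : realType) (X : riemannSurface R) (r : nat)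
    (U : set X) (B : set (frame R[i] X r)) (F : X -> 'M[R[i]]_r) : Prop :=
  forall x, U x -> exists (e : frame R[i] X r) (k : nat),
    [/\ is_hol_frame U B e, e.1 x, (k <= r)%N &
        forall y, e.1 y -> (F y == (pid_mx k : 'M[R[i]]_r) *m e.2 y)%MS].

(* The bundle H_Z (x) O of a local system H_Z: its fibres R[i]^r are the stalks
   int^r tensored with R[i]. *)
Definition ls_bundle (R : realType) (X : topologicalType) (r : nat)
    (L : set (frame int X r)) : set (frame R[i] X r) :=
  [set (e.1, fun x => map_mx intr (e.2 x)) | e in L].

Definition flat_frame (R : realType) (X : topologicalType) (r : nat)
    (L : set (frame int X r)) (x y : X) : 'M[R[i]]_r :=
  map_mx intr ((xget (setT, fun=> 1%:M) [set e | L e /\ e.1 x]).2 y).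

(* [nabla L c a s] is the covariant derivative of the tuple of sections [s]
   along the vector field [a * d/dz], where z is the coordinate of [c]. *)
Definition nabla (R : realType) (X : riemannSurface R) (r m : nat)
    (L : set (frame int X r)) (c : chart R X) (a : X -> R[i])
    (s : X -> 'M[R[i]]_(m, r)) (x : X) : 'M[R[i]]_(m, r) :=
  let e := @flat_frame R X r L x in
  (a x *: \matrix_(i < m, j < r)
     derive1 ((fun z => (s (cparam c z) *m invmx (e (cparam c z))) i j)
       : R[i] -> R[i]^o) (ccoord c x)) *m e x.

(* The vector field z d/dz for the coordinate z of [c]. *)
Definition nabla_log (R : realType) (X : riemannSurface R) (r m : nat)
    (L : set (frame int X r)) (c : chart R X) (s : X -> 'M[R[i]]_(m, r)) :=
  nabla L c (ccoord c) s.

Definition mxconj (R : realType) (m n : nat) (A : 'M[R[i]]_(m, n)) :=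
  map_mx (fun a : R[i] => a^*%C) A.

Record is_hodge_structure (R : realType) (r w : nat) (F : int -> 'M[R[i]]_r)
    : Prop := {
  hs_decreasing : forall p : int, (F (p + 1)%R <= F p)%MS;
  hs_exhaustive : exists p, row_full (F p);
  hs_separated : exists p, F p = 0;
  hs_sum : forall p, row_full (F p + mxconj (F (w%:Z + 1 - p)%R))%MS;
  hs_direct : forall p, (F p :&: mxconj (F (w%:Z + 1 - p)%R))%MS = 0 }.

Record is_polarization (R : realType) (r w : nat) (F : int -> 'M[R[i]]_r)
    (Q : 'M[int]_r) : Prop := {
  pol_sym : Q^T = (-1) ^+ w *: Q;
  pol_orth : forall p, F p *m map_mx intr Q *m (F (w%:Z + 1 - p))^T = 0;
  pol_pos : forall p (v : 'rV[R[i]]_r),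
    (v <= F p)%MS -> (v <= mxconj (F (w%:Z - p)%R))%MS -> v != 0 ->
    0 < ('i%C : R[i]) ^ (p - (w%:Z - p)) *
        (v *m map_mx intr Q *m (mxconj v)^T) 0 0 }.

Record is_VHS (R : realType) (X : riemannSurface R) (D : set X) (r w : nat)
    (L : set (frame int X r)) (F : int -> X -> 'M[R[i]]_r) : Prop := {
  vhs_local_system : is_local_system (~` D) L;
  vhs_subbundle : forall p, is_subbundle (~` D) (@ls_bundle R X r L) (F p);
  vhs_hodge : forall x, ~ D x -> is_hodge_structure w (fun p => F p x);
  vhs_transversality : forall p (s : X -> 'rV[R[i]]_r) (c : chart R X) x,
    ~ D x -> rs_atlas c -> cdom c x ->
    (\forall y \near x, hol_section (@ls_bundle R X r L) s y /\
                        (s y <= F p y)%MS) ->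
    (nabla L c (fun=> 1) s x <= F (p - 1)%R x)%MS }.

Definition polarizable (R : realType) (X : riemannSurface R) (D : set X)
    (r w : nat) (L : set (frame int X r)) (F : int -> X -> 'M[R[i]]_r) : Prop :=
  exists Q : X -> 'M[int]_r,
    (forall e x, L e -> e.1 x -> \forall y \near x,
       e.2 y *m Q y *m (e.2 y)^T = e.2 x *m Q x *m (e.2 x)^T) /\
    (forall x, ~ D x -> is_polarization w (fun p => F p x) (Q x)).

(* If [nabla_log] of the frame [e] is [A *m e] with [A] holomorphic at [d], the
   residue is the endomorphism of the fibre with matrix [A d] in the basis
   [e d]; [N] is its matrix in the standard basis, acting on row vectors. *)
Definition is_residue (R : realType) (X : riemannSurface R) (r : nat)
    (L : set (frame int X r)) (B : set (frame R[i] X r)) (d : X)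
    (N : 'M[R[i]]_r) : Prop :=
  exists (c : chart R X) (e : frame R[i] X r) (A : X -> 'M[R[i]]_r),
    [/\ coordinate_at d c, B e /\ e.1 d, hol_mx A d,
        \forall y \near d^', nabla_log L c e.2 y = A y *m e.2 y &
        N = invmx (e.2 d) *m A d *m e.2 d].

Definition residue (R : realType) (X : riemannSurface R) (r : nat)
    (L : set (frame int X r)) (B : set (frame R[i] X r)) (d : X)
    : 'M[R[i]]_r :=
  xget 0 [set N | is_residue L B d N].

(* In the order of [R[i]], [0 <= a < 1] says that [a] is real and in [0, 1). *)
Record is_canonical_extension (R : realType) (X : riemannSurface R)
    (D : set X) (r : nat) (L : set (frame int X r)) (B : set (frame R[i] X r))
    : Prop := {
  ce_bundle : is_hol_bundle setT B;
  ce_restriction : forall e x, B e -> e.1 x -> ~ D x ->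
    hol_section (@ls_bundle R X r L) e.2 x;
  ce_log_pole : forall d, D d -> exists N, is_residue L B d N;
  ce_eigenvalue : forall d a, D d -> eigenvalue (residue L B d) a -> 0 <= a < 1 }.

Record is_hodge_extension (R : realType) (X : riemannSurface R) (D : set X)
    (r : nat) (B : set (frame R[i] X r)) (F Fhat : int -> X -> 'M[R[i]]_r)
    : Prop := {
  he_subbundle : forall p, is_subbundle setT B (Fhat p);
  he_restriction : forall p x, ~ D x -> (Fhat p x == F p x)%MS }.

Definition cyclic_at (R : realType) (X : riemannSurface R) (r : nat)
    (L : set (frame int X r)) (omega : X -> 'rV[R[i]]_r) (u : X) : Prop :=
  forall (c : chart R X) (a : X -> R[i]),
    rs_atlas c -> cdom c u -> hol_at a u -> a u != 0 ->
    \forall y \near u,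
      (\matrix_(k < r) iter k (nabla L c a) omega y) \in unitmx.

Definition mero_section (R : realType) (X : riemannSurface R) (r : nat)
    (B : set (frame R[i] X r)) (s : X -> 'rV[R[i]]_r) (d : X) : Prop :=
  exists (c : chart R X) (n : nat) (g : X -> 'rV[R[i]]_r),
    [/\ coordinate_at d c, hol_section B g d &
        \forall y \near d^', ccoord c y ^+ n *: s y = g y].

Record is_generic_cyclic_vector (R : realType) (X : riemannSurface R)
    (D : set X) (r w : nat) (L : set (frame int X r))
    (F : int -> X -> 'M[R[i]]_r) (B : set (frame R[i] X r))
    (omega : X -> 'rV[R[i]]_r) : Prop := {
  gc_hol : forall x, ~ D x -> hol_section (@ls_bundle R X r L) omega x;
  gc_filtration : forall x, ~ D x -> (omega x <= F w%:Z x)%MS;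
  gc_mero : forall d, D d -> mero_section B omega d;
  gc_nonzero : exists2 x, ~ D x & omega x != 0;
  gc_cyclic : forall x, ~ D x -> omega x != 0 -> cyclic_at L omega x }.

Definition is_exponents (R : realType) (X : riemannSurface R) (r : nat)
    (L : set (frame int X r)) (omega : X -> 'rV[R[i]]_r) (u : X)
    (mu : r.-tuple R) : Prop :=
  sorted <=%R mu /\
  exists (c : chart R X) (b : 'I_r -> X -> R[i]),
    [/\ coordinate_at u c, forall j, hol_at (b j) u,
        \forall y \near u^', iter r (nabla_log L c) omega y +
          \sum_(j < r) b j y *: iter j (nabla_log L c) omega y = 0 &
        'X^r + \sum_(j < r) b j u *: 'X^j =
          \prod_(j < r) ('X - (((tnth mu j)%:C)%C)%:P)].

Definition nu (R : realType) (m : R) : R := (Num.floor m)%:~R - m.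

(* Flat transport along [gamma], defined on the whole real line; a flat section
   over [0, 1] always extends. *)
Definition flat_along (X : topologicalType) (R : realType) (r : nat)
    (L : set (frame int X r)) (gamma : R -> X) (v : R -> 'rV[int]_r) : Prop :=
  forall e t, L e -> e.1 (gamma t) -> \forall s \near t,
    v s *m invmx (e.2 (gamma s)) = v t *m invmx (e.2 (gamma t)).

Definition small_loop (R : realType) (X : topologicalType) (c : chart R X)
    (rho t : R) : X :=
  cparam c ((rho * cos (2 * pi * t)) +i* (rho * sin (2 * pi * t)))%C.

Definition trivial_monodromy (R : realType) (X : riemannSurface R) (r : nat)
    (L : set (frame int X r)) (u : X) : Prop :=
  exists2 c : chart R X, coordinate_at u c &
    \forall rho \near (0 : R)^'+, forall v : R -> 'rV[int]_r,
      flat_along L (small_loop c rho) v -> v 1 = v 0.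

Definition apparent (R : realType) (X : riemannSurface R) (D : set X)
    (r : nat) (L : set (frame int X r)) (mu : X -> r.-tuple R) : set X :=
  [set u | [/\ D u, forall j, tnth (mu u) j \is a Num.int &
               trivial_monodromy L u]].

(* Let [G <= F] be subbundles of [B] such that [F/G] is a line bundle.  A
   meromorphic section of [F/G] is represented by a family [s] of vectors of the
   fibres of [F].  Its order at [x] is [n] if, modulo [G], it is [z^n l] on a
   punctured neighbourhood of [x], for a local generator [l] of [F/G]. *)
Definition is_order (R : realType) (X : riemannSurface R) (r : nat)
    (B : set (frame R[i] X r)) (F G : X -> 'M[R[i]]_r)
    (s : X -> 'rV[R[i]]_r) (x : X) (n : int) : Prop :=
  exists (c : chart R X) (l : X -> 'rV[R[i]]_r),
    [/\ coordinate_at x c, hol_section B l x,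
        \forall y \near x, (l y <= F y)%MS,
        ~~ (l x <= G x)%MS &
        \forall y \near x^', ((s y - ccoord c y ^ n *: l y)%R <= G y)%MS].

(* The degree of the divisor of a non-zero meromorphic section. *)
Definition is_degree (R : realType) (X : riemannSurface R) (r : nat)
    (B : set (frame R[i] X r)) (F G : X -> 'M[R[i]]_r) (n : int) : Prop :=
  exists (s : X -> 'rV[R[i]]_r) (m : X -> int),
    [/\ forall x, (s x <= F x)%MS,
        forall x, is_order B F G s x (m x),
        finite_set [set x | m x != 0] &
        n = \sum_(x \in [set: X]) m x].

Definition degree (R : realType) (X : riemannSurface R) (r : nat)
    (B : set (frame R[i] X r)) (F G : X -> 'M[R[i]]_r) : int :=
  xget 0 [set n | is_degree B F G n].

Definition parabolic_weights (R : realType) (r : nat) (N : 'M[R[i]]_r)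
    : seq R :=
  xget [::] [set al : seq R | sorted <%R al /\
    forall a : R[i], eigenvalue N a = (a \in [seq (t%:C)%C | t <- al])].

Definition parabolic_filtration (R : realType) (r : nat) (N : 'M[R[i]]_r)
    (alpha : R) : 'M[R[i]]_r :=
  (\sum_(a <- parabolic_weights N | (alpha <= a)%R) geigenspace N (a%:C)%C)%MS.

(* A graded subspace of the fibre of E = (+)_p F^p / F^(p+1) is given by the
   family, indexed by p, of the inverse images in F^p of its components. *)
Definition gr_subset (R : realType) (r : nat) (S T : int -> 'M[R[i]]_r)
    : Prop :=
  forall p, (S p <= T p)%MS.

Definition gr_parabolic (R : realType) (r : nat) (N : 'M[R[i]]_r)
    (F : int -> 'M[R[i]]_r) (alpha : R) (p : int) : 'M[R[i]]_r :=
  ((parabolic_filtration N alpha :&: F p) + F (p + 1)%R)%MS.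

(* The summand F^q / F^(q+1) of E. *)
Definition gr_line (R : realType) (r : nat) (F : int -> 'M[R[i]]_r) (q p : int)
    : 'M[R[i]]_r :=
  if p == q then F p else F (p + 1).

Definition induced_weight (R : realType) (r : nat) (N : 'M[R[i]]_r)
    (F : int -> 'M[R[i]]_r) (q : int) : R :=
  let al := parabolic_weights N in
  nth 0 al (\max_(j < size al |
    `[< gr_subset (gr_line F q) (gr_parabolic N F (nth 0%R al j)) >]) j)%N.

Definition gr_degree (R : realType) (X : riemannSurface R) (r : nat)
    (B : set (frame R[i] X r)) (F : int -> X -> 'M[R[i]]_r) (q : int) : int :=
  degree B (F q) (F (q + 1)).

Definition gr_pdegree (R : realType) (X : riemannSurface R) (D : set X)
    (r : nat) (L : set (frame int X r)) (B : set (frame R[i] X r))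
    (F : int -> X -> 'M[R[i]]_r) (q : int) : R :=
  (gr_degree B F q)%:~R +
  \sum_(d \in D) induced_weight (residue L B d) (fun p => F p d) q.

(* Main.v *)
Require Import Defs.
From mathcomp Require Import all_boot all_order all_algebra.
From mathcomp Require Import complex.
From mathcomp Require Import all_classical all_reals all_analysis.
From mathcomp Require Import lra ring zify.

(* The degree of the line bundle cancels, so the claim is that at [d] in [D] the
   weight of E^k is 0 if [d] is apparent and the fractional part of mu_(k+1)
   otherwise.  Let theta = nabla_(z d/dz) near [d].
   Two logarithmic lattices whose residues have all their eigenvalues in [0, 1)
   coincide: if S = z^m P, P(0) <> 0, is the matrix of one in terms of the other,
   then P(0) intertwines the residues up to the shift by m, hence m = 0.  If the
   exponents lie in an interval of length < 1, the sections
     s_k = z^(- floor mu_(k+1)) (theta - mu_k) ... (theta - mu_1) omega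
   span such a lattice, so they form a frame of the canonical extension at [d].
   In this frame F^(w-k) is spanned by s_0, ..., s_k (transversality, and the
   ranks forced by the Hodge decomposition), and after a rotation of the indices
   the residue is triangular with the sorted fractional parts of the mu_j on the
   diagonal; the sum of the generalized eigenspaces for eigenvalues >= alpha is
   therefore spanned by the s_k(d) with {mu_(k+1)} >= alpha.
   At an apparent singularity a truncated formal solution shows that the residue
   has integral eigenvalues, hence only 0. *)

Set Implicit Arguments.
Unset Strict Implicit.
Unset Printing Implicit Defensive.

Import Order.TTheory GRing.Theory Num.Theory.
Import numFieldNormedType.Exports.
Import ComplexField.Normc.

Local Open Scope classical_set_scope.
Local Open Scope ring_scope.

(** * Complex power series *)

(* The norm of [R[i]] takes its values in [R[i]]; estimates use the [R]-valued [normc]. *)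
Section Basic.
Variable R : realType.
Implicit Types (z x y : R[i]) (e : R).

(** In a frame of the canonical extension theta acts on rows of coordinates as v -> z v' + v A with
    A holomorphic, so each weight is a question about germs at 0 of matrices of meromorphic
    functions, and only leading Laurent coefficients are compared. The gap assumption enters twice.
    The product of all the theta - mu_j is the indicial polynomial in theta; applied to omega it
    differs from the Picard-Fuchs equation by the terms b_j(0) - b_j(z), so it supplies a single
    factor z. This factor absorbs the quotients of the powers of z attached to the last and to the
    other sections as soon as the floors differ by at most 1, and then the new lattice is
    logarithmic. Its residue is upper triangular except for the entries of the last row at indices
    whose floor is one less. Since the exponents spread over less than 1, the fractional parts
    beyond the jump of the floor lie below those before it: listing the indices beyond the jump
    ahead of the others restores triangularity and sorts the diagonal at once. *)

Lemma normC_normc x : `|x| = ((normc x)%:C)%C.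
Proof. by case: x. Qed.

Lemma normc_ge0 x : 0 <= normc x.
Proof. by case: x => a b /=; exact: sqrtr_ge0. Qed.

Lemma normc_eq0 x : (normc x == 0) = (x == 0).
Proof. by apply/eqP/eqP => [/eq0_normc//|->]; rewrite normc0. Qed.

Lemma normc_gt0 x : (0 < normc x) = (x != 0).
Proof. by rewrite lt_def normc_ge0 andbT normc_eq0. Qed.

Lemma ler_normcD x y : normc (x + y) <= normc x + normc y.
Proof. exact: le_normcD. Qed.

Lemma normcBC x y : normc (x - y) = normc (y - x).
Proof. by rewrite -normcN opprB. Qed.

Lemma normcX x n : normc (x ^+ n) = normc x ^+ n.
Proof. by elim: n => [|n IH]; rewrite ?normc1// !exprS normcM IH. Qed.

Lemma ler_normc_sum (I : Type) (r : seq I) (P : pred I) (F : I -> R[i]) :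
  normc (\sum_(i <- r | P i) F i) <= \sum_(i <- r | P i) normc (F i).
Proof.
elim/big_rec2: _ => [|i a b _ IH]; first by rewrite normc0.
by rewrite (le_trans (ler_normcD _ _))// lerD2l.
Qed.

Lemma normc_real e : normc ((e%:C)%C) = `|e|.
Proof. by rewrite /normc/= expr0n addr0 sqrtr_sqr. Qed.

Lemma gtC0P (e : R[i]) : 0 < e -> exists2 a : R, 0 < a & e = ((a%:C)%C).
Proof.
case: e => a b; rewrite ltcE/= => /andP[/eqP -> a0]; by exists a.
Qed.

Lemma nearC_normcP z (P : R[i] -> Prop) :
  (\forall y \near (z : R[i]^o), P y) <->
  exists2 e, 0 < e & forall y, normc (y - z) < e -> P y.
Proof.
split.
  move=> /nbhs_normP[e /= /gtC0P[a a0 ->] H]; exists a => // y yz.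
  by apply: H; change (`|z - y| < (a%:C)%C); rewrite normC_normc ltcR normcBC.
move=> [e e0 H]; apply/nbhs_normP; exists (e%:C)%C; first by rewrite /= ltcR.
move=> y; change (`|z - y| < (e%:C)%C -> P y); rewrite normC_normc ltcR normcBC.
exact: H.
Qed.

Lemma dnearC_normcP z (P : R[i] -> Prop) :
  (\forall y \near (z : R[i]^o)^', P y) <->
  exists2 e, 0 < e & forall y, normc (y - z) < e -> y != z -> P y.
Proof. exact: nearC_normcP. Qed.

Lemma cvgCP (T : Type) (F : set_system T) (FF : Filter F) (f : T -> R[i]) (l : R[i]) :
  (f x @[x --> F] --> (l : R[i]^o)) <->
  forall e, 0 < e -> \forall x \near F, normc (f x - l) < e.
Proof.
rewrite (@cvgrPdist_lt _ R[i]^o T F FF f l); split => H e e0.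
  have := H (e%:C)%C; rewrite ltcR => /(_ e0).
  by apply: filterS => x; rewrite normC_normc ltcR normcBC.
have /gtC0P[a a0 ->] := e0.
by apply: filterS (H a a0) => x; rewrite normC_normc ltcR normcBC.
Qed.

Lemma cvgC_seqP (u : nat -> R[i]) (l : R[i]) :
  (u @ \oo --> (l : R[i]^o)) <->
  forall e, 0 < e -> exists N, forall n, (N <= n)%N -> normc (u n - l) < e.
Proof.
rewrite (@cvgCP nat \oo _ u l); split => H e e0.
  by have [N _ HN] := H e e0; exists N => n; exact: HN.
by have [N HN] := H e e0; exists N => // n; exact: HN.
Qed.

Lemma cvgC_geo (u : nat -> R[i]) (l : R[i]) (K : R) :
  (forall n, normc (u n - l) <= K * 2^-1 ^+ n) -> u @ \oo --> (l : R[i]^o).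
Proof.
move=> H; apply/cvgC_seqP => e e0.
have : (fun n => K * 2^-1 ^+ n) @ \oo --> (K * 0).
  by apply: cvgMr; apply: cvg_expr; rewrite ger0_norm ?invr_ge0// invf_lt1// ltr1n.
rewrite mulr0 => /cvgrPdist_lt /(_ e e0)[N _ HN].
exists N => n Nn; apply: le_lt_trans (H n) _; apply: le_lt_trans (HN n Nn).
by rewrite sub0r normrN ler_norm.
Qed.

Lemma cvgC_D (u v : nat -> R[i]) (l l' : R[i]) :
  u @ \oo --> (l : R[i]^o) -> v @ \oo --> (l' : R[i]^o) ->
  (fun n => u n + v n) @ \oo --> (l + l' : R[i]^o).
Proof. move=> h h'; apply (@cvgD R[i] R[i]^o nat \oo _ u v l l' h h'). Qed.

Lemma cvgC_M (u v : nat -> R[i]) (l l' : R[i]) :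
  u @ \oo --> (l : R[i]^o) -> v @ \oo --> (l' : R[i]^o) ->
  (fun n => u n * v n) @ \oo --> (l * l' : R[i]^o).
Proof.
move=> h h'.
apply (@cvgM _ nat \oo _ (u : nat -> R[i]^o) (v : nat -> R[i]^o) l l' h h').
Qed.

Lemma cvgC_cst (l : R[i]) : (fun _ : nat => l) @ \oo --> (l : R[i]^o).
Proof. apply (@cvg_cst R[i]^o l nat \oo _). Qed.

Lemma cvgC_N (u : nat -> R[i]) (l : R[i]) :
  u @ \oo --> (l : R[i]^o) -> (fun n => - u n) @ \oo --> (- l : R[i]^o).
Proof. move=> h; apply (@cvgN R[i] R[i]^o nat \oo _ u l h). Qed.

Lemma cvgC_uniq (u : nat -> R[i]) (l l' : R[i]) :
  u @ \oo --> (l : R[i]^o) -> u @ \oo --> (l' : R[i]^o) -> l = l'.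
Proof. by move=> h h'; exact: (@norm_cvg_unique _ R[i]^o (u @ \oo) _ l l' h h'). Qed.

Lemma cvgC_le (u : nat -> R[i]) (l : R[i]) (K : R) :
  (forall n, normc (u n) <= K) -> u @ \oo --> (l : R[i]^o) -> normc l <= K.
Proof.
move=> H /cvgC_seqP ul; apply/ler_addgt0Pr => e e0.
have [N /(_ _ (leqnn N)) HN] := ul e e0.
have := ler_normcD (u N) (l - u N); rewrite addrC subrK.
by move=> /le_trans; apply; rewrite lerD// normcBC ltW.
Qed.

Lemma cvgC_complex (u : nat -> R[i]) (a b : R) :
  (fun n => complex.Re (u n)) @ \oo --> a -> (fun n => complex.Im (u n)) @ \oo --> b ->
  u @ \oo --> ((a +i* b)%C : R[i]^o).
Proof.
move=> ha hb; apply/cvgC_seqP => e e0.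
have e2 : 0 < e / 2 by rewrite divr_gt0.
have /cvgrPdist_lt /(_ _ e2)[N _ HN] := ha.
have /cvgrPdist_lt /(_ _ e2)[M _ HM] := hb.
exists (maxn N M) => n; rewrite geq_max => /andP[/HN /= h1 /HM /= h2].
have dRe : complex.Re (u n - (a +i* b)%C) = complex.Re (u n) - a by case: (u n).
have dIm : complex.Im (u n - (a +i* b)%C) = complex.Im (u n) - b by case: (u n).
rewrite (complexE (u n - _)) dRe dIm.
apply: le_lt_trans (ler_normcD _ _) _; rewrite normcM !normc_real.
have -> : normc ('i%C : R[i]) = 1 by rewrite /normc expr0n expr1n add0r sqrtr1.
by rewrite mul1r distrC [`|_ - b|]distrC [e]splitr ltrD.
Qed.

End Basic.

(** * Majorised power series and Cauchy products *)

Section PowerSeries.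
Variable R : realType.
Implicit Types (a b : nat -> R[i]) (M r : R) (f g : R[i] -> R[i]).

Definition psum a (h : R[i]) (n : nat) : R[i] := \sum_(k < n) a k * h ^+ k.

(** The bound on the terms at radius [r] is carried along with the convergence: products,
    reciprocals and derivatives are all estimated from [M] and [r] by geometric series. *)
Definition has_ps a M r f (z0 : R[i]) : Prop :=
  [/\ 0 < r, forall k, normc (a k) * r ^+ k <= M &
      forall z, normc (z - z0) < r -> psum a (z - z0) @ \oo --> (f z : R[i]^o)].

Lemma has_ps_M_ge0 a M r f z0 : has_ps a M r f z0 -> 0 <= M.
Proof.
by case=> r0 H _; apply: le_trans (H 0%N); rewrite expr0 mulr1 normc_ge0.
Qed.

Lemma has_ps_shrink a M r r' f z0 : 0 < r' -> r' <= r ->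
  has_ps a M r f z0 -> has_ps a M r' f z0.
Proof.
move=> r'0 rr [r0 H1 H2]; split=> // [k|z zr]; last exact/H2/lt_le_trans/rr.
apply: le_trans (H1 k); rewrite ler_wpM2l ?normc_ge0// lerXn2r// nnegrE ltW//.
Qed.

(** Convergence at the single point z0 + e/2 bounds the terms there: from [N] on they are
    differences of partial sums within 1 of the limit, hence at most 2, and the finitely many
    earlier ones are added into [M]. *)
Lemma analytic_has_ps f z0 : analytic_at f z0 -> exists a M r, has_ps a M r f z0.
Proof.
case=> a /nearC_normcP[e e0 H]; set z1 := z0 + ((e / 2)%:C)%C.
have e2 : 0 < e / 2 by rewrite divr_gt0.
have z10 : z1 - z0 = ((e / 2)%:C)%C by rewrite /z1 addrC addKr.
have /cvgC_seqP cv : psum a (z1 - z0) @ \oo --> (f z1 : R[i]^o).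
  by apply: H; rewrite z10 normc_real ger0_norm ?ltW// ltr_pdivrMr// ltr_pMr// ltr1n.
have [N HN] := cv 1 ltr01.
have H1 k : (N <= k)%N -> normc (a k) * (e / 2) ^+ k <= 2.
  move=> Nk; have -> : normc (a k) * (e / 2) ^+ k =
      normc (psum a (z1 - z0) k.+1 - psum a (z1 - z0) k).
    rewrite /psum big_ord_recr/= addrAC subrr add0r normcM normcX z10 normc_real.
    by rewrite ger0_norm ?ltW.
  rewrite -(subrK (f z1) (psum _ _ k.+1)) -addrA (le_trans (ler_normcD _ _))//.
  by rewrite [2]/(1 + 1) lerD ?ltW ?HN ?leqW// normcBC HN.
pose M := 2 + \sum_(k < N) normc (a k) * (e / 2) ^+ k.
have M0 : 0 <= \sum_(k < N) normc (a k) * (e / 2) ^+ k.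
  by apply: sumr_ge0 => i _; rewrite mulr_ge0 ?normc_ge0// exprn_ge0// ltW.
exists a, M, (e / 2); split=> // [k|z ze].
  have [Nk|kN] := leqP N k; first by rewrite (le_trans (H1 k Nk))// lerDl.
  rewrite /M (bigD1 (Ordinal kN))//= addrCA lerDl addr_ge0//.
  by apply: sumr_ge0 => i _; rewrite mulr_ge0 ?normc_ge0// exprn_ge0// ltW.
by apply: H; rewrite (lt_trans ze)// ltr_pdivrMr// ltr_pMr// ltr1n.
Qed.

Lemma has_ps_center a M r f z0 : has_ps a M r f z0 -> f z0 = a 0%N.
Proof.
case=> r0 _ /(_ z0); rewrite subrr normc0 => /(_ r0) h.
apply: (cvgC_uniq h); apply/cvgC_seqP => e e0; exists 1%N => -[//|n] _.
rewrite /psum big_ord_recl/= expr0 mulr1 big1 ?addr0 ?subrr ?normc0//.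
by move=> i _; rewrite expr0n/= mulr0.
Qed.

Lemma near_eq_analytic f g z0 :
  (\forall z \near (z0 : R[i]^o), f z = g z) -> analytic_at f z0 -> analytic_at g z0.
Proof.
by move=> fg [a Ha]; exists a; apply: filterS2 fg Ha => z ->.
Qed.

Lemma analytic_cst (c : R[i]) z0 : analytic_at (fun=> c) z0.
Proof.
exists (fun k => if k == 0%N then c else 0); near=> z.
apply/cvgC_seqP => e e0; exists 1%N => -[//|n] _.
rewrite big_ord_recl/= expr0 mulr1 big1 ?addr0 ?subrr ?normc0//.
by move=> i _; rewrite mul0r.
Unshelve. all: by end_near. Qed.

Lemma analytic_id (z0 : R[i]) : analytic_at (fun z : R[i] => z) z0.
Proof.
exists (fun k => if k == 0%N then z0 else (k == 1%N)%:R); near=> z.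
apply/cvgC_seqP => e e0; exists 2%N => -[|[|n]]// _.
rewrite 2!big_ord_recl/= expr0 mulr1 mul1r expr1 big1 ?addr0.
  by rewrite addrCA subrr addr0 subrr normc0.
by move=> i _; rewrite mul0r.
Unshelve. all: by end_near. Qed.

Lemma analyticD f g z0 : analytic_at f z0 -> analytic_at g z0 ->
  analytic_at (fun z => f z + g z) z0.
Proof.
move=> [a Ha] [b Hb]; exists (fun k => a k + b k).
apply: filterS2 Ha Hb => z za zb; under eq_fun do
  (under eq_bigr do rewrite mulrDl; rewrite big_split/=).
exact: cvgC_D za zb.
Qed.

Definition convol a b n := \sum_(i < n.+1) a i * b (n - i)%N.

(** The error consists of the products with i + j >= n. Each is at most M M' 8^-n because |h| / r <
    1/8, and there are at most n^2 <= 4^n of them, which leaves 2^-n; hence the radius r / 8 for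
    products. *)
Lemma convol_psum a b M M' r (h : R[i]) n : 0 < r -> 0 <= M -> 0 <= M' ->
  (forall k, normc (a k) * r ^+ k <= M) -> (forall k, normc (b k) * r ^+ k <= M') ->
  normc h < r / 8 ->
  normc (psum (convol a b) h n - psum a h n * psum b h n) <= M * M' * 2^-1 ^+ n.
Proof.
move=> r0 M0 M'0 Ha Hb hr.
have E : psum (convol a b) h n =
  \sum_(i < n) \sum_(j < n | (i + j < n)%N) (a i * h ^+ i) * (b j * h ^+ j).
  rewrite /psum /convol; under eq_bigr do rewrite mulr_suml.
  (* The two sums are exchanged and m = i + j is substituted. *)
  pose G (m i : nat) := a i * b (m - i)%N * h ^+ m.
  rewrite (eq_bigr (fun m : 'I_n => \sum_(i < n | (i <= m)%N) G m i)); last first.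
    move=> m _; rewrite (big_ord_widen_cond n xpredT (fun i => a i * b (m - i)%N * h ^+ m))//.
  rewrite (exchange_big_dep xpredT)//=; apply: eq_bigr => i _.
  rewrite -(big_mkord (fun m => i <= m)%N (fun m => G m i)) -(big_mkord (fun j => i + j < n)%N (fun j => a i * h ^+ i * (b j * h ^+ j))).
  rewrite (big_cat_nat _ (n := i))//= ?(ltnW (ltn_ord i))//.
  rewrite big_nat_cond big_pred0 ?add0r; last by move=> m; case: leqP => //=; case: ltnP.
  rewrite [RHS](big_cat_nat _ (n := (n - i)%N)) ?leq_subr//=.
  rewrite [X in _ = _ + X]big_nat_cond [X in _ = _ + X]big_pred0 ?addr0; last first.
    by move=> m; rewrite leq_subLR leqNgt; case: (i + m < n)%N; rewrite ?andbF.
  rewrite -{1}(add0n (nat_of_ord i)) big_addn big_nat_cond [RHS]big_nat_cond.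
  apply: eq_big => [m|m _]; first by rewrite ltn_subRL leq_addl; case: (_ < _)%N.
  by rewrite /G addnK exprD; ring.
rewrite E /psum mulr_suml -sumrB.
under eq_bigr => i _ do rewrite mulr_sumr [X in _ - X](bigID (fun j : 'I_n => (i + j < n)%N))/= opprD addrA subrr sub0r.
apply: le_trans (ler_normc_sum _ _ _) _.
have t8 : normc h / r < 8^-1 by rewrite ltr_pdivrMr// mulrC.
have t0 : 0 <= normc h / r by rewrite divr_ge0 ?normc_ge0 ?ltW.
have term (c : nat -> R[i]) N k : (forall k, normc (c k) * r ^+ k <= N) ->
    normc (c k * h ^+ k) <= N * 8^-1 ^+ k.
  move=> Hc; rewrite normcM normcX.
  have -> : normc (c k) * normc h ^+ k = (normc (c k) * r ^+ k) * (normc h / r) ^+ k.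
    by rewrite expr_div_n; field; rewrite expf_neq0// gt_eqF.
  by rewrite ler_pM ?mulr_ge0 ?normc_ge0 ?exprn_ge0 ?(ltW r0)// lerXn2r ?nnegrE ?invr_ge0// ltW.
have bd (i : 'I_n) : normc (- \sum_(j < n | ~~ (i + j < n)%N) (a i * h ^+ i * (b j * h ^+ j)))
    <= M * M' * 8^-1 ^+ n *+ n.
  rewrite normcN (le_trans (ler_normc_sum _ _ _))//.
  rewrite -[X in _ *+ X]card_ord -sumr_const [leRHS](bigID (fun j : 'I_n => ~~ (i + j < n)%N))/=.
  rewrite -[leLHS]addr0 lerD//; last by apply: sumr_ge0 => j _; rewrite !mulr_ge0// exprn_ge0// invr_ge0.
  apply: ler_sum => j; rewrite -leqNgt => nij; rewrite normcM.
  apply: le_trans (ler_pM (normc_ge0 _) (normc_ge0 _) (term _ _ _ Ha) (term _ _ _ Hb)) _.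
  rewrite mulrACA -exprD ler_wpM2l ?mulr_ge0//.
  by rewrite ler_wiXn2l// ?invr_ge0// invf_le1// ler1n.
apply: le_trans (ler_sum _ (fun i _ => bd i)) _.
rewrite sumr_const card_ord -mulrnA -[X in X <= _]mulr_natr -!(mulrA (M * M')) ler_wpM2l ?mulr_ge0//.
have n2 : (n%:R : R) <= 2 ^+ n by rewrite -natrX ler_nat ltnW// ltn_expl.
rewrite natrM (_ : 2^-1 ^+ n = 8^-1 ^+ n * (2 ^+ n * 2 ^+ n)).
  by rewrite ler_wpM2l ?exprn_ge0 ?invr_ge0// ler_pM.
by rewrite -!exprMn; congr (_ ^+ _); field.
Qed.

Lemma has_psM a b M M' r f g z0 : has_ps a M r f z0 -> has_ps b M' r g z0 ->
  forall z, normc (z - z0) < r / 8 ->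
  psum (convol a b) (z - z0) @ \oo --> (f z * g z : R[i]^o).
Proof.
move=> fa gb z zr; have M0 := has_ps_M_ge0 fa; have M'0 := has_ps_M_ge0 gb.
case: fa gb => r0 Ha fa [_ Hb gb].
have zr' : normc (z - z0) < r by rewrite (lt_le_trans zr)// ler_pdivrMr// ler_peMr ?ltW// ltr1n.
pose u n := psum (convol a b) (z - z0) n - psum a (z - z0) n * psum b (z - z0) n.
have H : u @ \oo --> (0 : R[i]^o).
  apply: (@cvgC_geo R u 0 (M * M')) => n; rewrite subr0.
  exact: convol_psum r0 _ _ Ha Hb zr.
have -> : psum (convol a b) (z - z0) =
    fun n => u n + psum a (z - z0) n * psum b (z - z0) n.
  by apply/funext => n; rewrite /u subrK.
rewrite -[f z * g z]add0r.
exact: cvgC_D H (cvgC_M (fa z zr') (gb z zr')).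
Qed.

Lemma analyticM f g z0 : analytic_at f z0 -> analytic_at g z0 ->
  analytic_at (fun z => f z * g z) z0.
Proof.
move=> /analytic_has_ps[a [M [r fa]]] /analytic_has_ps[b [M' [r' gb]]].
set s := Num.min r r'.
have s0 : 0 < s by case: fa gb => r0 _ _ [r'0 _ _]; rewrite lt_min r0.
have fa' : has_ps a M s f z0 by apply: has_ps_shrink fa; rewrite ?ge_min ?lexx.
have gb' : has_ps b M' s g z0 by apply: has_ps_shrink gb; rewrite ?ge_min ?lexx ?orbT.
exists (convol a b); apply/nearC_normcP; exists (s / 8); first by rewrite divr_gt0.
exact: has_psM fa' gb'.
Qed.

End PowerSeries.

(** * The reciprocal of a power series *)

Section PowerSeries2.
Variable R : realType.
Implicit Types (a b : nat -> R[i]) (M r : R) (f g : R[i] -> R[i]).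

(** Course-of-values recursion: each coefficient of 1/f depends on all the earlier ones, so the list
    of the first [n] is built; [c] stands for 1 / a_0. *)
Fixpoint inv_coefs a (c : R[i]) (n : nat) : seq R[i] :=
  if n is n'.+1 then
    let s := inv_coefs a c n' in
    rcons s (if n' is 0%N then c else - c * \sum_(i < n') a i.+1 * nth 0 s (n' - i.+1))
  else [::].

Definition inv_coef a n := nth 0 (inv_coefs a (a 0%N)^-1 n.+1) n.

Lemma size_inv_coefs a c n : size (inv_coefs a c n) = n.
Proof. by elim: n => //= n IH; rewrite size_rcons IH. Qed.

Lemma nth_inv_coefs a n m : (m < n)%N ->
  nth 0 (inv_coefs a (a 0%N)^-1 n) m = inv_coef a m.
Proof.
elim: n => // n IH; rewrite ltnS leq_eqVlt => /orP[/eqP->//|mn].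
by rewrite -IH//= nth_rcons size_inv_coefs mn.
Qed.

Lemma inv_coef0 a : inv_coef a 0 = (a 0%N)^-1. Proof. by []. Qed.

Lemma inv_coefS a n :
  inv_coef a n.+1 = - (a 0%N)^-1 * \sum_(i < n.+1) a i.+1 * inv_coef a (n - i).
Proof.
rewrite {1}/inv_coef -[inv_coefs _ _ n.+2]/(rcons (inv_coefs a (a 0%N)^-1 n.+1) _).
rewrite nth_rcons size_inv_coefs ltnn eqxx.
congr (_ * _); apply: eq_bigr => i _.
rewrite subSS; congr (_ * _); apply: (@nth_inv_coefs a n.+1).
by rewrite ltnS leq_subr.
Qed.

Lemma convol_inv a n : a 0%N != 0 -> convol a (inv_coef a) n = (n == 0%N)%:R.
Proof.
move=> a0; case: n => [|n]; rewrite /convol big_ord_recl/= subn0.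
  by rewrite big_ord0 addr0 inv_coef0 divff.
rewrite inv_coefS mulrA mulrN divff// mulN1r.
by under [X in _ + X]eq_bigr do rewrite subSS; rewrite addNr.
Qed.

Lemma sum_half_pow n : \sum_(i < n) (2^-1 : R) ^+ i.+1 = 1 - 2^-1 ^+ n.
Proof.
elim: n => [|n IH]; first by rewrite big_ord0 expr0 subrr.
by rewrite big_ord_recr/= IH exprS; field.
Qed.

(** Strong induction on the recurrence. At radius r q with q = m / (2M) and m = |a_0|, the identity
    M q = m / 2 and q <= 1/2 bound the i-th term by 2^-(i+1); the sum stays below 1, so the bound 1
    / m persists. *)
Lemma inv_coef_bound a M r : 0 < r -> a 0%N != 0 ->
  (forall k, normc (a k) * r ^+ k <= M) ->
  exists K s, [/\ 0 < s, s <= r & forall k, normc (inv_coef a k) * s ^+ k <= K].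
Proof.
move=> r0 a0 Ha; set m := normc (a 0%N).
have m0 : 0 < m by rewrite normc_gt0.
have M0 : 0 <= M by apply: le_trans (Ha 0%N); rewrite expr0 mulr1 ltW.
have mM : m <= M by have := Ha 0%N; rewrite expr0 mulr1.
have M1 : 0 < M by exact: lt_le_trans mM.
pose q := m / (2 * M).
have q0 : 0 < q by rewrite divr_gt0// mulr_gt0.
have q2 : q <= 2^-1 by rewrite /q ler_pdivrMr ?mulr_gt0// mulrA mulVf// mul1r.
have q1 : q <= 1 by rewrite (le_trans q2)// invf_le1// ler1n.
have qM : M * q = m * 2^-1 by rewrite /q; field; rewrite gt_eqF.
exists m^-1, (r * q); split; first by rewrite mulr_gt0.
  by rewrite ler_piMr// ltW.
have H n : forall k, (k < n)%N -> normc (inv_coef a k) * (r * q) ^+ k <= m^-1.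
  elim: n => // n IH k; rewrite ltnS leq_eqVlt => /orP[/eqP->|]; last exact: IH.
  case: n IH => [|n] IH; first by rewrite inv_coef0 normcV expr0 mulr1.
  rewrite inv_coefS normcM normcN normcV -/m -mulrA ler_piMr ?invr_ge0 ?(ltW m0)//.
  apply: le_trans (ler_wpM2r _ (ler_normc_sum _ _ _)) _.
    by rewrite exprn_ge0// mulr_ge0// ltW.
  rewrite mulr_suml.
  have bd (i : 'I_n.+1) : normc (a i.+1 * inv_coef a (n - i)) * (r * q) ^+ n.+1 <=
      (2^-1) ^+ i.+1.
    rewrite normcM.
    have -> : (r * q) ^+ n.+1 = (r ^+ i.+1 * q ^+ i.+1) * (r * q) ^+ (n - i).
      by rewrite -exprMn -exprD addSn subnKC// -ltnS.
    have -> : normc (a i.+1) * normc (inv_coef a (n - i)) *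
        (r ^+ i.+1 * q ^+ i.+1 * (r * q) ^+ (n - i)) =
        (normc (a i.+1) * r ^+ i.+1 * q ^+ i.+1) * (normc (inv_coef a (n - i)) * (r * q) ^+ (n - i)) by ring.
    have h1 : normc (a i.+1) * r ^+ i.+1 * q ^+ i.+1 <= m * 2^-1 ^+ i.+1.
      apply: le_trans (ler_wpM2r (exprn_ge0 _ (ltW q0)) (Ha _)) _.
      rewrite exprS exprS mulrA [m * _]mulrA qM ler_wpM2l ?mulr_ge0 ?invr_ge0 ?(ltW m0)//.
      by rewrite lerXn2r// nnegrE ?invr_ge0// ltW.
    have h2 := IH (n - i)%N (leq_subr _ _).
    have rq0 : 0 <= r * q by rewrite mulr_ge0// ltW.
    apply: le_trans (ler_pM _ _ h1 h2) _.
    - by rewrite !mulr_ge0 ?normc_ge0// exprn_ge0// ltW.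
    - by rewrite mulr_ge0 ?normc_ge0// exprn_ge0.
    by rewrite mulrAC divff ?mul1r// gt_eqF.
  apply: le_trans (ler_sum _ (fun i _ => bd i)) _.
  by rewrite sum_half_pow gerBl exprn_ge0 ?invr_ge0.
by move=> k; apply: (H k.+1).
Qed.
End PowerSeries2.

(** * Termwise differentiation *)

Section Derivative.
Variable R : realType.
Implicit Types (a b : nat -> R[i]) (M r : R) (f g : R[i] -> R[i]).

Definition is_cderive f (z l : R[i]) : Prop :=
  is_derive (z : R[i]^o) (1 : R[i]^o) (f : R[i]^o -> R[i]^o) (l : R[i]^o).

Lemma cderive_bound f (z l : R[i]) (C s : R) : 0 < s ->
  (forall h, normc h < s -> normc (f (z + h) - f z - h * l) <= C * normc h ^+ 2) ->
  is_cderive f z l.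
Proof.
move=> s0 H.
have cv : (fun h : R[i] => h^-1 *: ((f : R[i]^o -> R[i]^o) (h *: (1 : R[i]^o) + z) - f z : R[i]^o))
    @ (0 : R[i]^o)^' --> (l : R[i]^o).
  apply/(@cvgCP R R[i] (0 : R[i]^o)^' _ _ l) => e e0.
  pose d := Num.min s (e / (`|C| + 1)).
  have C0 : 0 < `|C| + 1 by rewrite ltr_wpDl.
  apply/dnearC_normcP; exists d; first by rewrite lt_min s0 divr_gt0.
  move=> h; rewrite subr0 lt_min => /andP[hs he] h0.
  have -> : h^-1 *: ((f : R[i]^o -> R[i]^o) (h *: (1 : R[i]^o) + z) - f z : R[i]^o) - l =
     h^-1 * (f (z + h) - f z - h * l).
    by rewrite mulrBr mulKf// [h *: _]mulr1 [h + z]addrC.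
  rewrite normcM normcV ltr_pdivrMl ?normc_gt0//.
  have hp : 0 < normc h by rewrite normc_gt0.
  apply: le_lt_trans (H h hs) _; rewrite expr2 mulrCA ltr_pM2l//.
  apply: le_lt_trans (_ : normc h * (`|C| + 1) < _); last by rewrite -ltr_pdivlMr.
  by rewrite mulrC ler_wpM2l ?normc_ge0// (le_trans (ler_norm _))// lerDl.
split; first by apply/cvg_ex; exists (l : R[i]^o); exact: cv.
by apply: cvg_lim; [exact: (@norm_hausdorff R[i] R[i]^o)|exact: cv].
Qed.

(** The remainders satisfy D_(k+1) = (x + h) D_k + k h^2 x^(k-1). The base 4 leaves room both for |x
    + h| <= 2s and for k <= 4^k. *)
Lemma pow_taylor_bound (x h : R[i]) (s : R) k : 0 <= s -> normc x <= s -> normc h <= s ->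
  normc ((x + h) ^+ k - x ^+ k - k%:R * h * x ^+ k.-1) * s ^+ 2 <=
  normc h ^+ 2 * (4 * s) ^+ k.
Proof.
move=> s0 xs hs; elim: k => [|k IH].
  by rewrite !expr0 subrr mul0r mul0r subr0 normc0 mul0r mulr1 exprn_ge0 ?normc_ge0.
set D := (_ - _ - _) in IH.
have -> : (x + h) ^+ k.+1 - x ^+ k.+1 - k.+1%:R * h * x ^+ k.+1.-1 =
    (x + h) * D + k%:R * (h ^+ 2 * x ^+ k.-1).
  rewrite /D -pred_Sn -natr1; case: k {IH D} => [|k] /=; last by rewrite !exprS; ring.
  by rewrite expr1 !expr0 expr1; ring.
apply: le_trans (_ : (2 * s * normc D + k%:R * (normc h ^+ 2 * s ^+ k.-1)) * s ^+ 2 <= _).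
  rewrite ler_wpM2r ?exprn_ge0// (le_trans (ler_normcD _ _))// lerD//.
    rewrite normcM ler_wpM2r ?normc_ge0// (le_trans (ler_normcD _ _))//.
    by rewrite mulr_natl mulr2n lerD.
  rewrite !normcM !normcX ler_pM ?normc_ge0 ?mulr_ge0 ?exprn_ge0 ?normc_ge0//.
    have -> : (k%:R : R[i]) = ((k%:R : R)%:C)%C by rewrite rmorph_nat.
    by rewrite normc_real ger0_norm.
  rewrite -expr2 ler_wpM2l ?exprn_ge0 ?normc_ge0// lerXn2r ?nnegrE ?normc_ge0//.
have q0 : 0 <= normc h ^+ 2 by rewrite exprn_ge0 ?normc_ge0.
move: (normc h ^+ 2) (normc D) IH q0 => q d IH q0.
have -> : (2 * s * d + k%:R * (q * s ^+ k.-1)) * s ^+ 2 =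
    2 * s * (d * s ^+ 2) + q * (k%:R * s ^+ k.+1).
  case: k {D IH} => [|k]/=; first by rewrite mul0r addr0; ring.
  by rewrite !exprS; ring.
apply: le_trans (lerD (ler_wpM2l _ IH) (lexx _)) _; first by rewrite mulr_ge0.
have -> : 2 * s * (q * (4 * s) ^+ k) = q * (2 * 4 ^+ k * s ^+ k.+1).
  by rewrite exprMn exprS; ring.
rewrite -mulrDr ler_wpM2l// -mulrDl exprMn ler_wpM2r ?exprn_ge0//.
have : (k%:R : R) <= 4 ^+ k by rewrite -natrX ler_nat ltnW// ltn_expl.
have t0 : 0 <= (4 : R) ^+ k by rewrite exprn_ge0.
by move=> kt; rewrite [4 ^+ k.+1]exprS; lra.
Qed.

Definition dcoef a k := k.+1%:R * a k.+1.

Lemma dcoef_bound a M r k : 0 < r -> (forall k, normc (a k) * r ^+ k <= M) ->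
  normc (dcoef a k) * (r / 2) ^+ k <= 2 * M / r.
Proof.
move=> r0 Ha; rewrite /dcoef normcM.
have -> : (k.+1%:R : R[i]) = ((k.+1%:R : R)%:C)%C by rewrite rmorph_nat.
rewrite normc_real ger0_norm// ler_pdivlMr//.
have -> : k.+1%:R * normc (a k.+1) * (r / 2) ^+ k * r =
   (k.+1%:R / 2 ^+ k) * (normc (a k.+1) * r ^+ k.+1).
  by rewrite expr_div_n exprS; field; rewrite expf_neq0.
rewrite ler_pM ?mulr_ge0 ?divr_ge0 ?normc_ge0 ?exprn_ge0 ?(ltW r0)//.
rewrite ler_pdivrMr ?exprn_gt0// -exprS -natrX ler_nat.
by rewrite ltnW// ltn_expl.
Qed.

(** Domination by the geometric series of ratio 1/2; the limit is assembled from the real and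
    imaginary parts. *)
Lemma psum_cvg a M r (h : R[i]) : 0 < r -> (forall k, normc (a k) * r ^+ k <= M) ->
  normc h < r / 2 -> exists l : R[i], psum a h @ \oo --> (l : R[i]^o).
Proof.
move=> r0 Ha hr.
have term k : normc (a k * h ^+ k) <= geometric M 2^-1 k.
  rewrite normcM normcX /geometric/=.
  have -> : normc (a k) * normc h ^+ k = (normc (a k) * r ^+ k) * (normc h / r) ^+ k.
    by rewrite expr_div_n; field; rewrite expf_neq0// gt_eqF.
  have t0 : 0 <= normc h / r by rewrite divr_ge0 ?normc_ge0 ?ltW.
  rewrite ler_pM ?mulr_ge0 ?normc_ge0 ?exprn_ge0 ?(ltW r0)//.
  by rewrite lerXn2r ?nnegrE ?invr_ge0// ltW// ltr_pdivrMr// mulrC.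
have cvs (F : R[i] -> R) : (forall x, `|F x| <= normc x) ->
    cvgn (series (fun k => F (a k * h ^+ k))).
  move=> HF; apply: normed_cvg.
  apply: (@series_le_cvg _ _ (geometric M 2^-1)) => [k|k|k|]; rewrite ?normr_ge0//.
  - exact: le_trans (normc_ge0 _) (term k).
  - exact: le_trans (HF _) (term k).
  - by apply: is_cvg_geometric_series; rewrite ger0_norm ?invr_ge0// invf_lt1// ltr1n.
have hRe (x : R[i]) : `|complex.Re x| <= normc x.
  by have := normc_ge_Re x; rewrite normC_normc lecR.
have hIm (x : R[i]) : `|complex.Im x| <= normc x.
  case: x => x y /=; rewrite -(sqrtr_sqr y) ler_wsqrtr// lerDr sqr_ge0//.
have /cvg_ex[p pP] := cvs _ hRe; have /cvg_ex[q qP] := cvs _ hIm.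
exists (p +i* q)%C; apply: cvgC_complex.
  apply: cvg_trans pP; apply: near_eq_cvg; near=> n.
  by rewrite /series/= /psum raddf_sum/= big_mkord.
apply: cvg_trans qP; apply: near_eq_cvg; near=> n.
by rewrite /series/= /psum raddf_sum/= big_mkord.
Unshelve. all: by end_near. Qed.

(** The Taylor bounds of the powers are summed over k and passed to the limit: the remainder of [f]
    is at most 2M |h|^2 / (r/8)^2, the series being geometric because 4 (r/8) = r/2. *)
Lemma has_ps_derive a M r f z0 : has_ps a M r f z0 ->
  forall z, normc (z - z0) < r / 8 -> exists2 l : R[i],
    psum (dcoef a) (z - z0) @ \oo --> (l : R[i]^o) & is_cderive f z l.
Proof.
move=> fa; have M0 := has_ps_M_ge0 fa; case: fa => r0 Ha fa z zr.
have r2 : 0 < r / 2 by rewrite divr_gt0.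
have [l lP] : exists l : R[i], psum (dcoef a) (z - z0) @ \oo --> (l : R[i]^o).
  apply: (psum_cvg r2) => [k|]; first exact: dcoef_bound Ha.
  apply: lt_le_trans zr _; rewrite -mulrA -invfM ler_wpM2l ?(ltW r0)//.
  by rewrite lef_pV2 ?posrE// -natrM ler_nat.
exists l; first exact lP.
have s0 : 0 < r / 8 by rewrite divr_gt0.
apply: (@cderive_bound _ _ _ (2 * M / (r / 8) ^+ 2) _ s0) => h hs.
set x := z - z0 in zr lP *.
have sh (u : nat -> R[i]) (l' : R[i]) : u @ \oo --> (l' : R[i]^o) ->
    (fun n => u n.+1) @ \oo --> (l' : R[i]^o).
  move=> /cvgC_seqP H; apply/cvgC_seqP => e /H[N HN]; exists N => n Nn.
  by apply: HN; rewrite leqW.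
have cv1 : (fun n => psum a (x + h) n.+1) @ \oo --> (f (z + h) : R[i]^o).
  apply (sh (psum a (x + h)) (f (z + h))); have -> : x + h = z + h - z0 by rewrite /x addrAC.
  apply: fa; rewrite addrAC (le_lt_trans (ler_normcD _ _))//.
  by apply: lt_le_trans (ltrD zr hs) _; rewrite -mulrDr ler_piMr ?(ltW r0)//; lra.
have cv2 : (fun n => psum a x n.+1) @ \oo --> (f z : R[i]^o).
  apply (sh (psum a x) (f z)); apply: fa; apply: lt_le_trans zr _.
  by rewrite ler_piMr ?(ltW r0)//; lra.
have cv3 : (fun n => h * psum (dcoef a) x n) @ \oo --> (h * l : R[i]^o).
  by have := cvgC_M (@cvgC_cst R h) lP.
have cv : (fun n => psum a (x + h) n.+1 - psum a x n.+1 - h * psum (dcoef a) x n) @ \oo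
    --> (f (z + h) - f z - h * l : R[i]^o).
  by have := cvgC_D (cvgC_D cv1 (cvgC_N cv2)) (cvgC_N cv3).
apply: (@cvgC_le R _ _ _ _ cv) => n.
have -> : psum a (x + h) n.+1 - psum a x n.+1 - h * psum (dcoef a) x n =
   \sum_(k < n.+1) a k * ((x + h) ^+ k - x ^+ k - k%:R * h * x ^+ k.-1).
  rewrite /psum -sumrB [in LHS]big_ord_recl [in RHS]big_ord_recl/= !expr0 subrr add0r.
  rewrite mul0r mul0r subr0 subrr mulr0 add0r mulr_sumr -sumrB.
  by apply: eq_bigr => k _; rewrite /dcoef /bump/= add1n; ring.
apply: le_trans (ler_normc_sum _ _ _) _.
have bd (k : 'I_n.+1) : normc (a k * ((x + h) ^+ k - x ^+ k - k%:R * h * x ^+ k.-1)) <=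
    M / (r / 8) ^+ 2 * normc h ^+ 2 * (2^-1 ^+ k).
  have s20 : 0 < (r / 8) ^+ 2 by rewrite exprn_gt0.
  rewrite normcM -(ler_pM2r s20).
  rewrite -(mulrA (normc (a k))); apply: le_trans (ler_wpM2l (normc_ge0 _) (pow_taylor_bound k (ltW s0) (ltW zr) (ltW hs))) _.
  have -> : normc (a k) * (normc h ^+ 2 * (4 * (r / 8)) ^+ k) =
     (normc (a k) * r ^+ k) * (normc h ^+ 2 * 2^-1 ^+ k).
    have -> : 4 * (r / 8) = r * 2^-1 by field.
    by rewrite exprMn; ring.
  have -> : M / (r / 8) ^+ 2 * normc h ^+ 2 * 2^-1 ^+ k * (r / 8) ^+ 2 =
     M * (normc h ^+ 2 * 2^-1 ^+ k) by field; rewrite gt_eqF.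
  by rewrite ler_wpM2r// mulr_ge0 ?exprn_ge0 ?normc_ge0 ?invr_ge0.
apply: le_trans (ler_sum _ (fun k _ => bd k)) _.
rewrite -mulr_sumr [leRHS](_ : _ = M / (r / 8) ^+ 2 * normc h ^+ 2 * 2); last by ring.
rewrite ler_wpM2l ?mulr_ge0 ?exprn_ge0 ?normc_ge0 ?invr_ge0 ?exprn_ge0 ?(ltW s0)//.
rewrite (_ : \sum_(k < n.+1) _ = 2 * \sum_(k < n.+1) (2^-1 : R) ^+ k.+1); last first.
  by rewrite mulr_sumr; apply: eq_bigr => k _; rewrite exprS mulrA divff// mul1r.
by rewrite sum_half_pow ler_piMr// gerBl exprn_ge0 ?invr_ge0.
Qed.

End Derivative.

(** * Rules of complex differentiation *)

Section Cderive.
Variable R : realType.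
Implicit Types (f g : R[i] -> R[i]) (z l : R[i]).

Definition cder f z : R[i] := derive1 (f : R[i] -> R[i]^o) z.

Lemma is_cderive_cder f z l : is_cderive f z l -> cder f z = l.
Proof. by move=> [_ fl]; rewrite /cder derive1E; exact fl. Qed.

(** No quotient appears, so h = 0 is harmless; this is what lets the chain rule go through where the
    inner increment vanishes. *)
Lemma is_cderiveP f z l : is_cderive f z l <->
  forall e : R, 0 < e -> exists2 d : R, 0 < d &
    forall h, normc h < d -> normc (f (z + h) - f z - h * l) <= e * normc h.
Proof.
pose q (h : R[i]) := h^-1 *: ((f : R[i]^o -> R[i]^o) (h *: (1 : R[i]^o) + z) - f z : R[i]^o).
have qE h : h != 0 -> f (z + h) - f z - h * l = h * (q h - l).
  move=> h0; rewrite mulrBr /q [h *: _]mulr1 [h + z]addrC; congr (_ - _).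
  by rewrite -[LHS](mulVKf h0).
have qP : is_cderive f z l <-> (q h @[h --> (0 : R[i]^o)^'] --> (l : R[i]^o)).
  split=> [[H1 H2]|cv].
    rewrite -H2; exact: H1.
  split; first by apply/cvg_ex; exists (l : R[i]^o); exact: cv.
  by apply: cvg_lim; [exact: (@norm_hausdorff R[i] R[i]^o)|exact: cv].
rewrite qP (@cvgCP R R[i] (0 : R[i]^o)^' _ q l); split=> H e e0.
  have /dnearC_normcP[d d0 Hd] := H e e0; exists d; first exact d0.
  move=> h hd; have [->|h0] := eqVneq h 0.
    by rewrite addr0 subrr mul0r subrr normc0 mulr0.
  rewrite qE// normcM mulrC ler_wpM2r ?normc_ge0//.
  by apply/ltW/Hd => //; rewrite subr0.
have e2 : 0 < e / 2 by rewrite divr_gt0.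
have [d d0 Hd] := H _ e2; apply/dnearC_normcP; exists d; first exact d0.
move=> h; rewrite subr0 => hd h0; have := Hd h hd.
rewrite qE// normcM mulrC ler_pM2r ?normc_gt0// => /le_lt_trans; apply.
by rewrite ltr_pdivrMr// ltr_pMr// ltr1n.
Qed.

Lemma is_cderive_near f g z l : (\forall y \near (z : R[i]^o), f y = g y) ->
  is_cderive f z l -> is_cderive g z l.
Proof.
move=> /nearC_normcP[s s0 fg] /is_cderiveP H; apply/is_cderiveP => e /H[d d0 Hd].
exists (Num.min s d); first by rewrite lt_min s0.
move=> h; rewrite lt_min => /andP[hs hd].
by rewrite -!fg ?subrr ?normc0//; [exact: Hd|rewrite addrC addKr].
Qed.

Lemma cder_near f g z : (\forall y \near (z : R[i]^o), f y = g y) -> cder f z = cder g z.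
Proof.
move=> fg; rewrite /cder !derive1E.
by apply (@near_eq_derive _ R[i]^o R[i]^o f g z 1 fg).
Qed.

Lemma is_cderive_cst (c : R[i]) z : is_cderive (fun=> c) z 0.
Proof. apply (@is_derive_cst _ R[i]^o R[i]^o c z 1). Qed.

Lemma is_cderive_id z : is_cderive (fun x => x) z 1.
Proof. apply (@is_derive_id _ R[i]^o z 1). Qed.

Lemma is_cderiveD f g z l l' : is_cderive f z l -> is_cderive g z l' ->
  is_cderive (fun x => f x + g x) z (l + l').
Proof. move=> h h'; apply (@is_deriveD _ R[i]^o R[i]^o f g z 1 l l' h h'). Qed.

Lemma is_cderiveM f g z l l' : is_cderive f z l -> is_cderive g z l' ->
  is_cderive (fun x => f x * g x) z (l * g z + f z * l').
Proof.
move=> h h'; rewrite addrC [l * _]mulrC.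
apply (@is_deriveM _ R[i]^o (f : _ -> R[i]) g z 1 l l' h h').
Qed.

Lemma is_cderive_sum (I : Type) (r : seq I) (P : pred I) (F : I -> R[i] -> R[i]) z (L : I -> R[i]) :
  (forall i, P i -> is_cderive (F i) z (L i)) ->
  is_cderive (fun x => \sum_(i <- r | P i) F i x) z (\sum_(i <- r | P i) L i).
Proof.
move=> H; elim: r => [|i r IH].
  rewrite big_nil; have -> : (fun x => \sum_(i <- [::] | P i) F i x) = fun=> 0.
    by apply/funext => x; rewrite big_nil.
  exact (is_cderive_cst 0 z).
rewrite big_cons; case: (boolP (P i)) => Pi.
  have -> : (fun x => \sum_(j <- i :: r | P j) F j x) =
      fun x => F i x + \sum_(j <- r | P j) F j x.
    by apply/funext => x; rewrite big_cons Pi.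
  exact (is_cderiveD (H i Pi) IH).
have -> : (fun x => \sum_(j <- i :: r | P j) F j x) =
    fun x => \sum_(j <- r | P j) F j x.
  by apply/funext => x; rewrite big_cons (negbTE Pi).
exact IH.
Qed.

Lemma is_cderiveX n z : is_cderive (fun x => x ^+ n) z (n%:R * z ^+ n.-1).
Proof.
elim: n => [|n IH].
  rewrite mul0r; exact (is_cderive_cst 1 z).
have -> : (fun x : R[i] => x ^+ n.+1) = (fun x => x * x ^+ n).
  by apply/funext => x; rewrite exprS.
have -> : n.+1%:R * z ^+ n.+1.-1 = 1 * z ^+ n + z * (n%:R * z ^+ n.-1).
  by case: n {IH} => [|n]/=; rewrite ?exprS -?natr1; ring.
exact (is_cderiveM (is_cderive_id z) IH).
Qed.

Lemma is_cderive_continuous f z l : is_cderive f z l ->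
  {for z, continuous (f : R[i]^o -> R[i]^o)}.
Proof.
move=> /is_cderiveP /(_ 1 ltr01)[d d0 Hd].
suff H : f x @[x --> (z : R[i]^o)] --> (f z : R[i]^o) by exact H.
apply/(@cvgCP R R[i] (nbhs (z : R[i]^o)) _ f (f z)) => e e0.
have K0 : 0 < 1 + normc l by rewrite ltr_pwDl// normc_ge0.
apply/nearC_normcP; exists (Num.min d (e / (1 + normc l))); first by rewrite lt_min d0 divr_gt0.
move=> y; rewrite lt_min => /andP[yd ye].
have := Hd (y - z) yd; rewrite [z + _]addrC subrK mul1r => H.
have -> : f y - f z = (f y - f z - (y - z) * l) + (y - z) * l by rewrite subrK.
apply: le_lt_trans (ler_normcD _ _) _; rewrite normcM.
apply: le_lt_trans (lerD H (lexx _)) _.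
by rewrite -[X in X + _]mulr1 -mulrDr -ltr_pdivlMr.
Qed.

Lemma is_cderive_comp f g z l l' : is_cderive g z l -> is_cderive f (g z) l' ->
  is_cderive (fun x => f (g x)) z (l' * l).
Proof.
move=> /is_cderiveP gl /is_cderiveP fl; apply/is_cderiveP => e e0.
pose K := 1 + normc l; have K0 : 0 < K by rewrite ltr_pwDl// normc_ge0.
pose K' := 1 + normc l'; have K'0 : 0 < K' by rewrite ltr_pwDl// normc_ge0.
have e1 : 0 < e / 2 / K by rewrite !divr_gt0.
have e2 : 0 < e / 2 / K' by rewrite !divr_gt0.
have [d d0 Hd] := fl _ e1; have [d1 d10 Hd1] := gl _ e2.
have [d2 d20 Hd2] := gl 1 ltr01.
exists (Num.min (d / K) (Num.min d1 d2)); first by rewrite !lt_min divr_gt0// d10.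
move=> h; rewrite !lt_min => /and3P[hd h1 h2].
have [k kE] : exists k, k = g (z + h) - g z by exists (g (z + h) - g z).
have kb : normc k <= K * normc h.
  have -> : k = (k - h * l) + h * l by rewrite subrK.
  apply: le_trans (ler_normcD _ _) _; rewrite /K mulrDl lerD//; first by rewrite kE; exact: Hd2.
  by rewrite normcM mulrC.
have kd : normc k < d by apply: le_lt_trans kb _; rewrite mulrC -ltr_pdivlMr.
have := Hd k kd; rewrite {1}kE [g z + _]addrC subrK => H.
have -> : f (g (z + h)) - f (g z) - h * (l' * l) =
   (f (g (z + h)) - f (g z) - k * l') + (k - h * l) * l' by rewrite mulrBl addrA subrK [l' * l]mulrC mulrA.
apply: le_trans (ler_normcD _ _) _.
rewrite [leRHS](_ : _ = e / 2 * normc h + e / 2 * normc h); last by rewrite -mulrDl -splitr.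
rewrite lerD//.
  apply: le_trans H _; rewrite -(mulrA (e / 2)) ler_wpM2l//; first by rewrite divr_ge0// ltW.
  by rewrite ler_pdivrMl.
rewrite normcM; apply: le_trans (ler_wpM2r (normc_ge0 _) (_ : _ <= e / 2 / K' * normc h)) _.
  by rewrite kE; exact: Hd1.
rewrite -!(mulrA (e / 2)) ler_wpM2l//; first by rewrite divr_ge0// ltW.
rewrite -mulrA ler_pdivrMl// mulrC ler_wpM2r ?normc_ge0//.
by rewrite /K' lerDr.
Qed.

End Cderive.

(** * Analytic functions of one variable *)

Section Analytic.
Variable R : realType.
Implicit Types (f g : R[i] -> R[i]) (z l : R[i]).

Lemma analytic_cderive f z0 : analytic_at f z0 ->
  \forall z \near (z0 : R[i]^o), is_cderive f z (cder f z).
Proof.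
move=> /analytic_has_ps[a [M [r fa]]]; apply/nearC_normcP; exists (r / 8).
  by case: fa => r0 _ _; rewrite divr_gt0.
move=> z zr; have [l _ H] := has_ps_derive fa zr.
by rewrite (is_cderive_cder H); exact H.
Qed.

Lemma analytic_is_cderive f z0 : analytic_at f z0 -> is_cderive f z0 (cder f z0).
Proof. by move=> /analytic_cderive /nbhs_singleton H; exact H. Qed.

Lemma analytic_cder f z0 : analytic_at f z0 -> analytic_at (cder f) z0.
Proof.
move=> /analytic_has_ps[a [M [r fa]]]; exists (dcoef a); apply/nearC_normcP; exists (r / 8).
  by case: fa => r0 _ _; rewrite divr_gt0.
move=> z zr; have [l H1 H2] := has_ps_derive fa zr.
by rewrite (is_cderive_cder H2); exact H1.
Qed.

Lemma analytic_continuous f z0 : analytic_at f z0 ->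
  {for z0, continuous (f : R[i]^o -> R[i]^o)}.
Proof. move=> /analytic_is_cderive H; exact (is_cderive_continuous H). Qed.

Lemma continuousCP f z0 : {for z0, continuous (f : R[i]^o -> R[i]^o)} <->
  forall e : R, 0 < e -> exists2 d : R, 0 < d &
    forall z, normc (z - z0) < d -> normc (f z - f z0) < e.
Proof.
have H : {for z0, continuous (f : R[i]^o -> R[i]^o)} <->
    (f x @[x --> (z0 : R[i]^o)] --> (f z0 : R[i]^o)) by [].
rewrite H (@cvgCP R R[i] (nbhs (z0 : R[i]^o)) _ f (f z0)).
by split=> {}H e e0; apply/nearC_normcP; exact: H.
Qed.

Lemma dnbhsC_point z0 (P : R[i] -> Prop) :
  (\forall z \near (z0 : R[i]^o)^', P z) -> exists2 z, z != z0 & P z.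
Proof.
move=> /dnearC_normcP[d d0 H]; exists (z0 + ((d / 2)%:C)%C).
  by rewrite -subr_eq0 addrC addKr -normc_eq0 normc_real normr_eq0 gt_eqF// divr_gt0.
apply: H; last by rewrite -subr_eq0 addrC addKr -normc_eq0 normc_real normr_eq0 gt_eqF// divr_gt0.
by rewrite addrC addKr normc_real ger0_norm ?ltr_pdivrMr ?ltr_pMr ?ltr1n// divr_ge0// ltW.
Qed.

Lemma continuous_eq_center f g z0 :
  {for z0, continuous (f : R[i]^o -> R[i]^o)} ->
  {for z0, continuous (g : R[i]^o -> R[i]^o)} ->
  (\forall z \near (z0 : R[i]^o)^', f z = g z) -> f z0 = g z0.
Proof.
move=> /continuousCP cf /continuousCP cg fg.
apply/eqP; rewrite -subr_eq0 -normc_eq0; apply/eqP/le_anti; rewrite normc_ge0 andbT.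
apply/ler_addgt0Pr => e e0; rewrite add0r.
have e2 : 0 < e / 2 by rewrite divr_gt0.
have [d d0 Hf] := cf _ e2; have [d' d'0 Hg] := cg _ e2.
have : \forall z \near (z0 : R[i]^o)^', [/\ f z = g z, normc (z - z0) < d & normc (z - z0) < d'].
  have [s s0 Hs] := (dnearC_normcP _ _).1 fg.
  apply/dnearC_normcP; exists (Num.min s (Num.min d d')); first by rewrite !lt_min s0 d0.
  by move=> y; rewrite !lt_min => /and3P[ys yd yd'] yz; split => //; exact: Hs.
move=> /dnbhsC_point[z _ [E /Hf h /Hg h']].
have -> : f z0 - g z0 = - (f z - f z0) + (g z - g z0) by rewrite E; ring.
by apply: le_trans (ler_normcD _ _) _; rewrite normcN [e]splitr lerD// ltW.
Qed.

Lemma analytic_eq_center f g z0 : analytic_at f z0 -> analytic_at g z0 ->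
  (\forall z \near (z0 : R[i]^o)^', f z = g z) -> f z0 = g z0.
Proof. by move=> /analytic_continuous cf /analytic_continuous cg; exact: continuous_eq_center. Qed.

Lemma analytic_neq0_near f z0 : analytic_at f z0 -> f z0 != 0 ->
  \forall z \near (z0 : R[i]^o), f z != 0.
Proof.
move=> /analytic_continuous/continuousCP cf f0.
have [|d d0 H] := cf (normc (f z0)); first by rewrite normc_gt0.
apply/nearC_normcP; exists d => // z /H; apply: contraTneq => ->.
by rewrite sub0r normcN ltxx.
Qed.

(** The Cauchy product of the two series is 1, so the products of their partial sums tend to 1;
    dividing by the partial sums of [f], which are non-zero from some index on, gives convergence to
    1 / f(z). *)
Lemma analyticV f z0 : analytic_at f z0 -> f z0 != 0 ->
  analytic_at (fun z => (f z)^-1) z0.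
Proof.
move=> fan f0; have /analytic_has_ps[a [M [r fa]]] := fan.
have a0 : a 0%N != 0 by rewrite -(has_ps_center fa).
have [r0 Ha _] := fa.
have [K [s [s0 sr HK]]] := inv_coef_bound r0 a0 Ha.
have K0 : 0 <= K by apply: le_trans (HK 0%N); rewrite expr0 mulr1 normc_ge0.
have [_ Ha' fa'] := has_ps_shrink s0 sr fa.
have [d d0 fn0] := (nearC_normcP _ _).1 (analytic_neq0_near fan f0).
exists (inv_coef a); apply/nearC_normcP; exists (Num.min d (s / 8)).
  by rewrite lt_min d0 divr_gt0.
move=> z; rewrite lt_min => /andP[zd zs].
have zs' : normc (z - z0) < s.
  by rewrite (lt_le_trans zs)// ler_pdivrMr// ler_peMr ?(ltW s0)// ler1n.
have fz0 := fn0 z zd; set h := z - z0.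
have cv0 : (fun n => psum (convol a (inv_coef a)) h n - psum a h n * psum (inv_coef a) h n)
   @ \oo --> (0 : R[i]^o).
  apply (@cvgC_geo R _ 0 (M * K)) => n; rewrite subr0.
  exact: (convol_psum n s0 (has_ps_M_ge0 fa) K0 Ha' HK zs).
have cv1 : (psum (convol a (inv_coef a)) h) @ \oo --> (1 : R[i]^o).
  apply/cvgC_seqP => e e0; exists 1%N => -[//|n] _.
  rewrite /psum big_ord_recl/= expr0 mulr1 big1 ?addr0; last first.
    by move=> i _; rewrite convol_inv// mul0r.
  by rewrite convol_inv// subrr normc0.
have cv2 : (fun n => psum a h n * psum (inv_coef a) h n) @ \oo --> (1 : R[i]^o).
  have := cvgC_D cv1 (cvgC_N cv0); rewrite subr0.
  by under eq_fun do rewrite opprB addrC subrK.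
have cva : psum a h @ \oo --> (f z : R[i]^o) := fa' z zs'.
have cv3 : (fun n => (psum a h n)^-1) @ \oo --> ((f z)^-1 : R[i]^o).
  apply (@cvgV R[i] nat \oo _ (psum a h : nat -> R[i]^o) (f z) fz0 cva).
have cv4 := cvgC_M cv3 cv2; rewrite mulr1 in cv4.
have fzp : 0 < normc (f z) by rewrite normc_gt0.
have [N HN] := (cvgC_seqP _ _).1 cva _ fzp.
apply/cvgC_seqP => e e0; have [N' HN'] := (cvgC_seqP _ _).1 cv4 e e0.
exists (maxn N N') => n; rewrite geq_max => /andP[Nn N'n].
have := HN' n N'n; rewrite mulKf//; apply: contraTneq (HN n Nn) => ->.
by rewrite sub0r normcN ltxx.
Qed.

Lemma analytic_sum (I : Type) (r : seq I) (P : pred I) (F : I -> R[i] -> R[i]) z0 :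
  (forall i, P i -> analytic_at (F i) z0) ->
  analytic_at (fun z => \sum_(i <- r | P i) F i z) z0.
Proof.
move=> H; elim: r => [|i r IH].
  by under eq_fun do rewrite big_nil; exact: analytic_cst.
under eq_fun do rewrite big_cons; case: (boolP (P i)) => Pi; last exact IH.
exact (analyticD (H i Pi) IH).
Qed.

Lemma analytic_prod (I : Type) (r : seq I) (P : pred I) (F : I -> R[i] -> R[i]) z0 :
  (forall i, P i -> analytic_at (F i) z0) ->
  analytic_at (fun z => \prod_(i <- r | P i) F i z) z0.
Proof.
move=> H; elim: r => [|i r IH].
  by under eq_fun do rewrite big_nil; exact: analytic_cst.
under eq_fun do rewrite big_cons; case: (boolP (P i)) => Pi; last exact IH.
exact (analyticM (H i Pi) IH).
Qed.

Lemma analyticX f n z0 : analytic_at f z0 -> analytic_at (fun z => f z ^+ n) z0.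
Proof.
move=> fa; elim: n => [|n IH]; first exact: analytic_cst.
by under eq_fun do rewrite exprS; exact: analyticM.
Qed.

Lemma analyticN f z0 : analytic_at f z0 -> analytic_at (fun z => - f z) z0.
Proof.
move=> fa; under eq_fun do rewrite -mulN1r.
exact: analyticM (analytic_cst _ _) fa.
Qed.

Lemma analyticB f g z0 : analytic_at f z0 -> analytic_at g z0 ->
  analytic_at (fun z => f z - g z) z0.
Proof. by move=> fa /analyticN; exact: analyticD. Qed.

(** The quotient receives the value a_m at 0 by hand; the shifted series converges to it. *)
Lemma analytic_drop a M (r : R) f m : has_ps a M r f 0 ->
  (forall k, (k < m)%N -> a k = 0) ->
  exists g, [/\ analytic_at g 0, g 0 = a m &
    \forall z \near (0 : R[i]^o), f z = z ^+ m * g z].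
Proof.
move=> fa am; pose g z := if z == 0 then a m else f z / z ^+ m.
have [r0 Ha H] := fa; exists g; split; last 1 first.
- apply/nearC_normcP; exists r => // z; rewrite subr0 => zr.
  rewrite /g; case: eqVneq => [->|z0]; last by rewrite mulrC divfK// expf_neq0.
  rewrite (has_ps_center fa); case: m am {g} => [_|m am]; first by rewrite expr0 mul1r.
  by rewrite am// expr0n mul0r.
- exists (fun k => a (m + k)%N); apply/nearC_normcP; exists r; first exact: r0.
  move=> z; rewrite subr0 => zr; rewrite /g; case: eqVneq => [->|z0].
    apply/cvgC_seqP => e e0; exists 1%N => -[//|n] _.
    rewrite big_ord_recl/= expr0 mulr1 addn0 big1 ?addr0 ?subrr ?normc0//.
    by move=> i _; rewrite expr0n/= mulr0.
  have zm : z ^+ m != 0 by rewrite expf_neq0.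
  have cv := H z; rewrite subr0 in cv; have {}cv := cv zr.
  have cv1 : (fun n => psum a z (m + n)) @ \oo --> (f z : R[i]^o).
    apply/cvgC_seqP => e e0; have [N HN] := (cvgC_seqP _ _).1 cv e e0.
    by exists N => n Nn; apply: HN; rewrite (leq_trans Nn)// leq_addl.
  have := cvgC_M cv1 (@cvgC_cst R (z ^+ m)^-1).
  rewrite (_ : (fun n => _) = fun n => \sum_(k < n) a (m + k)%N * z ^+ k); first by [].
  apply/funext => n; rewrite /psum big_split_ord/= big1 ?add0r => [|i _]; last by rewrite am// mul0r.
  by rewrite mulr_suml; apply: eq_bigr => k _; rewrite exprD mulrCA mulrAC divff// mul1r.
- by rewrite /g eqxx.
Qed.

(** Either all the Taylor coefficients vanish, or the first non-zero one gives the order. *)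
Lemma analytic_order f : analytic_at f 0 ->
  (\forall z \near (0 : R[i]^o), f z = 0) \/
  exists m g, [/\ analytic_at g 0, g 0 != 0 &
    \forall z \near (0 : R[i]^o), f z = z ^+ m * g z].
Proof.
move=> /analytic_has_ps[a [M [r fa]]].
have [H|] := pselect (forall k, a k = 0).
  left; case: fa => r0 _ fa; apply/nearC_normcP; exists r => // z zr.
  apply: (cvgC_uniq (fa z zr)); apply/cvgC_seqP => e e0; exists 0%N => n _.
  by rewrite /psum big1 ?subr0 ?normc0// => i _; rewrite H mul0r.
move=> /existsNP H; right.
have ex : exists k, a k != 0 by case: H => k /eqP; exists k.
have [g [ga g0 gE]] : exists g, [/\ analytic_at g 0, g 0 = a (ex_minn ex) &
    \forall z \near (0 : R[i]^o), f z = z ^+ (ex_minn ex) * g z].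
  apply: analytic_drop fa _ => k; case: ex_minnP => m _ Hm km.
  by apply/eqP; apply: contraTT km => /Hm; rewrite -leqNgt.
exists (ex_minn ex), g; split => //; rewrite g0; by case: ex_minnP.
Qed.

Lemma analytic_div f : analytic_at f 0 -> f 0 = 0 ->
  exists g, analytic_at g 0 /\ \forall z \near (0 : R[i]^o), f z = z * g z.
Proof.
move=> /analytic_has_ps[a [M [r fa]]] f0.
have [|g [ga _ gE]] := analytic_drop (m := 1%N) fa.
  by case=> // _; rewrite -(has_ps_center fa).
by exists g.
Qed.

End Analytic.

(** * Matrices of germs *)

Section Sylvester.
Variables (K : closedFieldType).

Lemma horner_mx_intertwine m n (B : 'M[K]_n.+1) (C : 'M[K]_m.+1) (P : 'M[K]_(m.+1, n.+1)) q :
  P *m B = C *m P -> P *m horner_mx B q = horner_mx C q *m P.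
Proof.
move=> PB; elim/poly_ind: q => [|q c IH]; first by rewrite !rmorph0 mulmx0 mul0mx.
rewrite !rmorphD !rmorphM /= !horner_mx_X !horner_mx_C mulmxDr mulmxDl.
by rewrite -!mulmxE mulmxA IH -!mulmxA PB -[in RHS]scalar_mxC.
Qed.

(** Sylvester's argument: with no common eigenvalue, the characteristic polynomial chi of [C] takes
    an invertible value at [B], while P chi(B) = chi(C) P = 0 by Cayley-Hamilton, so P = 0. *)
Lemma intertwine_eigenvalue m n (B : 'M[K]_n.+1) (C : 'M[K]_m.+1) (P : 'M[K]_(m.+1, n.+1)) :
  P *m B = C *m P -> P != 0 -> exists2 a, eigenvalue B a & eigenvalue C a.
Proof.
move=> PB P0; have [rs rsE] := closed_field_poly_normal (char_poly C).
rewrite (monicP (char_poly_monic C)) scale1r in rsE.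
have := horner_mx_intertwine (char_poly C) PB.
rewrite Cayley_Hamilton mul0mx => H.
have [Hall|] := boolP (all (fun a => ~~ eigenvalue B a) rs); last first.
  move=> /allPn[a ars]; rewrite negbK => Ba; exists a => //.
  by rewrite eigenvalue_root_char rsE root_prod_XsubC.
suff U : horner_mx B (char_poly C) \in unitmx.
  by move: P0; rewrite -(mulmxK U P) H mul0mx eqxx.
rewrite rsE; elim: rs Hall {rsE H} => [|a rs IH] /=.
  by move=> _; rewrite big_nil rmorph1 unitmx1.
move=> /andP[Ha Hrs]; rewrite big_cons rmorphM /= -mulmxE unitmx_mul IH// andbT.
rewrite rmorphB /= horner_mx_X horner_mx_C -row_free_unit -kermx_eq0.
by move: Ha; rewrite /eigenvalue negbK.
Qed.

End Sylvester.

(** * Analytic matrix functions and their derivatives *)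

Section Germs.
Variable R : realType.
Local Notation C := R[i].
Implicit Types (f g : C -> C) (z l : C).

Lemma nearC_forall (I : finType) (P : I -> C -> Prop) (z0 : C) :
  (forall i, \forall z \near (z0 : R[i]^o), P i z) ->
  \forall z \near (z0 : R[i]^o), forall i, P i z.
Proof. exact: (@filter_forall C I P _ (nbhs_filter (z0 : R[i]^o))). Qed.

Definition an_mx m n (A : C -> 'M[C]_(m, n)) (z0 : C) : Prop :=
  forall i j, analytic_at (fun z => A z i j) z0.

Definition cder_mx m n (A : C -> 'M[C]_(m, n)) (z : C) : 'M[C]_(m, n) :=
  \matrix_(i, j) cder (fun y => A y i j) z.

Definition is_cder_mx m n (A : C -> 'M[C]_(m, n)) (z : C) (A' : 'M[C]_(m, n)) : Prop :=
  forall i j, is_cderive (fun y => A y i j) z (A' i j).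

Lemma is_cder_mx_cder m n (A : C -> 'M[C]_(m, n)) z A' : is_cder_mx A z A' -> cder_mx A z = A'.
Proof. by move=> H; apply/matrixP => i j; rewrite mxE; apply: is_cderive_cder. Qed.

Lemma is_cder_mx_near m n (A B : C -> 'M[C]_(m, n)) z A' :
  (\forall y \near (z : R[i]^o), A y = B y) -> is_cder_mx A z A' -> is_cder_mx B z A'.
Proof.
move=> AB H i j; apply: is_cderive_near (H i j).
by apply: filterS AB => y ->.
Qed.

Lemma cder_mx_near m n (A B : C -> 'M[C]_(m, n)) z :
  (\forall y \near (z : R[i]^o), A y = B y) -> cder_mx A z = cder_mx B z.
Proof.
move=> AB; apply/matrixP => i j; rewrite [LHS]mxE [RHS]mxE.
have ABij : \forall y \near (z : R[i]^o), A y i j = B y i j by apply: filterS AB => y ->.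
exact (cder_near ABij).
Qed.

Lemma is_cder_mxM m n p (A : C -> 'M[C]_(m, n)) (B : C -> 'M[C]_(n, p)) z A' B' :
  is_cder_mx A z A' -> is_cder_mx B z B' ->
  is_cder_mx (fun y => A y *m B y) z (A' *m B z + A z *m B').
Proof.
move=> HA HB i j; rewrite !mxE -big_split/=.
under [X in is_cderive X]eq_fun do rewrite mxE.
apply: is_cderive_sum => k _; exact (is_cderiveM (HA i k) (HB k j)).
Qed.

Lemma is_cder_mxZ m n (f : C -> C) (B : C -> 'M[C]_(m, n)) z l B' :
  is_cderive f z l -> is_cder_mx B z B' ->
  is_cder_mx (fun y => f y *: B y) z (l *: B z + f z *: B').
Proof.
move=> Hf HB i j; rewrite !mxE; under [X in is_cderive X]eq_fun do rewrite mxE.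
exact (is_cderiveM Hf (HB i j)).
Qed.

Lemma is_cder_mxD m n (A B : C -> 'M[C]_(m, n)) z A' B' :
  is_cder_mx A z A' -> is_cder_mx B z B' ->
  is_cder_mx (fun y => A y + B y) z (A' + B').
Proof.
move=> HA HB i j; rewrite !mxE; under [X in is_cderive X]eq_fun do rewrite mxE.
exact (is_cderiveD (HA i j) (HB i j)).
Qed.

Lemma is_cder_mx_cst m n (A : 'M[C]_(m, n)) z : is_cder_mx (fun=> A) z 0.
Proof. move=> i j; rewrite mxE; exact (is_cderive_cst (A i j) z). Qed.

Lemma an_mx_is_cder m n (A : C -> 'M[C]_(m, n)) z0 : an_mx A z0 ->
  \forall z \near (z0 : R[i]^o), is_cder_mx A z (cder_mx A z).
Proof.
move=> H; have : \forall z \near (z0 : R[i]^o),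
    forall ij : 'I_m * 'I_n, is_cderive (fun y => A y ij.1 ij.2) z (cder (fun y => A y ij.1 ij.2) z).
  apply (@nearC_forall _ (fun (ij : 'I_m * 'I_n) z => is_cderive (fun y => A y ij.1 ij.2) z (cder (fun y => A y ij.1 ij.2) z))) => ij.
  exact (analytic_cderive (H ij.1 ij.2)).
apply: filterS => z Hz i j; rewrite mxE; exact (Hz (i, j)).
Qed.

Lemma an_mx_cder m n (A : C -> 'M[C]_(m, n)) z0 : an_mx A z0 -> an_mx (cder_mx A) z0.
Proof.
move=> H i j; under eq_fun do rewrite mxE.
exact (analytic_cder (H i j)).
Qed.

Lemma an_mxM m n p (A : C -> 'M[C]_(m, n)) (B : C -> 'M[C]_(n, p)) z0 :
  an_mx A z0 -> an_mx B z0 -> an_mx (fun y => A y *m B y) z0.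
Proof.
move=> HA HB i j; under eq_fun do rewrite mxE.
apply: analytic_sum => k _; exact (analyticM (HA i k) (HB k j)).
Qed.

Lemma an_mxD m n (A B : C -> 'M[C]_(m, n)) z0 :
  an_mx A z0 -> an_mx B z0 -> an_mx (fun y => A y + B y) z0.
Proof.
move=> HA HB i j; under eq_fun do rewrite mxE.
exact (analyticD (HA i j) (HB i j)).
Qed.

Lemma an_mxZ m n f (B : C -> 'M[C]_(m, n)) z0 :
  analytic_at f z0 -> an_mx B z0 -> an_mx (fun y => f y *: B y) z0.
Proof.
move=> HA HB i j; under eq_fun do rewrite mxE.
exact (analyticM HA (HB i j)).
Qed.

Lemma an_mxN m n (B : C -> 'M[C]_(m, n)) z0 :
  an_mx B z0 -> an_mx (fun y => - B y) z0.
Proof.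
move=> HB i j; under eq_fun do rewrite mxE.
exact (analyticN (HB i j)).
Qed.

Lemma an_mx_cst m n (A : 'M[C]_(m, n)) z0 : an_mx (fun=> A) z0.
Proof. move=> i j; exact (analytic_cst (A i j) z0). Qed.

Lemma an_det n (A : C -> 'M[C]_n) z0 : an_mx A z0 -> analytic_at (fun z => \det (A z)) z0.
Proof.
move=> HA; rewrite /determinant; apply: analytic_sum => s _.
apply: analyticM; first exact (analytic_cst _ _).
apply: analytic_prod => i _; exact (HA _ _).
Qed.

Lemma an_adj n (A : C -> 'M[C]_n) z0 : an_mx A z0 -> an_mx (fun z => \adj (A z)) z0.
Proof.
move=> HA i j; under eq_fun do rewrite mxE /cofactor.
apply: analyticM; first exact (analytic_cst _ _).
apply: an_det => k l; under eq_fun do rewrite !mxE.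
exact (HA _ _).
Qed.

Lemma an_mx_eq_center m n (A B : C -> 'M[C]_(m, n)) z0 : an_mx A z0 -> an_mx B z0 ->
  (\forall z \near (z0 : R[i]^o)^', A z = B z) -> A z0 = B z0.
Proof.
move=> HA HB AB; apply/matrixP => i j; apply: (analytic_eq_center (HA i j) (HB i j)).
by apply: filterS AB => z ->.
Qed.

Lemma an_mx_div m n (A : C -> 'M[C]_(m, n)) : an_mx A 0 -> A 0 = 0 ->
  exists2 B, an_mx B 0 & \forall z \near (0 : R[i]^o), A z = z *: B z.
Proof.
move=> HA A0.
have /choice[G HG] (ij : 'I_m * 'I_n) : exists g, analytic_at g 0 /\
    \forall z \near (0 : R[i]^o), A z ij.1 ij.2 = z * g z.
  by apply: analytic_div (HA _ _) _; rewrite A0 mxE.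
exists (fun z => \matrix_(i, j) G (i, j) z).
  by move=> i j; under eq_fun do rewrite mxE; exact: (HG (i, j)).1.
have : \forall z \near (0 : R[i]^o), forall ij : 'I_m * 'I_n, A z ij.1 ij.2 = z * G ij z.
  apply (@nearC_forall _ (fun (ij : 'I_m * 'I_n) z => A z ij.1 ij.2 = z * G ij z)) => ij.
  exact: (HG ij).2.
by apply: filterS => z H; apply/matrixP => i j; rewrite !mxE (H (i, j)).
Qed.

Lemma dnearC_near z0 (P : C -> Prop) : (\forall z \near (z0 : R[i]^o)^', P z) ->
  \forall z \near (z0 : R[i]^o)^', \forall y \near (z : R[i]^o), P y.
Proof.
move=> /dnearC_normcP[d d0 H]; apply/dnearC_normcP; exists d => // z zd zz.
apply/nearC_normcP; exists (Num.min (d - normc (z - z0)) (normc (z - z0))).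
  by rewrite lt_min subr_gt0 zd normc_gt0 subr_eq0.
move=> y; rewrite lt_min ltrBrDr => /andP[y1 y2]; apply: H.
  have -> : y - z0 = (y - z) + (z - z0) by rewrite addrA subrK.
  exact: le_lt_trans (ler_normcD _ _) y1.
by apply: contraTneq y2 => ->; rewrite normcBC ltxx.
Qed.

Lemma dnearC_neq z0 : \forall z \near (z0 : R[i]^o)^', z != z0.
Proof. by apply/dnearC_normcP; exists 1. Qed.

Lemma nearC_dnearC z0 (P : C -> Prop) : (\forall z \near (z0 : R[i]^o), P z) ->
  \forall z \near (z0 : R[i]^o)^', P z.
Proof. by move=> /nearC_normcP[d d0 H]; apply/dnearC_normcP; exists d => // z zd _; exact: H. Qed.

Lemma dnearC_center z0 (P : C -> Prop) : (\forall z \near (z0 : R[i]^o)^', P z) ->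
  P z0 -> \forall z \near (z0 : R[i]^o), P z.
Proof.
move=> /dnearC_normcP[d d0 H] P0; apply/nearC_normcP; exists d => // z zd.
by have [->//|zz] := eqVneq z z0; exact: H.
Qed.

Lemma analyticXz (m : int) z : z != 0 -> analytic_at (fun x => x ^ m) z.
Proof.
move=> z0; case: m => n; first exact (analyticX n (analytic_id z)).
by apply (analyticV (analyticX n.+1 (analytic_id z))); rewrite expf_neq0.
Qed.

Lemma is_cderiveXz (m : int) z : z != 0 ->
  is_cderive (fun x => x ^ m) z (m%:~R * z ^ m / z).
Proof.
move=> z0; case: m => n.
  have -> : n%:~R * z ^ n / z = n%:R * z ^+ n.-1.
    case: n => [|n]; first by rewrite !mul0r.
    by rewrite exprSz -mulrA mulrAC divff// mul1r.
  exact (is_cderiveX n z).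
(* The derivative of a negative power is read off from the product rule for x^(n+1) x^-(n+1) = 1. *)
have /analytic_is_cderive := analyticXz (Negz n) z0; set l := cder _ _ => H.
suff <- : l = (Negz n)%:~R * z ^ Negz n / z by exact H.
have H1 := is_cderiveM (is_cderiveX n.+1 z) H.
have /is_cderive_cder : is_cderive (fun=> 1) z (n.+1%:R * z ^+ n.+1.-1 * z ^ Negz n + z ^+ n.+1 * l).
  apply: is_cderive_near H1.
  by apply: filterS (analytic_neq0_near (analytic_id z) z0) => y y0; rewrite divff// expf_neq0.
rewrite (is_cderive_cder (is_cderive_cst 1 z)) => /esym E.
have zn : z ^+ n.+1 != 0 by rewrite expf_neq0.
apply: (mulfI zn); have -> : z ^+ n.+1 * l = - (n.+1%:R * z ^+ n * z ^ Negz n).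
  by apply/eqP; rewrite -addr_eq0 addrC; apply/eqP.
have -> : (Negz n)%:~R = - n.+1%:R :> C by rewrite NegzE mulrNz.
have -> : z ^ Negz n = (z ^+ n.+1)^-1 by [].
by rewrite exprS; field; rewrite z0 expf_neq0.
Qed.

End Germs.

(** * Meromorphic germs and gauge transformations *)

Section Mero.
Variable R : realType.
Local Notation C := R[i].
Implicit Types (f g : C -> C) (z l : C).

Lemma dnearC_and (z0 : C) (P Q : C -> Prop) :
  (\forall z \near (z0 : R[i]^o)^', P z) -> (\forall z \near (z0 : R[i]^o)^', Q z) ->
  \forall z \near (z0 : R[i]^o)^', P z /\ Q z.
Proof. by apply: filterS2 => z. Qed.

(** One power of z serves all the entries, and the value at 0 is left free: such germs are compared
    on punctured discs only. *)
Definition mero_mx m n (S : C -> 'M[C]_(m, n)) : Prop :=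
  exists (k : int) (G : C -> 'M[C]_(m, n)),
    an_mx G 0 /\ \forall z \near (0 : R[i]^o)^', S z = z ^ k *: G z.

Lemma mero_mx_near m n (S T : C -> 'M[C]_(m, n)) :
  (\forall z \near (0 : R[i]^o)^', S z = T z) -> mero_mx S -> mero_mx T.
Proof.
move=> ST [k [G [HG SG]]]; exists k, G; split; first exact HG.
by apply: filterS2 ST SG => z ->.
Qed.

Lemma an_mero_mx m n (S : C -> 'M[C]_(m, n)) : an_mx S 0 -> mero_mx S.
Proof.
move=> H; exists 0, S; split; first exact H.
by apply: filterS (dnearC_neq _) => z _; rewrite expr0z scale1r.
Qed.

Lemma mero_mxM m n p (S : C -> 'M[C]_(m, n)) (T : C -> 'M[C]_(n, p)) :
  mero_mx S -> mero_mx T -> mero_mx (fun z => S z *m T z).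
Proof.
move=> [k [G [HG SG]]] [l [H [HH TH]]]; exists (k + l), (fun z => G z *m H z).
split; first exact (an_mxM HG HH).
near=> z; have z0 : z != 0 by near: z; exact: dnearC_neq.
rewrite (near SG z) // (near TH z) //.
by rewrite -scalemxAl -scalemxAr scalerA expfzDr.
Unshelve. all: by end_near. Qed.

Lemma mero_mxXz m n (k : int) (S : C -> 'M[C]_(m, n)) :
  mero_mx S -> mero_mx (fun z => z ^ k *: S z).
Proof.
move=> [l [G [HG SG]]]; exists (k + l), G; split; first exact HG.
near=> z; have z0 : z != 0 by near: z; exact: dnearC_neq.
by rewrite (near SG z) // scalerA expfzDr.
Unshelve. all: by end_near. Qed.

Lemma mero_mxZ m n f (S : C -> 'M[C]_(m, n)) :
  analytic_at f 0 -> mero_mx S -> mero_mx (fun z => f z *: S z).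
Proof.
move=> Hf [l [G [HG SG]]]; exists l, (fun z => f z *: G z).
split; first exact (an_mxZ Hf HG).
by apply: filterS SG => z ->; rewrite !scalerA mulrC.
Qed.

Lemma mero_mxD m n (S T : C -> 'M[C]_(m, n)) :
  mero_mx S -> mero_mx T -> mero_mx (fun z => S z + T z).
Proof.
move=> [k [G [HG SG]]] [l [H [HH TH]]].
wlog kl : k l S T G H HG HH SG TH / k <= l.
  move=> W; have [kl|/ltW lk] := lerP k l; first exact: (W k l S T G H).
  apply: mero_mx_near (W l k T S H G HH HG TH SG lk).
  by apply: filterS (dnearC_neq _) => z _; rewrite addrC.
have [d dE] : exists d : nat, l - k = d.
  by exists `|l - k|%N; rewrite gez0_abs ?subr_ge0.
exists k, (fun z => G z + z ^+ d *: H z); split.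
  exact (an_mxD HG (an_mxZ (analyticX d (analytic_id 0)) HH)).
near=> z; have z0 : z != 0 by near: z; exact: dnearC_neq.
rewrite (near SG z) // (near TH z) // scalerDr scalerA.
have -> : z ^ k * z ^+ d = z ^ l by rewrite -[z ^+ d]/(z ^ (Posz d)) -dE -expfzDr// addrC subrK.
by [].
Unshelve. all: by end_near. Qed.

(** Product rule z (z^k P)' = z^k (k P + z P'): a factor z^k shifts a residue by k. *)
Lemma scaler_expfz_leibniz m n (k : int) z (P P' : 'M[C]_(m, n)) : z != 0 ->
  z *: ((k%:~R * z ^ k / z) *: P + z ^ k *: P') = z ^ k *: (k%:~R *: P + z *: P').
Proof.
move=> z0; have e : z * (k%:~R * z ^ k / z) = z ^ k * k%:~R by rewrite mulrC divfK// mulrC.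
rewrite [LHS]scalerDr [RHS]scalerDr (scalerA z (_ / _)) e -(scalerA (z ^ k)).
by rewrite (scalerA z) [z * _]mulrC -scalerA.
Qed.

Lemma mero_mx_is_cder_form m n (S G : C -> 'M[C]_(m, n)) (k : int) : an_mx G 0 ->
  (\forall z \near (0 : R[i]^o)^', S z = z ^ k *: G z) ->
  \forall z \near (0 : R[i]^o)^',
    is_cder_mx S z ((k%:~R * z ^ k / z) *: G z + z ^ k *: cder_mx G z).
Proof.
move=> /an_mx_is_cder/nearC_dnearC HG /dnearC_near SG; near=> z.
have z0 : z != 0 by near: z; exact: dnearC_neq.
have Sz : \forall y \near (z : R[i]^o), y ^ k *: G y = S y.
  by apply: filterS (near SG z _) => // y ->.
apply: (is_cder_mx_near Sz); apply: is_cder_mxZ; first exact (is_cderiveXz k z0).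
by near: z; exact HG.
Unshelve. all: by end_near. Qed.

Lemma mero_mx_is_cder m n (S : C -> 'M[C]_(m, n)) : mero_mx S ->
  \forall z \near (0 : R[i]^o)^', is_cder_mx S z (cder_mx S z).
Proof.
move=> [k [G [HG SG]]]; have := mero_mx_is_cder_form HG SG.
by apply: filterS => z H; rewrite (is_cder_mx_cder H); exact H.
Qed.

Lemma mero_mx_cder m n (S : C -> 'M[C]_(m, n)) : mero_mx S -> mero_mx (cder_mx S).
Proof.
move=> [k [G [HG SG]]]; exists (k - 1), (fun z => k%:~R *: G z + z *: cder_mx G z).
split.
  exact (an_mxD (an_mxZ (analytic_cst _ _) HG) (an_mxZ (analytic_id 0) (an_mx_cder HG))).
have := mero_mx_is_cder_form HG SG; apply: filterS2 (dnearC_neq _) => z z0 H.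
rewrite (is_cder_mx_cder H) scalerDr !scalerA expfzDr// exprN1.
by rewrite divfK// -[k%:~R * _ / _]mulrA [k%:~R * _]mulrC.
Qed.

(** Fix an entry of [G] that is not identically zero, of order q. As long as G(0) = 0, a factor z
    moves from [G] into the power of z and q drops, so at most q steps are needed. *)
Lemma mero_mx_leading m n (S : C -> 'M[C]_(m, n)) : mero_mx S ->
  (\forall z \near (0 : R[i]^o)^', S z = 0) \/
  exists (k : int) (G : C -> 'M[C]_(m, n)), [/\ an_mx G 0, G 0 != 0 &
    \forall z \near (0 : R[i]^o)^', S z = z ^ k *: G z].
Proof.
move=> [k [G [HG SG]]].
have [H|] := pselect (forall ij : 'I_m * 'I_n, \forall z \near (0 : R[i]^o), G z ij.1 ij.2 = 0).
  left; have /nearC_dnearC H' := nearC_forall H.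
  apply: filterS2 SG H' => z -> Gz; rewrite [G z](_ : _ = 0) ?scaler0//.
  by apply/matrixP => i j; rewrite mxE (Gz (i, j)).
move=> /existsNP[[i j] /= nG]; right.
have [//|[q [g [ga g0 gE]]]] := analytic_order (HG i j).
elim: q k G HG SG {nG} gE => [|q IH] k G HG SG gE.
  exists k, G; split => //; apply: contraNneq g0 => G0.
  have := nbhs_singleton gE; rewrite G0 mxE expr0 mul1r => <-; exact: eqxx.
have [G0|] := eqVneq (G 0) 0; last by exists k, G.
have [H HH HE] := an_mx_div HG G0.
have dG : \forall z \near (0 : R[i]^o)^', H z i j = z ^+ q * g z.
  near=> z; have z0 : z != 0 by near: z; exact: dnearC_neq.
  apply: (mulfI z0); rewrite mulrA -exprS -(near (nearC_dnearC gE) z)//.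
  by rewrite (near (nearC_dnearC HE) z)// mxE.
apply: (IH (k + 1) H HH); last first.
  apply: (dnearC_center dG); apply: (analytic_eq_center (HH i j) _ dG).
  exact (analyticM (analyticX q (analytic_id 0)) ga).
near=> z; have z0 : z != 0 by near: z; exact: dnearC_neq.
by rewrite (near SG z)// (near (nearC_dnearC HE) z)// scalerA expfzDr// expr1z.
Unshelve. all: by end_near. Qed.

(** Cramer's rule: the determinant does not vanish identically, hence is z^q times a unit, and the
    inverse is the adjugate divided by it. *)
Lemma mero_invmx n (S : C -> 'M[C]_n) : mero_mx S ->
  (\forall z \near (0 : R[i]^o)^', S z \in unitmx) -> mero_mx (fun z => invmx (S z)).
Proof.
move=> [k [G [HG SG]]] U.
have UG : \forall z \near (0 : R[i]^o)^', G z \in unitmx.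
  near=> z; have z0 : z != 0 by near: z; exact: dnearC_neq.
  have := near U z; rewrite (near SG z)// unitmxZ ?unitfE ?expfz_neq0//; exact.
have [H|[q [g [ga g0 gE]]]] := analytic_order (an_det HG).
  have /dnbhsC_point[z _] : \forall z \near (0 : R[i]^o)^', False.
    apply: filterS2 (nearC_dnearC H) UG => z.
    by rewrite unitmxE unitfE => ->; rewrite eqxx.
  by [].
exists (- k - q%:Z), (fun z => (g z)^-1 *: \adj (G z)); split.
  exact (an_mxZ (analyticV ga g0) (an_adj HG)).
near=> z; have z0 : z != 0 by near: z; exact: dnearC_neq.
have Gz : G z \in unitmx by near: z.
have Sz : S z \in unitmx by near: z.
rewrite (near SG z)// invmxZ ?unitfE ?expfz_neq0//; last first.
  by rewrite -(near SG z).
rewrite /invmx Gz scalerA (near (nearC_dnearC gE) z)// invfM !scalerA; congr (_ *: _).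
by rewrite expfzDr// -!invr_expz mulrA.
Unshelve. all: by end_near. Qed.

(* Compare leading coefficients: if [S = z^k G] with [G 0 != 0] then
   [G 0 *m (A 0 + k) = A' 0 *m G 0], so [A 0 + k] and [A' 0] share an eigenvalue. *)
Lemma gauge_analytic m n (A : C -> 'M[C]_n.+1) (A' : C -> 'M[C]_m.+1)
    (S : C -> 'M[C]_(m.+1, n.+1)) :
  an_mx A 0 -> an_mx A' 0 -> mero_mx S ->
  (\forall z \near (0 : R[i]^o)^', z *: cder_mx S z + S z *m A z = A' z *m S z) ->
  (forall a a' (k : int), eigenvalue (A 0) a -> eigenvalue (A' 0) a' ->
     a + k%:~R = a' -> k = 0) ->
  exists P, [/\ an_mx P 0, \forall z \near (0 : R[i]^o)^', S z = P z &
     P 0 *m A 0 = A' 0 *m P 0].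
Proof.
move=> HA HA' HS E spec.
have [S0|[k [P [HP P0 SP]]]] := mero_mx_leading HS.
  exists (fun=> 0); split; [exact (an_mx_cst 0 0)|exact S0|].
  by rewrite mul0mx mulmx0.
have E' : \forall z \near (0 : R[i]^o)^',
    k%:~R *: P z + z *: cder_mx P z + P z *m A z = A' z *m P z.
  have W := dnearC_and (dnearC_and E SP) (dnearC_and (dnearC_neq 0) (mero_mx_is_cder_form HP SP)).
  apply: filterS W => z [[Ez Sz] [z0 Dz]].
  have zk : z ^ k != 0 by rewrite expfz_neq0.
  apply: (can_inj (scalerK zk)).
  move: Ez; rewrite (is_cder_mx_cder Dz) Sz -scalemxAr -scalemxAl (scaler_expfz_leibniz k _ _ z0) => <-.
  by rewrite -scalerDr.
have E0 : P 0 *m (A 0 + k%:~R%:M) = A' 0 *m P 0.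
  rewrite -(an_mx_eq_center _ _ E'); last exact (an_mxM HA' HP).
    by rewrite scale0r addr0 mulmxDr mul_mx_scalar addrC.
  exact (an_mxD (an_mxD (an_mxZ (analytic_cst _ _) HP)
    (an_mxZ (analytic_id 0) (an_mx_cder HP))) (an_mxM HP HA)).
have [a Ha Ha'] := intertwine_eigenvalue E0 P0.
have k0 : k = 0.
  apply: (spec (a - k%:~R) a _ _ Ha' (subrK _ _)).
  have /eigenvalueP[v vA v0] := Ha; apply/eigenvalueP; exists v => //.
  by rewrite scalerBl -vA mulmxDr mul_mx_scalar addrK.
exists P; split; first exact HP.
  by apply: filterS SP => z ->; rewrite k0 expr0z scale1r.
by rewrite -E0 k0 mulmxDr mul_mx_scalar scale0r addr0.
Unshelve. all: by end_near. Qed.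

(** The inverse of [S] solves the equation with [A] and [A'] exchanged, so both extend analytically,
    and their values at 0 are inverse to each other. *)
Lemma gauge_unit n (A A' S : C -> 'M[C]_n.+1) :
  an_mx A 0 -> an_mx A' 0 -> mero_mx S ->
  (\forall z \near (0 : R[i]^o)^', S z \in unitmx) ->
  (\forall z \near (0 : R[i]^o)^', z *: cder_mx S z + S z *m A z = A' z *m S z) ->
  (forall a a' (k : int), eigenvalue (A 0) a -> eigenvalue (A' 0) a' ->
     a + k%:~R = a' -> k = 0) ->
  exists P, [/\ an_mx P 0, \forall z \near (0 : R[i]^o)^', S z = P z,
     P 0 \in unitmx & P 0 *m A 0 = A' 0 *m P 0].
Proof.
move=> HA HA' HS U E spec.
have [P [HP SP PA]] := gauge_analytic HA HA' HS E spec.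
have HS' := mero_invmx HS U.
have [I IE] : exists I : C -> 'M[C]_n.+1, I = fun z => invmx (S z) by exists (fun z => invmx (S z)).
rewrite -IE in HS'.
have ES z : I z = invmx (S z) by rewrite IE.
have DS := mero_mx_is_cder HS; have DI := mero_mx_is_cder HS'.
have E' : \forall z \near (0 : R[i]^o)^', z *: cder_mx I z + I z *m A' z = A z *m I z.
  have W := dnearC_and (dnearC_and DS DI) (dnearC_and (dnearC_and U (dnearC_near U)) E).
  apply: filterS W => z [[D1 D2] [[Sz Un] Ez]].
  have D3 : cder_mx S z *m I z + S z *m cder_mx I z = 0.
    rewrite -(is_cder_mx_cder (is_cder_mxM D1 D2)).
    rewrite -(is_cder_mx_cder (is_cder_mx_cst (1%:M : 'M[C]_n.+1) z)).
    by apply: cder_mx_near; apply: filterS Un => y Uy; rewrite ES mulmxV.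
  rewrite ES in D3 *.
  move: (cder_mx S z) (cder_mx I z) Ez D3 => D D' Ez D3.
  have DE : D = - (S z *m D' *m S z).
    move/eqP: D3; rewrite addr_eq0 => /eqP/(congr1 (fun M => M *m S z)).
    by rewrite mulmxKV// mulNmx.
  have D'E : D' = - (invmx (S z) *m D *m invmx (S z)).
    by rewrite DE mulmxN mulNmx opprK -!mulmxA mulmxV// mulmx1 mulKmx.
  have -> : A' z = (z *: D + S z *m A z) *m invmx (S z) by rewrite Ez mulmxK.
  rewrite D'E mulmxDl mulmxDr -!mulmxA mulKmx// -!scalemxAl -scalemxAr.
  by rewrite scalerN addrA addNr add0r.
have [|Q [HQ SQ _]] := gauge_analytic HA' HA HS' E'.
  move=> a a' k Ha Ha' aa; apply/eqP; rewrite -oppr_eq0; apply/eqP.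
  by apply: (spec a' a _ Ha' Ha); rewrite -aa rmorphN /= addrK.
exists P; split=> //.
have : P 0 *m Q 0 = 1%:M.
  apply: an_mx_eq_center (an_mxM HP HQ) (an_mx_cst _ _) _.
  near=> z; rewrite -(near SP z)// -(near SQ z)// ES mulmxV//.
  by near: z; exact U.
by case/mulmx1_unit.
Unshelve. all: by end_near. Qed.

End Mero.

(** * Regular singular systems *)

Section ModZ.
Variable R : realType.
Local Notation C := R[i].
Implicit Types (f g : C -> C) (z l : C).

(** Frobenius recursion with leading coefficient [x]. The next correction x' z^(M+1) must satisfy x'
    (A(0) - al + M + 1) = - q(0), which is solvable because al - (M+1) is not an eigenvalue. A
    finite order of approximation suffices for comparing leading coefficients. *)
Lemma truncated_solution n (A : C -> 'M[C]_n.+1) (al : C) (x : 'rV[C]_n.+1) :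
  an_mx A 0 -> x *m A 0 = al *: x ->
  (forall j : nat, ~~ eigenvalue (A 0) (al - j.+1%:R)) ->
  forall M : nat, exists y q : C -> 'rV[C]_n.+1, [/\ an_mx y 0, y 0 = x, an_mx q 0 &
    \forall z \near (0 : R[i]^o)^',
      z *: cder_mx y z + y z *m A z - al *: y z = z ^+ M.+1 *: q z].
Proof.
move=> HA xA nev; elim=> [|M [y [q [Hy y0 Hq E]]]].
  have [||q Hq qE] := @an_mx_div R _ _ (fun z => x *m A z - al *: x).
  - exact (an_mxD (an_mxM (an_mx_cst x 0) HA) (an_mx_cst _ 0)).
  - by rewrite xA subrr.
  exists (fun=> x), q; split; [exact (an_mx_cst x 0)|reflexivity|exact Hq|].
  apply: filterS (nearC_dnearC qE) => z qz; rewrite expr1 -qz.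
  by rewrite (is_cder_mx_cder (is_cder_mx_cst x z)) scaler0 add0r.
pose U : 'M[C]_n.+1 := A 0 - (al - M.+1%:R)%:M.
have UU : U \in unitmx.
  by rewrite -row_free_unit -kermx_eq0; move: (nev M); rewrite /eigenvalue negbK.
pose x' := - (q 0 *m invmx U).
have x'U : x' *m A 0 - al *: x' + M.+1%:R *: x' = - q 0.
  have -> : - q 0 = x' *m U by rewrite mulNmx mulmxKV.
  by rewrite /U mulmxBr mul_mx_scalar scalerBl opprB [in RHS]addrA [in RHS]addrAC.
have [||q' Hq' q'E] := @an_mx_div R _ _ (fun z => q z + (M.+1%:R *: x' + x' *m A z - al *: x')).
- exact (an_mxD Hq (an_mxD (an_mxD (an_mx_cst _ 0) (an_mxM (an_mx_cst x' 0) HA)) (an_mx_cst _ 0))).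
- by rewrite -addrA [M.+1%:R *: _ + _]addrC x'U addrN.
exists (fun z => y z + z ^+ M.+1 *: x'), q'; split.
- exact (an_mxD Hy (an_mxZ (analyticX M.+1 (analytic_id 0)) (an_mx_cst x' 0))).
- by rewrite expr0n scale0r addr0.
- exact Hq'.
have W := dnearC_and E (dnearC_and (nearC_dnearC (an_mx_is_cder Hy)) (nearC_dnearC q'E)).
apply: filterS W => z [Ez [Dy q'z]].
rewrite (is_cder_mx_cder (is_cder_mxD Dy (is_cder_mxZ (is_cderiveX M.+1 z) (is_cder_mx_cst x' z)))).
have -> : z ^+ M.+2 *: q' z = z ^+ M.+1 *: (z *: q' z) by rewrite scalerA -exprSr.
have d1 : z *: ((M.+1%:R * z ^+ M.+1.-1) *: x' + z ^+ M.+1 *: 0) = z ^+ M.+1 *: (M.+1%:R *: x').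
  by rewrite scaler0 addr0 !scalerA -pred_Sn mulrCA -exprS mulrC.
have d2 : (y z + z ^+ M.+1 *: x') *m A z = y z *m A z + z ^+ M.+1 *: (x' *m A z).
  by rewrite mulmxDl -scalemxAl.
have d3 : al *: (y z + z ^+ M.+1 *: x') = al *: y z + z ^+ M.+1 *: (al *: x').
  by rewrite scalerDr !scalerA mulrC.
rewrite -q'z [z *: (cder_mx y z + _)]scalerDr d1 d2 d3 [RHS]scalerDr -Ez scalerBr scalerDr.
by rewrite opprD (addrACA (z *: _)) (addrACA (z *: _ + _)).
Qed.

(* A truncated solution [y] of [z y' + y A = al y] transports to [u = y S^-1],
   whose leading coefficient is an eigenvector of [A' 0]. *)
Lemma eigenvalue_mod_Z n (A A' S : C -> 'M[C]_n.+1) (al : C) :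
  an_mx A 0 -> an_mx A' 0 -> mero_mx S ->
  (\forall z \near (0 : R[i]^o)^', S z \in unitmx) ->
  (\forall z \near (0 : R[i]^o)^', z *: cder_mx S z + S z *m A z = A' z *m S z) ->
  eigenvalue (A 0) al -> (forall j : nat, ~~ eigenvalue (A 0) (al - j.+1%:R)) ->
  exists k : int, eigenvalue (A' 0) (al - k%:~R).
Proof.
move=> HA HA' HS U E /eigenvalueP[x xA x0] nev.
have [c1 [G1 [HG1 SG1]]] := mero_invmx HS U.
have [c2 [G2 [HG2 SG2]]] := HS.
(* [M] is so large that the error z^(M+1) q, carried through the inverse of [S] (divisible by z^c1),
   vanishes to higher order than [u], whose leading exponent will be at most - c2. *)
pose mx : int := Num.max 0 (- c2 - c1); pose M := `|mx|%N.
have Mge : - c2 <= M%:Z + c1.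
  by rewrite /M gez0_abs /mx ?le_max ?lexx// -lerBlDr le_max lexx orbT.
have [y [q [Hy y0 Hq Ey]]] := truncated_solution HA xA nev M.
have [u uE] : exists u : C -> 'rV[C]_n.+1, forall z, u z = y z *m invmx (S z).
  by exists (fun z => y z *m invmx (S z)).
have Hu : mero_mx u.
  apply: (mero_mx_near _ (mero_mxM (an_mero_mx Hy) (mero_invmx HS U))).
  by apply: filterS U => z _; rewrite uE.
have uS : \forall z \near (0 : R[i]^o)^', y z = u z *m S z.
  by apply: filterS U => z Uz; rewrite uE mulmxKV.
have [u0|[k [P [HP P0 uP]]]] := mero_mx_leading Hu.
  exfalso; move/eqP: x0; apply; rewrite -y0.
  apply: (an_mx_eq_center Hy (an_mx_cst 0 0)).
  by apply: filterS2 uS u0 => z -> ->; rewrite mul0mx.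
(* Otherwise y = u S would vanish at 0, against y(0) = x. *)
have kc : k <= - c2.
  rewrite leNgt; apply/negP => ck.
  have [d dE] : exists d : nat, k + c2 = d.+1%:Z by exists `|(k + c2 - 1)%R|%N; lia.
  move/eqP: x0; apply; rewrite -y0.
  have HZ : an_mx (fun z => z ^+ d.+1 *: (P z *m G2 z)) 0.
    exact (an_mxZ (analyticX d.+1 (analytic_id 0)) (an_mxM HP HG2)).
  rewrite (an_mx_eq_center Hy HZ) ?expr0n ?scale0r//.
  have W := dnearC_and uS (dnearC_and uP (dnearC_and SG2 (dnearC_neq 0))).
  apply: filterS W => z [-> [-> [-> z0]]].
  by rewrite -scalemxAl -scalemxAr scalerA -expfzDr// dE.
exists k.
have [d dE] : exists d : nat, M.+1%:Z + c1 - k = d.+1%:Z by exists `|(M%:Z + c1 - k)%R|%N; lia.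
have E' : \forall z \near (0 : R[i]^o)^',
    k%:~R *: P z + z *: cder_mx P z + P z *m A' z - al *: P z = z ^+ d.+1 *: (q z *m G1 z).
  have W := dnearC_and (dnearC_and Ey (dnearC_and E (dnearC_and uP SG1)))
    (dnearC_and (dnearC_and (dnearC_neq 0) U)
      (dnearC_and (dnearC_and (mero_mx_is_cder Hu) (mero_mx_is_cder HS))
        (dnearC_and (dnearC_near uS) (mero_mx_is_cder_form HP uP)))).
  apply: filterS W => z [[Ez [ESz [uPz SG1z]]] [[z0 Uz] [[Du DS] [uSn Df]]]].
  have zk : z ^ k != 0 by rewrite expfz_neq0.
  apply: (can_inj (scalerK zk)).
  have yz : y z = u z *m S z := nbhs_singleton uSn.
  have Dy : cder_mx y z = cder_mx u z *m S z + u z *m cder_mx S z.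
    by rewrite (cder_mx_near uSn) (is_cder_mx_cder (is_cder_mxM Du DS)).
  have H1 : (z *: cder_mx u z + u z *m A' z - al *: u z) *m S z = z ^+ M.+1 *: q z.
    rewrite -Ez Dy yz mulmxBl mulmxDl -!scalemxAl -!mulmxA -ESz.
    by rewrite mulmxDr scalerDr -scalemxAr !addrA.
  have H2 : z *: cder_mx u z + u z *m A' z - al *: u z = z ^ k *: (z ^+ d.+1 *: (q z *m G1 z)).
    rewrite -[LHS](mulmxK Uz) H1 SG1z -scalemxAl -scalemxAr !scalerA; congr (_ *: _).
    rewrite -[z ^+ M.+1]/(z ^ (Posz M.+1)) -[z ^+ d.+1]/(z ^ (Posz d.+1)) -!expfzDr//.
    by rewrite -dE; congr (z ^ _); lia.
  rewrite -H2 (is_cder_mx_cder Df) uPz -scalemxAl.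
  rewrite (scaler_expfz_leibniz k _ _ z0).
  have -> : al *: (z ^ k *: P z) = z ^ k *: (al *: P z) by rewrite !scalerA mulrC.
  by rewrite -scalerDr -scalerBr.
have HL := an_mxD (an_mxD (an_mxD (an_mxZ (analytic_cst k%:~R 0) HP)
  (an_mxZ (analytic_id 0) (an_mx_cder HP))) (an_mxM HP HA'))
  (an_mxN (an_mxZ (analytic_cst al 0) HP)).
have HR := an_mxZ (analyticX d.+1 (analytic_id 0)) (an_mxM Hq HG1).
(* At z = 0 the relation becomes k P(0) + P(0) A'(0) = al P(0). *)
have := an_mx_eq_center HL HR E'; rewrite expr0n !scale0r addr0 => E0.
apply/eigenvalueP; exists (P 0); last exact P0.
by rewrite scalerBl -(subr0_eq E0) addrC addKr.
Qed.

End ModZ.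

Section MeroMore.
Variable R : realType.
Local Notation C := R[i].

Lemma dnearC_forall (I : finType) (P : I -> C -> Prop) (z0 : C) :
  (forall i, \forall z \near (z0 : R[i]^o)^', P i z) ->
  \forall z \near (z0 : R[i]^o)^', forall i, P i z.
Proof. exact: (@filter_forall C I P _ (dnbhs_filter (z0 : R[i]^o))). Qed.

Lemma mero_mx_cst m n (M : 'M[C]_(m, n)) : mero_mx (fun _ : C => M).
Proof. exact (an_mero_mx (an_mx_cst M 0)). Qed.

Lemma mero_mx_sum m n (I : Type) (r : seq I) (F : I -> C -> 'M[C]_(m, n)) :
  (forall i, mero_mx (F i)) -> mero_mx (fun z => \sum_(i <- r) F i z).
Proof.
move=> H; elim: r => [|i r IH].
  by under eq_fun do rewrite big_nil; exact (mero_mx_cst 0).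
by under eq_fun do rewrite big_cons; exact (mero_mxD (H i) IH).
Qed.

Lemma mero_mx_rows m n (s : 'I_m -> C -> 'rV[C]_n) :
  (forall i, mero_mx (s i)) -> mero_mx (fun z => \matrix_(i < m) s i z).
Proof.
move=> H.
have -> : (fun z => \matrix_(i < m) s i z) =
    fun z => \sum_(i <- enum 'I_m) (delta_mx i 0 : 'cV[C]_m) *m s i z.
  apply/funext => z; apply/matrixP => i j; rewrite summxE mxE big_enum/= (bigD1 i)//=.
  rewrite !mxE big_ord1 !mxE !eqxx mul1r big1 ?addr0// => k ki.
  by rewrite !mxE big_ord1 !mxE eq_sym (negbTE ki) mul0r.
by apply: mero_mx_sum => i; exact (mero_mxM (mero_mx_cst _) (H i)).
Qed.

Lemma is_cder_mx_sum m n (I : Type) (r : seq I) (F : I -> C -> 'M[C]_(m, n)) z F' :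
  (forall i, is_cder_mx (F i) z (F' i)) ->
  is_cder_mx (fun z => \sum_(i <- r) F i z) z (\sum_(i <- r) F' i).
Proof.
move=> H; elim: r => [|i r IH].
  by under eq_fun do rewrite big_nil; rewrite big_nil; exact (is_cder_mx_cst _ _).
by under eq_fun do rewrite big_cons; rewrite big_cons; exact (is_cder_mxD (H i) IH).
Qed.

End MeroMore.

(** * Shearing a scalar equation into a logarithmic system *)

Section Shear.
Variable R : realType.
Local Notation C := R[i].
Variable w : nat.
Local Notation r := w.+1.
Variable A : C -> 'M[C]_r.
Hypothesis HA : an_mx A 0.

(** Covariant derivative along z d/dz, in the coordinates of a frame with connection matrix [A]. *)
Definition theta (v : C -> 'rV[C]_r) (z : C) : 'rV[C]_r := z *: cder_mx v z + v z *m A z.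

Lemma theta_near v v' z : (\forall y \near (z : R[i]^o), v y = v' y) ->
  theta v z = theta v' z.
Proof. by move=> H; rewrite /theta (cder_mx_near H) (nbhs_singleton H). Qed.

Lemma theta_dnear v v' : (\forall y \near (0 : R[i]^o)^', v y = v' y) ->
  \forall z \near (0 : R[i]^o)^', theta v z = theta v' z.
Proof. by move=> /dnearC_near; apply: filterS => z; exact: theta_near. Qed.

Lemma theta_mero v : mero_mx v -> mero_mx (theta v).
Proof.
move=> Hv; apply: mero_mxD (mero_mxM Hv (an_mero_mx HA)).
exact (mero_mxZ (analytic_id 0) (mero_mx_cder Hv)).
Qed.

Lemma theta_sum n (c : 'I_n -> C) (u : 'I_n -> C -> 'rV[C]_r) : (forall i, mero_mx (u i)) ->
  \forall z \near (0 : R[i]^o)^',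
    theta (fun z => \sum_(i < n) c i *: u i z) z = \sum_(i < n) c i *: theta (u i) z.
Proof.
move=> Hu; have := dnearC_forall (fun i => mero_mx_is_cder (Hu i)).
apply: filterS => z H; rewrite /theta.
have D i : is_cder_mx (fun z => c i *: u i z) z (0 *: u i z + c i *: cder_mx (u i) z).
  exact (is_cder_mxZ (is_cderive_cst (c i) z) (H i)).
rewrite (is_cder_mx_cder (is_cder_mx_sum (index_enum 'I_n) D)) scaler_sumr mulmx_suml -big_split/=.
apply: eq_bigr => i _; rewrite scale0r add0r scalerDr !scalerA -scalemxAl.
by congr (_ + _); rewrite mulrC.
Qed.

Lemma theta_Xz (k : int) u : mero_mx u ->
  \forall z \near (0 : R[i]^o)^',
    theta (fun z => z ^ k *: u z) z = z ^ k *: (k%:~R *: u z + theta u z).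
Proof.
move=> Hu; have := dnearC_and (mero_mx_is_cder Hu) (dnearC_neq 0).
apply: filterS => z [H z0]; rewrite /theta.
rewrite (is_cder_mx_cder (is_cder_mxZ (is_cderiveXz k z0) H)).
by rewrite (scaler_expfz_leibniz k _ _ z0) -scalemxAl -scalerDr addrA.
Qed.

Variables (v0 : C -> 'rV[C]_r) (m : nat -> C) (f : nat -> int) (b : nat -> C -> C).
Hypothesis Hv0 : mero_mx v0.
Let vv j := iter j theta v0.
Hypothesis Hb : forall j, (j < r)%N -> analytic_at (b j) 0.
Hypothesis HE : \forall z \near (0 : R[i]^o)^',
  vv r z + \sum_(j < r) b j z *: vv j z = 0.
Hypothesis Hind : 'X^r + \sum_(j < r) b j 0 *: 'X^j = \prod_(j < r) ('X - (m j)%:P).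
Hypothesis HU : \forall z \near (0 : R[i]^o)^', \matrix_(j < r) vv j z \in unitmx.
Hypothesis fS : forall i, (i < w)%N -> f i <= f i.+1.
(* The last row of the matrix of [theta] involves the powers [z ^ (f j - f w + 1)]. *)
Hypothesis fw : forall i, (i <= w)%N -> f w <= f i + 1.

Let p k : {poly C} := \prod_(j < k) ('X - (m j)%:P).

(** These are p_k(theta) v0, with p_k the k-th partial product of the indicial polynomial: constant
    coefficients keep the change between them and the iterates of theta constant. *)
Fixpoint shear_t (k : nat) : C -> 'rV[C]_r :=
  if k is k'.+1 then fun z => theta (shear_t k') z - m k' *: shear_t k' z else v0.
Local Notation t := shear_t.

Lemma iter_theta_mero j : mero_mx (vv j).
Proof. by elim: j => [|j IH] //; exact (theta_mero IH). Qed.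

Lemma shear_t_mero j : mero_mx (t j).
Proof.
elim: j => [|j IH]; first exact Hv0.
apply: mero_mxD (theta_mero IH) _.
apply: (mero_mx_near _ (mero_mxZ (analytic_cst (- m j) 0) IH)).
by apply: filterS (dnearC_neq 0) => z _; rewrite scaleNr.
Qed.

Lemma indicial_partS k : p k.+1 = p k * 'X - m k *: p k.
Proof. by rewrite /p big_ord_recr/= mulrBr [_ * (m k)%:P]mulrC mul_polyC. Qed.

Lemma size_indicial_part k : size (p k) = k.+1.
Proof. by rewrite /p size_prod_XsubC /index_enum -enumT size_enum_ord. Qed.

Lemma shear_tE k : \forall z \near (0 : R[i]^o)^',
  t k z = \sum_(j < k.+1) (p k)`_j *: vv j z.
Proof.
elim: k => [|k IH].
  apply: filterS (dnearC_neq 0) => z _.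
  by rewrite /p big_ord1 big_ord0 coef1 scale1r.
have W := dnearC_and IH (dnearC_and (theta_dnear IH)
  (theta_sum (fun j : 'I_k.+1 => (p k)`_j) (fun j => iter_theta_mero j))).
apply: filterS W => z [tE [thE H]] /=; rewrite thE H tE indicial_partS.
under [RHS]eq_bigr do rewrite coefB coefZ coefMX scalerBl.
rewrite [RHS]sumrB; congr (_ - _).
  by rewrite [RHS]big_ord_recl/= scale0r add0r.
rewrite [RHS]big_ord_recr/= nth_default ?size_indicial_part// mulr0 scale0r addr0 scaler_sumr.
by apply: eq_bigr => j _; rewrite scalerA.
Qed.

(** The relation theta t_i = m_i t_i + t_(i+1) inverts the triangular expansion. The coefficients
    live on all of [nat], zero past [j], so that the sum can be extended to a fixed range. *)
Lemma iter_thetaE j : exists c : nat -> C, (forall i, (j < i)%N -> c i = 0) /\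
  \forall z \near (0 : R[i]^o)^', vv j z = \sum_(i < j.+1) c i *: t i z.
Proof.
elim: j => [|j [c [c0 H]]].
  exists (fun i => (i == 0%N)%:R); split; first by case.
  by apply: filterS (dnearC_neq 0) => z _; rewrite big_ord1 scale1r.
exists (fun i => (if i is i'.+1 then c i' else 0) + c i * m i); split.
  by case=> // i ji; rewrite !c0 ?mul0r ?addr0// leqW.
have W := dnearC_and (theta_dnear H) (theta_sum (fun i : 'I_j.+1 => c i) (fun i => shear_t_mero i)).
apply: filterS W => z [thE E].
rewrite -[vv j.+1 z]/(theta (vv j) z) thE E.
under [RHS]eq_bigr do rewrite scalerDl.
rewrite [RHS]big_split/= [X in _ = X + _]big_ord_recl/= scale0r add0r.
rewrite [X in _ = _ + X]big_ord_recr/= c0// mul0r scale0r addr0 -big_split/=.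
by apply: eq_bigr => i _; rewrite -scalerA -scalerDr subrK.
Qed.

Lemma iter_theta_sum_shear_t (j : 'I_r) : exists c : 'I_r -> C,
  \forall z \near (0 : R[i]^o)^', vv j z = \sum_(i < r) c i *: t i z.
Proof.
have [c [c0 H]] := iter_thetaE j; exists (fun i => c i).
apply: filterS H => z ->.
rewrite (big_ord_widen_cond r xpredT (fun i => c i *: t i z)) ?ltn_ord//=.
rewrite big_mkcond/=; apply: eq_bigr => i _; case: ltnP => // ji.
by rewrite c0// scale0r.
Qed.

(** [p r] is the indicial polynomial, so subtracting the equation leaves the coefficients b_j(0) -
    b_j(z), which vanish at 0. The factor z gained here is what tolerates a twist f_j one less than
    f_w. *)
Lemma shear_t_last : exists be : 'I_r -> C -> C, (forall i, analytic_at (be i) 0) /\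
  \forall z \near (0 : R[i]^o)^', t r z = \sum_(i < r) (z * be i z) *: t i z.
Proof.
have /choice[c cE] := iter_theta_sum_shear_t.
have pr (j : nat) : (p r)`_j = (j == r)%:R + (if (j < r)%N then b j 0 else 0).
  rewrite /p -Hind coefD coefXn coef_sum; congr (_ + _).
  under eq_bigr do rewrite coefZ coefXn.
  case: ltnP => jr.
    rewrite (bigD1 (Ordinal jr))//= eqxx mulr1 big1 ?addr0// => i.
    by rewrite -val_eqE/= eq_sym => /negbTE ->; rewrite mulr0.
  by rewrite big1// => i _; rewrite gtn_eqF ?mulr0// (leq_trans _ jr).
pose ga (i : 'I_r) (z : C) := \sum_(j < r) (b j 0 - b j z) * c j i.
have ga_an i : analytic_at (ga i) 0.
  apply: analytic_sum => j _; apply: analyticM; last exact (analytic_cst _ _).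
  exact (analyticB (analytic_cst _ _) (Hb (ltn_ord j))).
have ga0 i : ga i 0 = 0 by rewrite /ga big1// => j _; rewrite subrr mul0r.
have /choice[be beE] i := analytic_div (ga_an i) (ga0 i).
exists be; split; first by move=> i; exact (beE i).1.
have W1 := dnearC_forall cE; have W2 := dnearC_forall (fun i => nearC_dnearC (beE i).2).
have W := dnearC_and (dnearC_and W1 W2) (dnearC_and HE (shear_tE r)).
apply: filterS W => z [[vE bE] [Ez ->]].
have vE' : vv r z = - \sum_(j < r) b j z *: vv j z by apply/eqP; rewrite -addr_eq0; apply/eqP.
rewrite big_ord_recr -[nat_of_ord ord_max]/r pr eqxx ltnn addr0 scale1r vE' /= -sumrB.
rewrite (eq_bigr (fun j : 'I_r => \sum_(i < r) ((b j 0 - b j z) * c j i) *: t i z)); last first.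
  move=> j _; rewrite pr ltn_eqF ?ltn_ord// add0r -scalerBl vE scaler_sumr.
  by apply: eq_bigr => i _; rewrite scalerA.
rewrite exchange_big/=; apply: eq_bigr => i _.
by rewrite -scaler_suml -bE.
Qed.

Lemma shear_t_unit : \forall z \near (0 : R[i]^o)^', \matrix_(i < r) t i z \in unitmx.
Proof.
have /choice[c cE] := iter_theta_sum_shear_t.
apply: filterS2 (dnearC_forall cE) HU => z vE.
have -> : \matrix_(j < r) vv j z = (\matrix_(j, i) c j i) *m \matrix_(i < r) t i z.
  apply/row_matrixP => j; rewrite rowK vE row_mul mulmx_sum_row.
  by apply: eq_bigr => i _; rewrite !mxE rowK.
by rewrite unitmx_mul => /andP[].
Qed.

(** With s_i = z^(-f_i) t_i one gets theta s_i = (m_i - f_i) s_i + z^(f_(i+1) - f_i) s_(i+1) for i <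
    w; in the last row the terms z^(f_j - f_w + 1) be_j s_j replace s_(i+1). The exponents are
    non-negative by [fS] and [fw], and at z = 0 only the off-diagonal terms with exponent 0 can
    survive, whence the two cases. *)
Lemma shear_frame : exists (A' S : C -> 'M[C]_r),
  [/\ an_mx A' 0 /\ mero_mx S, \forall z \near (0 : R[i]^o)^', S z \in unitmx,
      \forall z \near (0 : R[i]^o)^', z *: cder_mx S z + S z *m A z = A' z *m S z,
      (forall i, A' 0 i i = m i - (f i)%:~R) /\
      (forall i j : 'I_r, A' 0 i j != 0 -> i != j ->
         (f i = f j /\ (i < j)%N) \/ f j < f i) &
      \forall z \near (0 : R[i]^o)^', forall i : 'I_r, exists c : nat -> C,
        row i (S z) = \sum_(j < i.+1) c j *: iter j theta v0 z].
Proof.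
have [be [be_an tr]] := shear_t_last.
pose s (i : nat) z := z ^ (- f i) *: t i z.
pose S z := \matrix_(i < r) s i z.
pose A' z := \matrix_(i < r, j < r) ((m i - (f i)%:~R) * (i == j)%:R +
  (j == i.+1 :> nat)%:R * z ^+ `|f j - f i|%N +
  (i == w :> nat)%:R * (z ^+ `|(f j - f w + 1)%R|%N * be j z)).
have s_mero i : mero_mx (s i) := mero_mxXz (- f i) (shear_t_mero i).
exists A', S; split.
- split; last exact: mero_mx_rows.
  move=> i j; under eq_fun do rewrite mxE.
  have aX n := analyticX n (analytic_id (0 : C)).
  exact (analyticD (analyticD (analytic_cst _ _) (analyticM (analytic_cst _ _) (aX _)))
    (analyticM (analytic_cst _ _) (analyticM (aX _) (be_an j)))).
- apply: filterS2 shear_t_unit (dnearC_neq 0) => z U z0.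
  have -> : S z = diag_mx (\row_i z ^ (- f i)) *m \matrix_(i < r) t i z.
    apply/row_matrixP => i; rewrite rowK row_mul row_diag_mx -scalemxAl -rowE rowK.
    by rewrite mxE.
  rewrite unitmx_mul U andbT unitmxE det_diag unitfE prodf_seq_neq0.
  by apply/allP => i _; rewrite mxE expfz_neq0.
- have W1 := dnearC_forall (fun i : 'I_r => theta_Xz (- f i) (shear_t_mero i)).
  apply: filterS (dnearC_and W1 (dnearC_and tr (dnearC_neq 0))) => z [thE [trE z0]].
  apply/row_matrixP => i.
  have -> : row i (z *: cder_mx S z + S z *m A z) = theta (s i) z.
    rewrite linearD linearZ/= row_mul rowK /theta; congr (_ *: _ + _).
    apply/rowP => j; rewrite !mxE.
    by congr (cder _ z); apply/funext => y; rewrite !mxE.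
  rewrite row_mul mulmx_sum_row thE.
  under eq_bigr do rewrite rowK !mxE 2!scalerDl.
  rewrite !big_split/= [X in _ = X + _ + _](bigD1 i)//= eqxx mulr1 [X in _ + X + _ + _]big1 ?addr0; last first.
    by move=> j ji; rewrite eq_sym (negbTE ji) mulr0 scale0r.
  have tS : theta (t i) z = m i *: t i z + t i.+1 z by rewrite /= addrCA subrr addr0.
  have E1 : z ^ (- f i) *: ((- f i)%:~R *: t i z + theta (t i) z) =
      (m i - (f i)%:~R) *: s i z + z ^ (- f i) *: t i.+1 z.
    rewrite tS addrA -scalerDl scalerDr /s !scalerA; congr (_ *: _ + _).
    by rewrite mulrC rmorphN /= [- _ + _]addrC.
  rewrite E1 -addrA; congr (_ + _).
  have [iw|wi] := ltnP i w.
    rewrite [X in _ = _ + X]big1 ?addr0; last by move=> j _; rewrite ltn_eqF// mul0r scale0r.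
    have iw' : (i.+1 < r)%N by [].
    rewrite (bigD1 (Ordinal iw'))//= eqxx mul1r big1 ?addr0; last first.
      by move=> j; rewrite -val_eqE/= => /negbTE ->; rewrite mul0r scale0r.
    rewrite /s scalerA -[z ^+ `|_|%N]/(z ^ (Posz `|_|%N)) gez0_abs ?subr_ge0 ?fS//.
    by rewrite -expfzDr//; congr (z ^ _ *: _) => /=; lia.
  have iE : i = w :> nat by apply/eqP; rewrite eqn_leq wi andbT -ltnS ltn_ord.
  rewrite big1 ?add0r; last first.
    by move=> j _; rewrite ltn_eqF ?mul0r ?scale0r// iE ltn_ord.
  rewrite iE eqxx [t w.+1 z]trE scaler_sumr; apply: eq_bigr => j _.
  rewrite mul1r /s !scalerA; congr (_ *: _).
  rewrite -[z ^+ `|_|%N]/(z ^ (Posz `|_|%N)) gez0_abs; last first.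
    by have := fw (ltn_ord j); lia.
  rewrite mulrA [in RHS]mulrAC; congr (_ * _).
  have -> : z ^ (- f w) * z = z ^ (- f w + 1) by rewrite expfzDr// expr1z.
  by rewrite -expfzDr//; congr (z ^ _); lia.
- split=> [i|i j]; rewrite mxE.
    rewrite eqxx mulr1 ltn_eqF// mul0r addr0 -[RHS]addr0; congr (_ + _).
    case: eqVneq => [->|_]; last by rewrite mul0r.
    by rewrite subrr add0r expr0n/= mul0r mulr0.
  move=> Aij ij; move: Aij; rewrite (negbTE ij) mulr0 add0r => Aij.
  have [ji|ji] := eqVneq (j : nat) i.+1.
    have iw : (i < w)%N by rewrite -ltnS -ji ltn_ord.
    move: Aij; rewrite ji eqxx mul1r (ltn_eqF iw) mul0r addr0 expr0n.
    have [/eqP|] := eqVneq `|(f i.+1 - f i)%R|%N 0%N; last by rewrite eqxx.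
    by rewrite absz_eq0 subr_eq0 => /eqP -> _; left.
  move: Aij; rewrite (negbTE ji) mul0r add0r.
  have [iw|] := eqVneq (i : nat) w; last by rewrite mul0r eqxx.
  rewrite mul1r expr0n.
  have [/eqP|] := eqVneq `|(f j - f w + 1)%R|%N 0%N; last by rewrite mul0r eqxx.
  by rewrite absz_eq0 => /eqP fj _; right; rewrite iw; lia.
- have W := dnearC_forall (fun i : 'I_r => shear_tE i).
  apply: filterS W => z H i; exists (fun j => z ^ (- f i) * (p i)`_j).
  rewrite rowK /s H scaler_sumr; apply: eq_bigr => j _; by rewrite scalerA.
Qed.

End Shear.

(** * Parabolic weights of a triangular residue *)

Section Triangular.
Variable K : fieldType.
Variables (w : nat) (N0 : 'M[K]_w.+1) (de : 'I_w.+1 -> K) (ka : 'I_w.+1 -> nat).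
Hypothesis ka_inj : injective ka.
Hypothesis N0_tri : forall i j, N0 i j != 0 -> i != j -> (ka i < ka j)%N.
Hypothesis N0_diag : forall i, N0 i i = de i.

(** Off the diagonal [N0] only moves coordinates to strictly larger [ka], so at the least index of
    the support the diagonal entry acts alone. *)
Lemma tri_row_horner (x : 'rV[K]_w.+1) i p :
  (forall j, x 0 j != 0 -> (ka i <= ka j)%N) ->
  (forall j, (x *m horner_mx N0 p) 0 j != 0 -> (ka i <= ka j)%N) /\
  (x *m horner_mx N0 p) 0 i = x 0 i * p.[de i].
Proof.
move=> Hx; elim/poly_ind: p => [|p c [IH1 IH2]].
  by rewrite rmorph0 mulmx0 horner0 mulr0; split=> [j|]; rewrite mxE// eqxx.
rewrite rmorphD rmorphM /= horner_mx_X horner_mx_C mulmxDr mul_mx_scalar -mulmxE mulmxA.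
move: (x *m _) IH1 IH2 => y IH1 IH2; split=> [j|].
  rewrite !mxE; apply: contraNT; rewrite -ltnNge => ji.
  rewrite (_ : x 0 j = 0) ?mulr0 ?addr0; last first.
    by apply/eqP; apply: contraTT ji => /Hx; rewrite -leqNgt.
  rewrite big1// => k _; apply/eqP; rewrite mulf_eq0; apply/norP => -[yk Nk].
  have ik := IH1 _ yk; have [kj|kj] := eqVneq k j; first by rewrite -kj ltnNge ik in ji.
  by have := N0_tri Nk kj; rewrite ltnNge (ltnW (leq_trans ji ik)).
rewrite !mxE hornerMXaddC (bigD1 i)//= N0_diag IH2 big1 ?addr0; last first.
  move=> k ki; apply/eqP; rewrite mulf_eq0; apply/norP => -[yk Nk].
  by have := N0_tri Nk ki; rewrite ltnNge (IH1 _ yk).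
by rewrite mulrDr mulrA [c * _]mulrC.
Qed.

(** Each factor P(N0) clears the coordinate of least [ka], because [P] vanishes at the diagonal
    entry there; as many factors as there are admissible indices suffice. *)
Lemma tri_row_kill P n c (x : 'rV[K]_w.+1) :
  (forall j, x 0 j != 0 -> (c <= ka j)%N) ->
  (#|[pred j | (c <= ka j)%N]| <= n)%N ->
  (forall j, (c <= ka j)%N -> P.[de j] = 0) ->
  x *m horner_mx N0 (P ^+ n) = 0.
Proof.
elim: n c x => [|n IH] c x Hx cn HP.
  have -> : x = 0; last by rewrite mul0mx.
  apply/rowP => j; rewrite mxE; apply/eqP; apply/negP => /negP /Hx cj.
  by move: cn; rewrite leqn0 => /eqP/card0_eq/(_ j); rewrite inE cj.
have [->|x0] := eqVneq x 0; first by rewrite mul0mx.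
have [j0 j0c] : exists j0, (c <= ka j0)%N.
  have [j xj] : exists j, x 0 j != 0.
    apply/existsP; apply: contraNT x0 => /existsPn H; apply/eqP/rowP => j.
    by rewrite mxE; apply/eqP; rewrite -[_ == _]negbK H.
  by exists j; apply: Hx.
have [i ic imin] := @arg_minnP _ j0 (fun j => c <= ka j)%N ka j0c.
have [H1 H2] : _ /\ _ := @tri_row_horner x i P (fun j xj => imin j (Hx j xj)).
rewrite exprS rmorphM /= -mulmxE mulmxA; apply: (IH (ka i).+1).
- move=> j yj; rewrite ltn_neqAle (H1 j yj) andbT; apply: contra_neq yj => /ka_inj <-.
  by rewrite H2 HP// mulr0.
- rewrite -ltnS; apply: leq_trans cn; apply: proper_card; apply/properP; split.
    by apply/fintype.subsetP => j; rewrite !inE => /ltnW; apply: leq_trans.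
  by exists i; rewrite inE ?ltnn.
- by move=> j ij; apply: HP; apply: leq_trans ic (ltnW ij).
Qed.

Lemma card_ka_le c : (#|[pred j | (c <= ka j)%N]| <= w.+1)%N.
Proof. by rewrite -[X in (_ <= X)%N](card_ord w.+1) max_card. Qed.

Lemma delta_supp i j : (delta_mx 0 i : 'rV[K]_w.+1) 0 j != 0 -> (ka i <= ka j)%N.
Proof. by case: (eqVneq j i) => [->//|ji]; rewrite mxE (negbTE ji) andbF eqxx. Qed.

(** An eigenvector is scaled by the diagonal entry at its least index. Conversely, if N0 - de_i were
    invertible, a power of the product over the other diagonal values would kill the i-th basis
    vector, although it multiplies its i-th coordinate by a non-zero number. *)
Lemma tri_eigenvalueP a : reflect (exists i, a = de i) (eigenvalue N0 a).
Proof.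
apply: (iffP idP) => [/eigenvalueP[v vN v0]|[i ->]].
  have [j0 j0c] : exists j, v 0 j != 0.
    apply/existsP; apply: contraNT v0 => /existsPn H; apply/eqP/rowP => j.
    by rewrite mxE; apply/eqP; rewrite -[_ == _]negbK H.
  have [i ic imin] := @arg_minnP _ j0 (fun j => v 0 j != 0) ka j0c.
  have [_] := @tri_row_horner v i 'X imin.
  rewrite horner_mx_X hornerX vN mxE mulrC => /(mulfI ic) E; by exists i.
rewrite /eigenvalue; apply: contraT; rewrite negbK kermx_eq0 row_free_unit => U.
pose P := \prod_(j | de j != de i) ('X - (de j)%:P).
have H : (delta_mx 0 i : 'rV[K]_w.+1) *m horner_mx N0 ((P * ('X - (de i)%:P)) ^+ w.+1) = 0.
  apply: (tri_row_kill (@delta_supp i) (card_ka_le (ka i))) => j _; rewrite hornerM /P.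
  have [->|ji] := eqVneq (de j) (de i); first by rewrite hornerXsubC subrr mulr0.
  by rewrite (bigD1 j)//= hornerM hornerXsubC subrr !mul0r.
move: H; rewrite exprMn rmorphM /= -mulmxE mulmxA [X in _ *m X]rmorphXn /= => H.
have UU : horner_mx N0 ('X - (de i)%:P) ^+ w.+1 \in unitmx.
  rewrite -[_ \in _]/(_ \is a GRing.unit) unitrX//.
  by rewrite rmorphB /= horner_mx_X horner_mx_C.
have {H} H : (delta_mx 0 i : 'rV[K]_w.+1) *m horner_mx N0 (P ^+ w.+1) = 0.
  by rewrite -[LHS](mulmxK UU) H mul0mx.
have [_] := @tri_row_horner (delta_mx 0 i) i (P ^+ w.+1) (@delta_supp i).
rewrite H !mxE !eqxx mul1r horner_exp => /esym/eqP.
rewrite expf_eq0/= /P horner_prod => /prodf_eq0[j ji].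
by rewrite hornerXsubC subr_eq0 eq_sym (negbTE ji).
Qed.

End Triangular.

(** * From the triangular form to the induced weight *)

Section Weights.
Variable R : realType.
Local Notation C := R[i].
Variables (w : nat) (N0 : 'M[C]_w.+1) (de : 'I_w.+1 -> R) (ka : 'I_w.+1 -> nat).
Hypothesis ka_inj : injective ka.
Hypothesis N0_tri : forall i j, N0 i j != 0 -> i != j -> (ka i < ka j)%N.
Hypothesis N0_diag : forall i, N0 i i = ((de i)%:C)%C.
Hypothesis de_mono : forall i j, (ka i < ka j)%N -> de i <= de j.
Variables (B N : 'M[C]_w.+1).
Hypothesis B_unit : B \in unitmx.
Hypothesis BN : B *m N = N0 *m B.

Lemma de_mono_le i j : (ka i <= ka j)%N -> de i <= de j.
Proof. by rewrite leq_eqVlt => /orP[/eqP/ka_inj ->|/de_mono]. Qed.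

Lemma intertwine_horner p : B *m horner_mx N p = horner_mx N0 p *m B.
Proof.
elim/poly_ind: p => [|p c IH]; first by rewrite !rmorph0 mulmx0 mul0mx.
rewrite !rmorphD !rmorphM /= !horner_mx_X !horner_mx_C mulmxDr mulmxDl.
by rewrite -!mulmxE mulmxA IH -!mulmxA BN -[in RHS]scalar_mxC.
Qed.

Lemma eigenvalue_weights a : reflect (exists i, a = ((de i)%:C)%C) (eigenvalue N a).
Proof.
have -> : eigenvalue N a = eigenvalue N0 a; last exact: tri_eigenvalueP ka_inj N0_tri N0_diag a.
apply/eigenvalueP/eigenvalueP => -[v vN v0].
  exists (v *m invmx B); last first.
    by apply: contra_neq v0 => /(congr1 (mulmx^~ B)); rewrite mulmxKV// mul0mx.
  apply: (can_inj (mulmxK B_unit)).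
  by rewrite -[LHS]mulmxA -BN mulmxA mulmxKV// vN -scalemxAl mulmxKV.
exists (v *m B); last first.
  by apply: contra_neq v0 => /(congr1 (mulmx^~ (invmx B))); rewrite mulmxK// mul0mx.
by rewrite -mulmxA BN mulmxA vN scalemxAl.
Qed.

(** [parabolic_weights] is a choice, so an admissible list is exhibited first: the diagonal, sorted
    and without repetitions. *)
Lemma parabolic_weightsP : sorted <%R (parabolic_weights N) /\
  forall a : R, (a \in parabolic_weights N) = [exists i, a == de i].
Proof.
pose al0 := sort <=%R (undup [seq de i | i <- enum 'I_w.+1]).
have Ex : exists al : seq R, sorted <%R al /\
    forall a : C, eigenvalue N a = (a \in [seq (t%:C)%C | t <- al]).
  exists al0; split; first by rewrite sort_lt_sorted undup_uniq.
  move=> a; apply/eigenvalue_weights/mapP => [[i ->]|[t]].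
    by exists (de i) => //; rewrite mem_sort mem_undup map_f// mem_enum.
  by rewrite mem_sort mem_undup => /mapP[i _ ->] ->; exists i.
have [h1 h2] := xgetPex [::] Ex; split; first exact h1.
move=> a; apply/idP/existsP => [aal|[i /eqP ->]].
  have : eigenvalue N ((a%:C)%C) by rewrite h2 map_f.
  by move=> /eigenvalue_weights[i [->]]; exists i.
have : eigenvalue N (((de i)%:C)%C) by apply/eigenvalue_weights; exists i.
by rewrite h2 => /mapP[t tal [->]].
Qed.

Definition weight_poly (a : R) : {poly C} :=
  \prod_(b <- parabolic_weights N | a <= b) ('X - ((b%:C)%C)%:P).

(** Kernels of coprime polynomials in [N] add up to the kernel of the product; this turns the
    parabolic filtration into a single polynomial condition. *)
Lemma sum_geigenspace (al : seq R) (P : pred R) : uniq al ->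
  (\sum_(b <- al | P b) geigenspace N ((b%:C)%C) :=:
   kermxpoly N ((\prod_(b <- al | P b) ('X - ((b%:C)%C)%:P)) ^+ w.+1))%MS.
Proof.
elim: al => [|b al IH] /=.
  by move=> _; rewrite !big_nil expr1n kermxpoly1; exact: eqmx_refl.
move=> /andP[bal /IH {}IH]; rewrite !big_cons; case: ifP => _; last exact IH.
rewrite exprMn; apply: eqmx_trans (eqmx_sym (kermxpolyM _ _)); last first.
  apply: coprimep_expl; apply: coprimep_expr; rewrite big_seq_cond.
  elim/big_rec: _ => [|c q /andP[cal _] IHq]; first exact: coprimep1.
  rewrite coprimepMr IHq andbT coprimep_XsubC root_XsubC.
  by apply: contra bal => /eqP[<-].
exact: adds_eqmx (eqmx_refl _) IH.
Qed.

Lemma parabolic_filtrationP a (x : 'rV[C]_w.+1) :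
  (x *m B <= parabolic_filtration N a)%MS =
  (x *m horner_mx N0 (weight_poly a ^+ w.+1) == 0).
Proof.
have u : uniq (parabolic_weights N) by have [/lt_sorted_uniq] := parabolic_weightsP.
rewrite /parabolic_filtration (sum_geigenspace _ u) sub_kermx -mulmxA.
rewrite intertwine_horner mulmxA; apply/eqP/eqP => [H|->]; last by rewrite mul0mx.
by rewrite -[LHS](mulmxK B_unit) H mul0mx.
Qed.

(** Every index at or above [k] in the order [ka] has a diagonal entry at least [a], which is
    therefore a root of [weight_poly a]. *)
Lemma row_in_parabolic k a : a <= de k -> (row k B <= parabolic_filtration N a)%MS.
Proof.
move=> ak; rewrite rowE parabolic_filtrationP; apply/eqP.
apply: (tri_row_kill ka_inj N0_tri N0_diag (c := ka k)).
- exact: delta_supp.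
- exact: card_ka_le.
- move=> j kj; rewrite /weight_poly horner_prod.
  have jal : de j \in parabolic_weights N.
    by rewrite parabolic_weightsP.2; apply/existsP; exists j.
  rewrite (big_rem _ jal)/= (le_trans ak (de_mono_le kj)).
  by rewrite hornerXsubC subrr mul0r.
Qed.

(** At the least index i of the support [weight_poly a] must vanish, so a <= de_i, and [de] does not
    decrease along [ka]. *)
Lemma parabolic_coord a (x : 'rV[C]_w.+1) k :
  (x *m B <= parabolic_filtration N a)%MS -> x 0 k != 0 -> a <= de k.
Proof.
rewrite parabolic_filtrationP => /eqP xQ xk.
have [i xi imin] := @arg_minnP _ k (fun j => x 0 j != 0) ka xk.
have [_] := tri_row_horner N0_tri N0_diag (weight_poly a ^+ w.+1) imin.
rewrite xQ mxE => /esym/eqP; rewrite mulf_eq0 (negbTE xi)/= horner_exp expf_eq0/=.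
rewrite /weight_poly -big_filter horner_prod => /eqP/eqP.
rewrite prodf_seq_eq0 => /hasP[b]; rewrite mem_filter hornerXsubC subr_eq0/=.
move=> /andP[ab _] /eqP[ib]; apply: le_trans ab _; rewrite -ib.
exact: de_mono_le (imin _ xk).
Qed.

(** Row k of [B] generates F^q / F^(q+1). Modulo F^(q+1) it lies in the step [a] of the filtration
    exactly when a <= de_k, so the largest admissible index is the position of de_k in the list of
    weights. *)
Lemma induced_weight_triangular (F : int -> 'M[C]_w.+1) (q : int) (k : 'I_w.+1) :
  (F q == (pid_mx k.+1 : 'M[C]_w.+1) *m B)%MS ->
  (F (q + 1)%R == (pid_mx k : 'M[C]_w.+1) *m B)%MS ->
  induced_weight N F q = de k.
Proof.
move=> Fq Fq1; rewrite /induced_weight; set al := parabolic_weights N.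
have [al_sort al_mem] := parabolic_weightsP; rewrite -/al in al_sort al_mem.
have kal : de k \in al by rewrite al_mem; apply/existsP; exists k.
have cond a : a \in al ->
    gr_subset (gr_line F q) (gr_parabolic N F a) <-> a <= de k.
  move=> _; split=> [/(_ q)|ak p].
    rewrite /gr_line eqxx /gr_parabolic => H.
    have rk : (row k B <= F q)%MS.
      rewrite (eqmxP Fq); apply: submx_trans (row_sub k _).
      rewrite row_mul (_ : row k (pid_mx k.+1) = delta_mx 0 k) -?rowE ?submx_refl//.
      by apply/rowP => j; rewrite !mxE eqxx ltnSn andbT eq_sym.
    have /sub_addsmxP[[u1 u2] /= uE] := submx_trans rk H.
    have yH : (u1 *m (parabolic_filtration N a :&: F q)%MS <= parabolic_filtration N a)%MS.
      exact: submx_trans (submxMl _ _) (capmxSl _ _).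
    have /submxP[v vE] : (u2 *m F (q + 1)%R <= (pid_mx k : 'M[C]_w.+1) *m B)%MS.
      by rewrite -(eqmxP Fq1) submxMl.
    (* Only rows before [k] are subtracted, so the k-th coordinate of [x] stays 1. *)
    pose x := delta_mx 0 k - v *m (pid_mx k : 'M[C]_w.+1).
    have xB : x *m B = u1 *m (parabolic_filtration N a :&: F q)%MS.
      by rewrite mulmxBl -rowE uE -mulmxA -vE addrK.
    rewrite -xB in yH; apply: (parabolic_coord yH).
    rewrite !mxE !eqxx big1 ?subr0 ?oner_eq0// => j _.
    by rewrite mxE; case: eqVneq => [->|]; rewrite ?ltnn mulr0.
  (* Away from [q] the graded line is zero, that is, F^(p+1), which lies in every step. *)
  rewrite /gr_line /gr_parabolic; case: eqVneq => [->|_]; last exact: addsmxSr.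
  have Hk : (row k B <= parabolic_filtration N a :&: F q)%MS.
    rewrite sub_capmx row_in_parabolic//= (eqmxP Fq); apply: submx_trans (row_sub k _).
    rewrite row_mul (_ : row k (pid_mx k.+1) = delta_mx 0 k) -?rowE ?submx_refl//.
    by apply/rowP => j; rewrite !mxE eqxx ltnSn andbT eq_sym.
  rewrite (eqmxP Fq); apply/row_subP => i; rewrite row_mul.
  have [ik|ik|ik] := ltngtP i k.
  - rewrite (_ : row i (pid_mx k.+1) = row i (pid_mx k)).
      by rewrite -row_mul; apply: submx_trans (row_sub _ _) _; rewrite -(eqmxP Fq1) addsmxSr.
    by apply/rowP => j; rewrite !mxE ik ltnS ltnW.
  - rewrite (_ : row i (pid_mx k.+1) = 0) ?mul0mx ?sub0mx//.
    by apply/rowP => j; rewrite !mxE ltnS leqNgt ik andbF.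
  - have {}ik : i = k by apply: val_inj.
    rewrite ik (_ : row k (pid_mx k.+1) = delta_mx 0 k) -?rowE.
      exact: submx_trans Hk (addsmxSl _ _).
    by apply/rowP => j; rewrite !mxE eqxx ltnSn andbT eq_sym.
set j0 := index (de k) al.
have j0s : (j0 < size al)%N by rewrite index_mem.
have nj0 : nth 0 al j0 = de k by rewrite nth_index.
rewrite (_ : (\max_(j < size al | _) j)%N = j0)//.
apply/eqP; rewrite eqn_leq; apply/andP; split.
  apply/bigmax_leqP => j /asboolP; rewrite cond ?mem_nth// -nj0 => H.
  rewrite leqNgt; apply/negP => jj; move: H; rewrite leNgt => /negP; apply.
  by rewrite lt_sorted_ltn_nth// inE.
apply: (@leq_bigmax_cond _ _ (fun j : 'I_(size al) => nat_of_ord j) (Ordinal j0s)).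
by apply/asboolP; rewrite cond ?mem_nth//= nj0.
Qed.

End Weights.

(** * The connection in local coordinates *)

Lemma nearC_and (R : realType) (z0 : R[i]) (P Q : R[i] -> Prop) :
  (\forall z \near (z0 : R[i]^o), P z) -> (\forall z \near (z0 : R[i]^o), Q z) ->
  \forall z \near (z0 : R[i]^o), P z /\ Q z.
Proof. by apply: filterS2 => z. Qed.

(** * Neighbourhoods and derivatives in charts *)

Section Charts.
Variables (R : realType) (X : riemannSurface R).
Local Notation C := R[i].
Implicit Types (c : chart R X) (x y : X).

Lemma chart_param c x : rs_atlas c -> cdom c x -> cparam c (ccoord c x) = x.
Proof. by move=> /rs_chart ch; exact: (chart_coordK ch). Qed.

Lemma near_cdom c x : rs_atlas c -> cdom c x -> \forall y \near x, cdom c y.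
Proof. by move=> /rs_chart ch cx; exact: (open_nbhs_nbhs (conj (chart_open ch) cx)). Qed.

Lemma near_param c x (P : X -> Prop) : rs_atlas c -> cdom c x ->
  (\forall y \near x, P y) -> \forall z \near (ccoord c x : R[i]^o), P (cparam c z).
Proof.
move=> ca cx Px; have ch := rs_chart ca.
have H := chart_param_continuous ch cx.
have PP : nbhs (cparam c (ccoord c x)) P by rewrite (chart_param ca cx).
exact (H P PP).
Qed.

Lemma near_coord c x (Q : C -> Prop) : rs_atlas c -> cdom c x ->
  (\forall z \near (ccoord c x : R[i]^o), Q z) -> \forall y \near x, Q (ccoord c y).
Proof.
move=> ca cx Qx; have ch := rs_chart ca.
exact: (chart_coord_continuous ch cx Qx).
Qed.

Lemma near_coordK c x : rs_atlas c -> cdom c x ->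
  \forall z \near (ccoord c x : R[i]^o), cdom c (cparam c z) /\ ccoord c (cparam c z) = z.
Proof.
move=> ca cx; have ch := rs_chart ca.
have : nbhs (ccoord c x : R[i]^o) ((ccoord c : X -> R[i]^o) @` cdom c).
  apply: open_nbhs_nbhs; split; first exact: chart_image_open ch.
  by exists x.
by apply: filterS => _ [y cy <-]; rewrite (chart_param ca cy).
Qed.

Lemma near_chartP c x (P : X -> Prop) : rs_atlas c -> cdom c x ->
  (\forall y \near x, P y) <-> \forall z \near (ccoord c x : R[i]^o), P (cparam c z).
Proof.
move=> ca cx; split; first exact: near_param.
move=> H; apply: filterS2 (near_coord ca cx H) (near_cdom ca cx) => y Py cy.
by rewrite (chart_param ca cy) in Py.
Qed.

Lemma dnear_chartP c x (P : X -> Prop) : rs_atlas c -> cdom c x ->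
  (\forall y \near x^', P y) <-> \forall z \near (ccoord c x : R[i]^o)^', P (cparam c z).
Proof.
move=> ca cx; split=> H.
  have H' := near_param ca cx H.
  apply: filterS2 H' (near_coordK ca cx) => z Pz [_ zz] zx; apply: Pz.
  by apply: contra_neq zx => <-.
have H' := near_coord ca cx H.
apply: filterS2 H' (near_cdom ca cx) => y Py cy yx.
rewrite (chart_param ca cy) in Py; apply: Py.
by apply: contra_neq yx => E; rewrite -(chart_param ca cy) E chart_param.
Qed.

Lemma dnear_point x (P : X -> Prop) : (\forall y \near x^', P y) -> exists2 y, y != x & P y.
Proof.
have [c ca cx] := rs_cover x => Px.
have nx : \forall y \near x^', y != x /\ P y.
  have Px' : \forall y \near x, y != x -> P y := Px.
  have : \forall y \near x, y != x -> y != x /\ P y by apply: filterS Px' => y Py yx; split => //; exact: Py.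
  by [].
by have /(dnear_chartP _ ca cx)/dnbhsC_point[z _ [zx Pz]] := nx; exists (cparam c z).
Qed.

Lemma analytic_transition c c' x : rs_atlas c -> rs_atlas c' -> cdom c x -> cdom c' x ->
  analytic_at (ccoord c' \o cparam c) (ccoord c x).
Proof. by move=> ca ca' cx cx'; exact: (rs_compatible ca ca' cx cx').1. Qed.

Lemma hol_at_coord c x : rs_atlas c -> cdom c x -> hol_at (ccoord c) x.
Proof. move=> ca cx c' ca' cx'; exact: analytic_transition. Qed.

Lemma cder_param_chain c c' y (f : X -> C) l : rs_atlas c -> rs_atlas c' ->
  cdom c y -> cdom c' y -> is_cderive (f \o cparam c') (ccoord c' y) l ->
  is_cderive (f \o cparam c) (ccoord c y)
    (l * cder (ccoord c' \o cparam c) (ccoord c y)).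
Proof.
move=> ca ca' cy cy' Hf.
have Ht := analytic_is_cderive (analytic_transition ca ca' cy cy').
set t := ccoord c' \o cparam c in Ht *.
have ty : t (ccoord c y) = ccoord c' y by rewrite /t /= chart_param.
rewrite -ty in Hf.
apply: is_cderive_near (is_cderive_comp Ht Hf).
have := near_param ca cy (near_cdom ca' cy').
by apply: filterS => z cz; rewrite /t /= chart_param.
Qed.

Lemma cder_transition_inv c c' y : rs_atlas c -> rs_atlas c' -> cdom c y -> cdom c' y ->
  cder (ccoord c' \o cparam c) (ccoord c y) * cder (ccoord c \o cparam c') (ccoord c' y) = 1.
Proof.
move=> ca ca' cy cy'.
have Ht := analytic_is_cderive (analytic_transition ca' ca cy' cy).
have H := cder_param_chain ca ca' cy cy' Ht.
have H1 : is_cderive (ccoord c \o cparam c) (ccoord c y) 1.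
  apply: is_cderive_near (is_cderive_id (ccoord c y)).
  by apply: filterS (near_coordK ca cy) => z [_ zz]; rewrite /= zz.
rewrite mulrC -(is_cderive_cder H); exact (is_cderive_cder H1).
Qed.

Lemma hol_at_near (f g : X -> C) x : (\forall y \near x, f y = g y) -> hol_at f x -> hol_at g x.
Proof.
move=> fg Hf c ca cx; apply: near_eq_analytic (Hf c ca cx).
exact: near_param ca cx fg.
Qed.

Lemma hol_atM (f g : X -> C) x : hol_at f x -> hol_at g x -> hol_at (fun y => f y * g y) x.
Proof. move=> Hf Hg c ca cx; exact (analyticM (Hf c ca cx) (Hg c ca cx)). Qed.

(** Seen in another chart, this is the derivative of [f] in that chart divided by the derivative of
    the transition map, which does not vanish. *)
Lemma hol_at_cder (f : X -> C) c x : rs_atlas c -> cdom c x -> hol_at f x ->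
  hol_at (fun y => cder (f \o cparam c) (ccoord c y)) x.
Proof.
move=> ca cx Hf c' ca' cx'.
have Hf' := Hf c' ca' cx'.
have Ht := analytic_transition ca' ca cx' cx.
have t0 : cder (ccoord c \o cparam c') (ccoord c' x) != 0.
  apply/eqP => t0; have := cder_transition_inv ca ca' cx cx'.
  by rewrite t0 mulr0 => /esym/eqP; rewrite oner_eq0.
have := analyticM (analytic_cder Hf') (analyticV (analytic_cder Ht) t0).
apply: near_eq_analytic.
have n1 := near_param ca' cx' (near_cdom ca cx).
have n2 := near_coordK ca' cx'.
have n3 := analytic_cderive Hf'.
apply: filterS (nearC_and n1 (nearC_and n2 n3)) => z [cz [[cz' zz] Dz]] /=.
have Dz' : is_cderive (f \o cparam c') (ccoord c' (cparam c' z)) (cder (f \o cparam c') z).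
  by rewrite zz; exact Dz.
rewrite (is_cderive_cder (cder_param_chain ca ca' cz cz' Dz')); congr (_ * _).
have := cder_transition_inv ca ca' cz cz'; rewrite zz => E.
have t1 : cder (ccoord c \o cparam c') z != 0.
  by apply/eqP => t1; move/eqP: E; rewrite t1 mulr0 eq_sym oner_eq0.
apply: (mulIf t1); rewrite E; exact (mulVf t1).
Qed.

End Charts.

(** * The Gauss-Manin connection in flat frames *)

Section Nabla.
Variables (R : realType) (X : riemannSurface R).
Local Notation C := R[i].
Variables (D : set X) (w : nat) (L : set (frame int X w.+1)).
Hypothesis LS : is_local_system (~` D) L.
Local Notation r := w.+1.
Implicit Types (c : chart R X) (x y : X).

Definition complex_frame (e : frame int X r) (y : X) : 'M[C]_r := map_mx intr (e.2 y).

Lemma map_intr_unit (U : 'M[int]_r) : U \in unitmx ->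
  (map_mx intr U : 'M[C]_r) \in unitmx /\ invmx (map_mx intr U : 'M[C]_r) = map_mx intr (invmx U).
Proof.
move=> HU; have H : (map_mx intr U : 'M[C]_r) *m map_mx intr (invmx U) = 1%:M.
  by rewrite -map_mxM mulmxV// map_mx1.
have [U1 _] := mulmx1_unit H; split => //.
by rewrite -[LHS]mulmx1 -H mulmxA mulVmx// mul1mx.
Qed.

Lemma complex_frame_unit e y : L e -> e.1 y -> complex_frame e y \in unitmx.
Proof. by move=> Le ey; have [] := map_intr_unit (ls_basis LS Le ey). Qed.

Lemma complex_frame_transition e e' x : L e -> L e' -> e.1 x -> e'.1 x ->
  \forall y \near x, complex_frame e y *m invmx (complex_frame e' y) = complex_frame e x *m invmx (complex_frame e' x).
Proof.
move=> Le Le' ex e'x.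
have o : \forall y \near x, e.1 y by exact: (open_nbhs_nbhs (conj (ls_open LS Le).1 ex)).
have o' : \forall y \near x, e'.1 y by exact: (open_nbhs_nbhs (conj (ls_open LS Le').1 e'x)).
apply: filterS3 o o' (ls_transition LS Le Le' ex e'x) => y ey e'y E.
rewrite /complex_frame (map_intr_unit (ls_basis LS Le' e'y)).2 (map_intr_unit (ls_basis LS Le' e'x)).2.
by rewrite -!map_mxM E.
Qed.

Lemma flat_frameP x : ~ D x -> exists e, [/\ L e, e.1 x & @flat_frame R X r L x = complex_frame e].
Proof.
move=> Dx; have Ex : exists e, (L e /\ e.1 x) by have [e] := ls_cover LS Dx; exists e.
by have [h1 h2] := xgetPex (setT, fun=> 1%:M) Ex; exists (xget (setT, fun=> 1%:M) [set e | L e /\ e.1 x]).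
Qed.

Lemma frame_near e x : L e -> e.1 x -> \forall y \near x, e.1 y.
Proof. by move=> Le ex; exact: (open_nbhs_nbhs (conj (ls_open LS Le).1 ex)). Qed.

Lemma frame_notD e x : L e -> e.1 x -> ~ D x.
Proof. by move=> Le ex; exact: (ls_open LS Le).2. Qed.

Lemma nabla_cder m c a (s : X -> 'M[C]_(m, r)) x : nabla L c a s x =
  (a x *: cder_mx (fun z => s (cparam c z) *m invmx (@flat_frame R X r L x (cparam c z)))
     (ccoord c x)) *m @flat_frame R X r L x x.
Proof. by []. Qed.

(** [nabla] relies on a flat frame chosen at each point; two flat frames differ by a locally
    constant matrix, so any one around [x] gives the same value. *)
Lemma nablaE m e c a (s : X -> 'M[C]_(m, r)) x M : L e -> e.1 x -> rs_atlas c -> cdom c x ->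
  is_cder_mx (fun z => s (cparam c z) *m invmx (complex_frame e (cparam c z))) (ccoord c x) M ->
  nabla L c a s x = (a x *: M) *m complex_frame e x.
Proof.
move=> Le ex ca cx HM.
have [e0 [Le0 e0x fE]] := flat_frameP (frame_notD Le ex).
rewrite nabla_cder fE.
pose T := complex_frame e x *m invmx (complex_frame e0 x).
have H : is_cder_mx (fun z => s (cparam c z) *m invmx (complex_frame e0 (cparam c z))) (ccoord c x) (M *m T).
  have := is_cder_mxM HM (is_cder_mx_cst T (ccoord c x)); rewrite mulmx0 addr0.
  apply: is_cder_mx_near.
  have n1 := near_param ca cx (complex_frame_transition Le Le0 ex e0x).
  have n2 := near_param ca cx (frame_near Le ex).
  apply: filterS (nearC_and n1 n2) => z [tz ez].
  by rewrite /T -tz mulmxA mulmxKV// complex_frame_unit.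
rewrite (is_cder_mx_cder H) -!scalemxAl /T -!mulmxA mulVmx ?mulmx1//.
exact: complex_frame_unit.
Qed.

Lemma nabla_near m c a (s s' : X -> 'M[C]_(m, r)) x : rs_atlas c -> cdom c x ->
  (\forall y \near x, s y = s' y) -> nabla L c a s x = nabla L c a s' x.
Proof.
move=> ca cx ss; rewrite !nabla_cder.
rewrite (@cder_mx_near R _ _ _ (fun z => s' (cparam c z) *m invmx (@flat_frame R X r L x (cparam c z)))); first by [].
by have := near_param ca cx ss; apply: filterS => z ->.
Qed.

Lemma hol_section_cder m e c (s : X -> 'M[C]_(m, r)) x : L e -> e.1 x -> rs_atlas c -> cdom c x ->
  hol_section (@ls_bundle R X r L) s x ->
  an_mx (fun z => s (cparam c z) *m invmx (complex_frame e (cparam c z))) (ccoord c x).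
Proof.
move=> Le ex ca cx Hs i j.
have Be : @ls_bundle R X r L (e.1, complex_frame e) by exists e.
exact (Hs _ Be ex i j c ca cx).
Qed.

Lemma hol_section_is_cder m e c (s : X -> 'M[C]_(m, r)) x : L e -> e.1 x -> rs_atlas c -> cdom c x ->
  hol_section (@ls_bundle R X r L) s x ->
  exists M, is_cder_mx (fun z => s (cparam c z) *m invmx (complex_frame e (cparam c z))) (ccoord c x) M.
Proof.
move=> Le ex ca cx /(hol_section_cder Le ex ca cx)/an_mx_is_cder/nbhs_singleton H.
by eexists; exact H.
Qed.

Lemma nablaM m n c a (P : X -> 'M[C]_(m, n)) (s : X -> 'M[C]_(n, r)) x P' :
  ~ D x -> rs_atlas c -> cdom c x ->
  is_cder_mx (fun z => P (cparam c z)) (ccoord c x) P' ->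
  hol_section (@ls_bundle R X r L) s x ->
  nabla L c a (fun y => P y *m s y) x = a x *: (P' *m s x) + P x *m nabla L c a s x.
Proof.
move=> Dx ca cx HP Hs.
have [e Le ex] := ls_cover LS Dx.
have [M HM] := hol_section_is_cder Le ex ca cx Hs.
have := is_cder_mxM HP HM; rewrite (chart_param ca cx) => HPs.
have E1 : is_cder_mx (fun z => (P (cparam c z) *m s (cparam c z)) *m invmx (complex_frame e (cparam c z)))
   (ccoord c x) (P' *m (s x *m invmx (complex_frame e x)) + P x *m M).
  apply: is_cder_mx_near HPs; have /nearC_normcP := near_coordK ca cx => -[d d0 _].
  by apply/nearC_normcP; exists d => // z _; rewrite mulmxA.
rewrite (nablaE a Le ex ca cx E1) (nablaE a Le ex ca cx HM).
rewrite scalerDr mulmxDl -!scalemxAl -scalemxAr -!mulmxA mulVmx ?mulmx1//.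
exact: complex_frame_unit.
Qed.

Lemma nablaZ_field m c a (s : X -> 'M[C]_(m, r)) x :
  nabla L c a s x = a x *: nabla L c (fun=> 1) s x.
Proof. by rewrite !nabla_cder scale1r -scalemxAl. Qed.

Lemma nabla_change m c c' (s : X -> 'M[C]_(m, r)) x : ~ D x ->
  rs_atlas c -> cdom c x -> rs_atlas c' -> cdom c' x ->
  hol_section (@ls_bundle R X r L) s x ->
  nabla L c (fun=> 1) s x =
    cder (ccoord c' \o cparam c) (ccoord c x) *: nabla L c' (fun=> 1) s x.
Proof.
move=> Dx ca cx ca' cx' Hs.
have [e Le ex] := ls_cover LS Dx.
have [M HM] := hol_section_is_cder Le ex ca' cx' Hs.
have H : is_cder_mx (fun z => s (cparam c z) *m invmx (complex_frame e (cparam c z))) (ccoord c x)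
   (cder (ccoord c' \o cparam c) (ccoord c x) *: M).
  move=> i j; rewrite mxE mulrC.
  exact (@cder_param_chain R X c c' x (fun y => (s y *m invmx (complex_frame e y)) i j) (M i j) ca ca' cx cx' (HM i j)).
by rewrite (nablaE _ Le ex ca cx H) (nablaE _ Le ex ca' cx' HM) !scale1r scalemxAl.
Qed.

Lemma nabla_hol m c a (s : X -> 'M[C]_(m, r)) x : ~ D x -> rs_atlas c -> cdom c x ->
  hol_at a x -> hol_section (@ls_bundle R X r L) s x ->
  hol_section (@ls_bundle R X r L) (nabla L c a s) x.
Proof.
move=> Dx ca cx Ha Hs _ [e Le <-] /= ex i j.
have Be : @ls_bundle R X r L (e.1, complex_frame e) by exists e.
have Hij : hol_at (fun y => (s y *m invmx (complex_frame e y)) i j) x := Hs _ Be ex i j.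
have := hol_atM Ha (hol_at_cder ca cx Hij).
apply: hol_at_near.
have H := near_coord ca cx (an_mx_is_cder (hol_section_cder Le ex ca cx Hs)).
apply: filterS3 H (frame_near Le ex) (near_cdom ca cx) => y Dy ey cy.
rewrite (nablaE a Le ey ca cy Dy) mulmxK ?complex_frame_unit// !mxE.
by [].
Qed.

End Nabla.

(** * Isolated zeros *)

Section Dichotomy.
Variable R : realType.
Local Notation C := R[i].

Lemma analytic_shift (f : C -> C) (z0 : C) : analytic_at f z0 -> analytic_at (fun z => f (z0 + z)) 0.
Proof.
move=> [a /nearC_normcP[d d0 H]]; exists a; apply/nearC_normcP; exists d; first exact d0.
move=> z; rewrite subr0 => zd; have := H (z0 + z); rewrite addrC addKr => /(_ zd).
by [].
Qed.

Lemma analytic_isolated_zeros (f : C -> C) (z0 : C) : analytic_at f z0 ->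
  (\forall z \near (z0 : R[i]^o), f z = 0) \/ (\forall z \near (z0 : R[i]^o)^', f z != 0).
Proof.
move=> /analytic_shift/analytic_order[/nearC_normcP[d d0 H]|[m [g [ga g0 /nearC_normcP[d d0 H]]]]].
  left; apply/nearC_normcP; exists d; first exact d0.
  by move=> z zd; have := H (z - z0); rewrite subr0 [z0 + _]addrC subrK; apply.
right; have /nearC_normcP[d' d'0 H'] := analytic_neq0_near ga g0.
apply/dnearC_normcP; exists (Num.min d d'); first by rewrite lt_min d0.
move=> z; rewrite lt_min => /andP[zd zd'] zz.
have := H (z - z0); rewrite subr0 [z0 + _]addrC subrK => ->//.
by rewrite mulf_neq0 ?expf_neq0 ?subr_eq0//; apply: H'; rewrite subr0.
Qed.

Lemma an_mx_isolated_zeros m n (G : C -> 'M[C]_(m, n)) (z0 : C) : an_mx G z0 ->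
  (\forall z \near (z0 : R[i]^o), G z = 0) \/ (\forall z \near (z0 : R[i]^o)^', G z != 0).
Proof.
move=> HG.
have [H|] := pselect (forall ij : 'I_m * 'I_n, \forall z \near (z0 : R[i]^o), G z ij.1 ij.2 = 0).
  left; apply: filterS (nearC_forall H) => z Gz; apply/matrixP => i j.
  by rewrite mxE (Gz (i, j)).
move=> /existsNP[[i j] /= nG]; right.
have [//|H] := analytic_isolated_zeros (HG i j).
by apply: filterS H => z; apply: contra_neq => ->; rewrite mxE.
Qed.

End Dichotomy.

(** * The cyclic vector and the ranks of the Hodge filtration *)

Section Omega.
Variables (R : realType) (X : riemannSurface R).
Local Notation C := R[i].
Variables (D : set X) (w : nat).
Hypothesis finD : finite_set D.
Local Notation r := w.+1.
Variables (L : set (frame int X r)) (F : int -> X -> 'M[C]_r).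
Hypothesis vhs : is_VHS D w L F.
Variable Hhat : set (frame C X r).
Hypothesis canH : is_canonical_extension D L Hhat.
Variable omega : X -> 'rV[C]_r.
Hypothesis cyc : is_generic_cyclic_vector D w L F Hhat omega.
Let LS := vhs_local_system vhs.

Lemma dnearX_and x (P Q : X -> Prop) : (\forall y \near x^', P y) -> (\forall y \near x^', Q y) ->
  \forall y \near x^', P y /\ Q y.
Proof. by apply: filterS2 => y. Qed.

Lemma near_notD x : \forall y \near x^', ~ D y.
Proof.
have cl : closed (D `\ x).
  apply: (accessible_finite_set_closed.1 (hausdorff_accessible (@rs_hausdorff R X))).
  exact: finite_setD.
have H : \forall y \near x, ~ (D `\ x) y.
  apply: (open_nbhs_nbhs (A := ~` (D `\ x))); split; first exact: closed_openC.
  by case=> _; apply.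
have H' : \forall y \near x, y != x -> ~ D y.
  by apply: filterS H => y H yx Dy; apply: H; split=> // yx'; rewrite yx' eqxx in yx.
exact H'.
Qed.

Lemma near_notD_out x : ~ D x -> \forall y \near x, ~ D y.
Proof.
move=> Dx; have H' : \forall y \near x, y != x -> ~ D y := near_notD x.
by apply: filterS H' => y H; have [->|/H] := eqVneq y x.
Qed.

Lemma dnear_nbhsX x (P : X -> Prop) : (\forall y \near x^', P y) ->
  \forall y \near x^', \forall t \near y, P t.
Proof.
have [c ca cx] := rs_cover x => /(dnear_chartP _ ca cx) H.
apply/(dnear_chartP _ ca cx).
have W := dnearC_and (dnearC_near H) (nearC_dnearC (near_coordK ca cx)).
apply: filterS W => z [Hz [cz zz]].
by apply/(near_chartP _ ca cz); rewrite zz.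
Qed.

Lemma coord_neq0 c (d : X) : coordinate_at d c -> \forall y \near d^', ccoord c y != 0.
Proof.
move=> [ca cd c0]; apply/(dnear_chartP _ ca cd).
have W := dnearC_and (nearC_dnearC (near_coordK ca cd)) (dnearC_neq (ccoord c d)).
by apply: filterS W => z [[_ ->]]; rewrite c0.
Qed.

(** Isolated zeros, applied to coordinates: at a point of [D] in a frame of [Hhat] after clearing
    the pole, elsewhere in a flat frame. *)
Lemma omega_isolated x : (\forall y \near x^', omega y = 0) \/ (\forall y \near x^', omega y != 0).
Proof.
have [Dx|Dx] := pselect (D x).
  have [c [n [g [cd Hg gE]]]] := gc_mero cyc Dx.
  have [ca cx c0] := cd.
  have [e He ex] := hb_cover (ce_bundle canH) (I : [set: X] x).
  have HG : an_mx (fun z => g (cparam c z) *m invmx (e.2 (cparam c z))) (ccoord c x).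
    by move=> i j; exact (Hg e He ex i j c ca cx).
  have eo : \forall y \near x, e.1 y.
    exact: (open_nbhs_nbhs (conj (hb_open (ce_bundle canH) He).1 ex)).
  have eu : \forall y \near x^', e.2 y \in unitmx.
    have H : \forall y \near x, y != x -> e.2 y \in unitmx.
      by apply: filterS eo => y ey _; exact: (hb_basis (ce_bundle canH) He ey).
    exact H.
  have W := dnearX_and eu (dnearX_and gE (coord_neq0 cd)).
  have [G0|G0] := an_mx_isolated_zeros HG; [left|right].
    have G0' : \forall y \near x^', g y *m invmx (e.2 y) = 0.
      by apply/(dnear_chartP _ ca cx); exact: nearC_dnearC.
    apply: filterS (dnearX_and G0' W) => y [Gy [ey [gy cy]]].
    have g0 : g y = 0 by rewrite -[LHS](mulmxKV ey) Gy mul0mx.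
    by move/eqP: gy; rewrite g0 scaler_eq0 expf_eq0 (negbTE cy) andbF => /eqP.
  have G0' : \forall y \near x^', g y *m invmx (e.2 y) != 0.
    by apply/(dnear_chartP _ ca cx).
  apply: filterS (dnearX_and G0' W) => y [Gy [ey [gy cy]]].
  by apply: contra_neq Gy => oy; rewrite -gy oy scaler0 mul0mx.
have [c ca cx] := rs_cover x.
have [e Le ex] := ls_cover LS Dx.
have HG := hol_section_cder Le ex ca cx (gc_hol cyc Dx).
have eu : \forall y \near x^', (@complex_frame R X w e y : matrix _ _ _) \in unitmx.
  have H : \forall y \near x, y != x -> @complex_frame R X w e y \in unitmx.
    by apply: filterS (frame_near LS Le ex) => y ey _; exact: (complex_frame_unit LS).
  exact H.
have [G0|G0] := an_mx_isolated_zeros HG; [left|right].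
  have G0' : \forall y \near x^', omega y *m invmx (@complex_frame R X w e y) = 0.
    by apply/(dnear_chartP _ ca cx); exact: nearC_dnearC.
  apply: filterS (dnearX_and G0' eu) => y [Gy ey].
  by rewrite -[LHS](mulmxKV ey) Gy mul0mx.
have G0' : \forall y \near x^', omega y *m invmx (@complex_frame R X w e y) != 0.
  by apply/(dnear_chartP _ ca cx).
apply: filterS (dnearX_and G0' eu) => y [Gy ey].
by apply: contra_neq Gy => ->; rewrite mul0mx.
Qed.

(* The set of points near which [omega] vanishes is open and closed. *)
Lemma omega_neq0_near x : \forall y \near x^', omega y != 0.
Proof.
pose Z := [set x | \forall y \near x^', omega y = 0].
have [//|Zx] : (\forall y \near x^', omega y != 0) \/ Z x.
  by have [] := omega_isolated x; [right|left].
have nZ y : ~ Z y -> \forall t \near y^', omega t != 0.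
  by move=> Zy; have [] := omega_isolated y.
have oZ : open Z.
  rewrite openE => y Zy; have H : \forall t \near y, t != y -> \forall u \near t, omega u = 0 := dnear_nbhsX Zy.
  apply: filterS H => t Ht; have [->//|/Ht {}Ht] := eqVneq t y.
  have : \forall u \near t, u != t -> omega u = 0 by apply: filterS Ht => u.
  by [].
have cZ : closed Z.
  rewrite -[Z]setCK; apply: open_closedC; rewrite openE => y /nZ Zy.
  have H : \forall t \near y, t != y -> \forall u \near t, omega u != 0 := dnear_nbhsX Zy.
  apply: filterS H => t Ht; have [->|/Ht {}Ht] := eqVneq t y.
    by move=> Zy'; have [u _ [/negP u0 /eqP]] := dnear_point (dnearX_and Zy Zy').
  move=> Zt; have Ht' : \forall u \near t, u != t -> omega u != 0 by apply: filterS Ht => u.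
  by have [u _ [/negP u0 /eqP]] := dnear_point (dnearX_and (Ht' : \forall u \near t^', omega u != 0) Zt).
have ZT : Z = [set: X].
  apply: (@rs_connected R X); first by exists x.
    by exists Z => //; rewrite setTI.
  by exists Z => //; rewrite setTI.
have [x0 Dx0 ox0] := gc_nonzero cyc.
exfalso.
have [c ca cx] := rs_cover x0.
have [e Le ex] := ls_cover LS Dx0.
have HG := hol_section_cder Le ex ca cx (gc_hol cyc Dx0).
have Zx0 : Z x0 by rewrite ZT.
have /(dnear_chartP _ ca cx) Zz := Zx0.
(* [Z] only controls punctured neighbourhoods; continuity carries the vanishing to [x0] itself. *)
have G0 : omega (cparam c (ccoord c x0)) *m invmx (@complex_frame R X w e (cparam c (ccoord c x0))) = 0.
  apply: (an_mx_eq_center HG (an_mx_cst 0 (ccoord c x0))).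
  by apply: filterS Zz => z ->; rewrite mul0mx.
rewrite (chart_param ca cx) in G0.
move/eqP: ox0; apply.
by rewrite -[LHS](mulmxKV (complex_frame_unit LS Le ex)) G0 mul0mx.
Qed.

Lemma iter_hol c j y : rs_atlas c -> cdom c y -> ~ D y ->
  hol_section (@ls_bundle R X r L) (iter j (nabla_log L c) omega) y.
Proof.
move=> ca cy Dy; elim: j => [|j IH]; first exact: gc_hol cyc _ Dy.
rewrite iterS; exact (nabla_hol LS Dy ca cy (hol_at_coord ca cy) IH).
Qed.

Lemma iter_filtration c j y : rs_atlas c -> cdom c y -> ~ D y ->
  (iter j (nabla_log L c) omega y <= F (w%:Z - j%:Z)%R y)%MS.
Proof.
move=> ca; elim: j y => [|j IH] y cy Dy; first by rewrite subr0; exact: gc_filtration cyc _ Dy.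
rewrite iterS /nabla_log nablaZ_field scalemx_sub//.
have -> : w%:Z - j.+1%:Z = (w%:Z - j%:Z) - 1 by lia.
apply: (vhs_transversality vhs Dy ca cy).
apply: filterS2 (near_cdom ca cy) (near_notD_out Dy) => t ct Dt.
split; first exact: iter_hol.
exact: IH.
Qed.

(** On a small punctured disc neither z d/dz nor omega vanishes, so cyclicity applies at each of its
    points. *)
Lemma iter_unit_near c d : coordinate_at d c -> \forall y \near d^',
  [/\ cdom c y, ~ D y & (\matrix_(k < r) iter k (nabla_log L c) omega y) \in unitmx].
Proof.
move=> cd; have [ca cdd c0] := cd.
have cn : \forall y \near d^', cdom c y.
  have H : \forall y \near d, y != d -> cdom c y by apply: filterS (near_cdom ca cdd) => y.
  exact H.
have W := dnearX_and (dnearX_and cn (near_notD d)) (dnearX_and (omega_neq0_near d) (coord_neq0 cd)).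
apply: filterS W => y [[cy Dy] [oy zy]]; split=> //.
exact: (nbhs_singleton (gc_cyclic cyc Dy oy ca cy (hol_at_coord ca cy) zy)).
Qed.

Lemma filtration_le y (p : int) (n : nat) : ~ D y -> (F (p + n%:Z)%R y <= F p y)%MS.
Proof.
move=> Dy; elim: n => [|n IH]; first by rewrite addr0.
have -> : p + n.+1%:Z = p + n%:Z + 1 by lia.
apply: submx_trans IH.
exact: (hs_decreasing (vhs_hodge vhs Dy)).
Qed.

Lemma rank_mxconj (A : 'M[C]_r) : \rank (mxconj A) = \rank A.
Proof. exact: mxrank_map. Qed.

(** The first j iterates are independent and lie in F^(r-j), which bounds the rank below. The Hodge
    decomposition makes F^(r-j) and the conjugate of F^j complementary, so the ranks for j and r - j
    add up to r and neither bound can be strict. *)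
Lemma rank_filtration c y : rs_atlas c -> cdom c y -> ~ D y ->
  (\matrix_(k < r) iter k (nabla_log L c) omega y) \in unitmx ->
  forall j, (j <= r)%N -> \rank (F (r%:Z - j%:Z)%R y) = j.
Proof.
move=> ca cy Dy U; set W := \matrix_(k < r) _ in U.
have ge j : (j <= r)%N -> (j <= \rank (F (r%:Z - j%:Z)%R y))%N.
  move=> jr; have rk : \rank ((pid_mx j : 'M[C]_r) *m W) = j.
    by rewrite mxrankMfree ?row_free_unit// rank_pid_mx.
  rewrite -{1}rk; apply: mxrankS; apply/row_subP => i; rewrite row_mul.
  have [ij|ij] := ltnP i j.
    have -> : row i (pid_mx j : 'M[C]_r) = delta_mx 0 i.
      by apply/rowP => k; rewrite !mxE ij andbT eq_sym.
    rewrite -rowE rowK; apply: submx_trans (iter_filtration i ca cy Dy) _.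
    have -> : w%:Z - i%:Z = (r%:Z - j%:Z) + (j - i.+1)%N%:Z by lia.
    exact (@filtration_le y (r%:Z - j%:Z) (j - i.+1)%N Dy).
  have -> : row i (pid_mx j : 'M[C]_r) = 0 by apply/rowP => k; rewrite !mxE ltnNge ij andbF.
  by rewrite mul0mx sub0mx.
have hs := vhs_hodge vhs Dy.
have sum j : (j <= r)%N -> (\rank (F (r%:Z - j%:Z)%R y) + \rank (F (r%:Z - (r - j)%N%:Z)%R y))%N = r.
  move=> jr; set p := r%:Z - j%:Z.
  have pE : w%:Z + 1 - p = r%:Z - (r - j)%N%:Z by rewrite /p; lia.
  have := mxrank_sum_cap (F p y) (mxconj (F (w%:Z + 1 - p)%R y)).
  rewrite (hs_direct hs p) mxrank0 addn0 rank_mxconj pE => <-.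
  by rewrite -pE; apply/eqP; exact: (hs_sum hs p).
move=> j jr; apply/eqP; rewrite eqn_leq ge// andbT.
have := sum j jr; have := ge (r - j)%N (leq_subr _ _); lia.
Qed.

End Omega.

(** * The canonical extension near a puncture *)

Section CoordRatio.
Variables (R : realType) (X : riemannSurface R).
Local Notation C := R[i].

(** The transition map fixes 0 and has a non-zero derivative there; [psi] is its quotient by z. *)
Lemma coord_ratio (d : X) c c' : coordinate_at d c -> coordinate_at d c' ->
  exists psi : C -> C, [/\ analytic_at psi 0, psi 0 != 0,
    \forall z \near (0 : R[i]^o), ccoord c' (cparam c z) = z * psi z &
    cder (ccoord c' \o cparam c) 0 = psi 0].
Proof.
move=> [ca cd c0] [ca' cd' c0'].
have Ht := analytic_transition ca ca' cd cd'; rewrite c0 in Ht.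
have pd : cparam c 0 = d by rewrite -c0 (chart_param ca cd).
have t0 : (ccoord c' \o cparam c) 0 = 0 by rewrite /= pd.
have [psi [Hpsi E]] := analytic_div Ht t0.
have D1 : is_cderive (fun z => z * psi z) 0 (1 * psi 0 + 0 * cder psi 0).
  exact (is_cderiveM (is_cderive_id 0) (analytic_is_cderive Hpsi)).
have dE : cder (ccoord c' \o cparam c) 0 = psi 0.
  by rewrite (cder_near E) (is_cderive_cder D1) mul1r mul0r addr0.
exists psi; split; [exact Hpsi| |exact E|exact dE].
rewrite -dE; apply/eqP => z0; have := cder_transition_inv ca ca' cd cd'.
by rewrite c0 z0 mul0r => /esym/eqP; rewrite oner_eq0.
Qed.

End CoordRatio.

(** * Coordinates in a frame of the canonical extension *)

Section Local.
Variables (R : realType) (X : riemannSurface R).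
Local Notation C := R[i].
Variables (D : set X) (w : nat).
Hypothesis finD : finite_set D.
Local Notation r := w.+1.
Variables (L : set (frame int X r)) (F : int -> X -> 'M[C]_r).
Hypothesis vhs : is_VHS D w L F.
Variables (Hhat : set (frame C X r)) (Fhat : int -> X -> 'M[C]_r).
Hypothesis canH : is_canonical_extension D L Hhat.
Hypothesis extF : is_hodge_extension D Hhat F Fhat.
Variable omega : X -> 'rV[C]_r.
Hypothesis cyc : is_generic_cyclic_vector D w L F Hhat omega.
Let LS := vhs_local_system vhs.

Lemma nabla_log_change m c c' (s : X -> 'M[C]_(m, r)) y k : ~ D y ->
  rs_atlas c -> cdom c y -> rs_atlas c' -> cdom c' y ->
  hol_section (@ls_bundle R X r L) s y ->
  ccoord c y * cder (ccoord c' \o cparam c) (ccoord c y) = k * ccoord c' y ->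
  nabla_log L c s y = k *: nabla_log L c' s y.
Proof.
move=> Dy ca cy ca' cy' Hs kE.
rewrite /nabla_log nablaZ_field (nabla_change LS Dy ca cy ca' cy' Hs).
by rewrite [in RHS]nablaZ_field !scalerA kE.
Qed.

Lemma Hhat_frame_unit e y : Hhat e -> e.1 y -> e.2 y \in unitmx.
Proof. exact: (hb_basis (ce_bundle canH)). Qed.

Lemma Hhat_frame_near e y : Hhat e -> e.1 y -> \forall t \near y, e.1 t.
Proof. by move=> He ey; exact: (open_nbhs_nbhs (conj (hb_open (ce_bundle canH) He).1 ey)). Qed.

(** [residue] comes with some coordinate [c1]. Passing to [c] multiplies the connection matrix by
    the ratio [h] of the two fields z d/dz, and h(0) = 1, so the value at 0 is unchanged. *)
Lemma residue_model d c : D d -> coordinate_at d c ->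
  exists (e : frame C X r) (A : C -> 'M[C]_r),
  [/\ Hhat e /\ e.1 d, an_mx A 0,
    \forall z \near (0 : R[i]^o)^', nabla_log L c e.2 (cparam c z) = A z *m e.2 (cparam c z) &
    residue L Hhat d = invmx (e.2 d) *m A 0 *m e.2 d].
Proof.
move=> Dd cd; have [ca cdd c0] := cd.
have [c1 [e [A1 [c1d [He ed] HA1 E NE]]]] := xgetPex 0 (ce_log_pole canH Dd).
have [ca1 cd1 c10] := c1d.
have [psi [Hpsi psi0 psiE psid]] := coord_ratio cd c1d.
have pd : cparam c 0 = d by rewrite -c0 (chart_param ca cdd).
pose h z := cder (ccoord c1 \o cparam c) z / psi z.
have Ht := analytic_transition ca ca1 cdd cd1; rewrite c0 in Ht.
have Hh : analytic_at h 0 := analyticM (analytic_cder Ht) (analyticV Hpsi psi0).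
exists e, (fun z => h z *: A1 (cparam c z)); split; first by [].
- apply: (an_mxZ Hh) => i j; have := HA1 i j c ca cdd; rewrite c0 => H; exact H.
- have cn : \forall y \near d, cdom c1 y /\ e.1 y.
    by apply: filterS2 (near_cdom ca1 cd1) (Hhat_frame_near He ed) => y.
  have n1 := near_param ca cdd cn; rewrite c0 in n1.
  have n2 := near_coordK ca cdd; rewrite c0 in n2.
  have /(dnear_chartP _ ca cdd) n3 := dnearX_and E (near_notD finD d); rewrite c0 in n3.
  have W := dnearC_and (nearC_dnearC (nearC_and n1 n2)) (dnearC_and n3
    (nearC_dnearC (nearC_and psiE (analytic_neq0_near Hpsi psi0)))).
  apply: filterS W => z [[[c1y ey] [cy zz]] [[Ey Dy] [pz p0]]].
  rewrite (@nabla_log_change _ c c1 _ _ (h z) Dy ca cy ca1 c1y (ce_restriction canH He ey Dy)).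
    by rewrite Ey scalemxAl.
  by rewrite zz pz /h [RHS]mulrCA (divfK p0).
- rewrite /residue NE pd /h psid mulfV// scale1r.
  by [].
Qed.

Section Frame.
Variables (d : X) (c : chart R X) (e : frame C X r) (A : C -> 'M[C]_r).
Hypothesis Dd : D d.
Hypothesis cd : coordinate_at d c.
Hypothesis He : Hhat e.
Hypothesis ed : e.1 d.
Hypothesis HA : an_mx A 0.
Hypothesis EA : \forall z \near (0 : R[i]^o)^', nabla_log L c e.2 (cparam c z) = A z *m e.2 (cparam c z).
Hypothesis NE : residue L Hhat d = invmx (e.2 d) *m A 0 *m e.2 d.

Definition omega_coord (z : C) : 'rV[C]_r := omega (cparam c z) *m invmx (e.2 (cparam c z)).
Local Notation v0 := omega_coord.

Lemma param0 : cparam c 0 = d.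
Proof. by have [ca cdd c0] := cd; rewrite -c0 (chart_param ca cdd). Qed.

Lemma frame_dnear : \forall z \near (0 : R[i]^o),
  [/\ cdom c (cparam c z), ccoord c (cparam c z) = z, e.1 (cparam c z) &
      e.2 (cparam c z) \in unitmx].
Proof.
have [ca cdd c0] := cd.
have n1 := near_param ca cdd (Hhat_frame_near He ed); rewrite c0 in n1.
have n2 := near_coordK ca cdd; rewrite c0 in n2.
apply: filterS (nearC_and n1 n2) => z [ez [cz zz]]; split => //.
exact: Hhat_frame_unit.
Qed.

Lemma notD_dnear : \forall z \near (0 : R[i]^o)^', ~ D (cparam c z).
Proof.
have [ca cdd c0] := cd.
by have /(dnear_chartP _ ca cdd) := near_notD finD d; rewrite c0.
Qed.

Lemma omega_coord_mero : mero_mx v0.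
Proof.
have [ca cdd c0] := cd.
have [c2 [n [g [c2d Hg gE]]]] := gc_mero cyc Dd.
have [psi [Hpsi psi0 psiE _]] := coord_ratio cd c2d.
have HG : an_mx (fun z => g (cparam c z) *m invmx (e.2 (cparam c z))) 0.
  by move=> i j; have := Hg e He ed i j c ca cdd; rewrite c0 => H; exact H.
have /(dnear_chartP _ ca cdd) gE' := gE; rewrite c0 in gE'.
exists (- n%:Z), (fun z => (psi z ^+ n)^-1 *: (g (cparam c z) *m invmx (e.2 (cparam c z)))).
split.
  by apply: (an_mxZ (analyticV (analyticX n Hpsi) _) HG); rewrite expf_neq0.
have W := dnearC_and gE' (dnearC_and (dnearC_neq 0)
   (nearC_dnearC (nearC_and psiE (analytic_neq0_near Hpsi psi0)))).
apply: filterS W => z [gz [z0 [pz p0]]].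
rewrite -gz pz -scalemxAl !scalerA -exprnN exprMn.
rewrite [_ * (z ^+ n * _)]mulrC !mulrA.
rewrite (_ : _ * _ = 1) ?scale1r//.
by field; rewrite !expf_neq0.
Qed.

(** By the Leibniz rule for coordinates times the frame [e], [nabla_log] turns into [theta A]. *)
Lemma iter_omega_coord j : \forall z \near (0 : R[i]^o)^',
  iter j (nabla_log L c) omega (cparam c z) = iter j (theta A) v0 z *m e.2 (cparam c z).
Proof.
have [ca cdd c0] := cd.
elim: j => [|j IH].
  apply: filterS (nearC_dnearC frame_dnear) => z [_ _ _ U].
  by rewrite /= /v0 mulmxKV.
have Hvj : mero_mx (iter j (theta A) v0).
  by elim: j {IH} => [|j IH]; [exact omega_coord_mero|exact (theta_mero HA IH)].
have W := dnearC_and (dnearC_and (dnearC_near IH) (mero_mx_is_cder Hvj))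
  (dnearC_and (dnearC_and EA notD_dnear) (nearC_dnearC frame_dnear)).
apply: filterS W => z [[Ez Dv] [[Az Dy] [cy zz ey ue]]].
set vj := iter j (theta A) v0 in Ez Dv *.
set y := cparam c z in Dy cy zz ey ue Az *.
have nk := near_coordK ca cy; rewrite zz in nk.
have P' : is_cder_mx (fun z => vj (ccoord c (cparam c z))) (ccoord c y) (cder_mx vj z).
  rewrite zz; apply: is_cder_mx_near Dv.
  by apply: filterS nk => z' [_ ->].
have near_eq : \forall t \near y, iter j (nabla_log L c) omega t = vj (ccoord c t) *m e.2 t.
  apply/(near_chartP _ ca cy); rewrite zz.
  by apply: filterS (nearC_and Ez nk) => z' [-> [_ ->]].
rewrite iterS /nabla_log (nabla_near _ _ ca cy near_eq).
rewrite (nablaM LS _ Dy ca cy P' (ce_restriction canH He ey Dy)).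
rewrite -[nabla L c (ccoord c) e.2 y]/(nabla_log L c e.2 y) Az zz iterS.
by rewrite {2}/theta mulmxDl -scalemxAl mulmxA.
Qed.

Lemma omega_coord_unit : \forall z \near (0 : R[i]^o)^',
  \matrix_(j < r) iter j (theta A) v0 z \in unitmx.
Proof.
have [ca cdd c0] := cd.
have /(dnear_chartP _ ca cdd) U := iter_unit_near finD vhs canH cyc cd; rewrite c0 in U.
have W := dnearC_and (dnearC_forall (fun j : 'I_r => iter_omega_coord j)) U.
apply: filterS W => z [H [_ _]].
have -> : \matrix_(k < r) iter k (nabla_log L c) omega (cparam c z) =
  (\matrix_(j < r) iter j (theta A) v0 z) *m e.2 (cparam c z).
  by apply/row_matrixP => k; rewrite rowK H row_mul rowK.
by rewrite unitmx_mul => /andP[].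
Qed.

Lemma eigenvalue_residue_model a : eigenvalue (A 0) a -> 0 <= a < 1.
Proof.
move=> /eigenvalueP[v vA v0].
have ue := Hhat_frame_unit He ed.
apply: (ce_eigenvalue canH Dd); rewrite NE; apply/eigenvalueP; exists (v *m e.2 d).
  by rewrite !mulmxA mulmxK// vA scalemxAl.
by apply: contra_neq v0 => /(congr1 (mulmx^~ (invmx (e.2 d)))); rewrite mulmxK// mul0mx.
Qed.

(** In a frame adapted to the subbundle, membership means that the coordinates from [k] on vanish, a
    closed condition. Multiplied by the determinant of [M] it is expressed through the adjugate,
    hence analytic in z. *)
Lemma Fhat_limit q (p : C -> 'rV[C]_r) : an_mx p 0 ->
  (\forall z \near (0 : R[i]^o)^', (p z *m e.2 (cparam c z) <= Fhat q (cparam c z))%MS) ->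
  (p 0 *m e.2 d <= Fhat q d)%MS.
Proof.
move=> Hp pF; have [ca cdd c0] := cd.
have [ep [k [[oe _ eh] epd kr FE]]] := he_subbundle extF q (I : [set: X] d).
pose M z := ep.2 (cparam c z) *m invmx (e.2 (cparam c z)).
have HM : an_mx M 0.
  by move=> i j; have := (eh d epd).2 e He ed i j c ca cdd; rewrite c0 => H; exact H.
have ue := Hhat_frame_unit He ed; have uep := (eh d epd).1.
have en : \forall y \near d, ep.1 y by exact: (open_nbhs_nbhs (conj oe epd)).
have n1 := near_param ca cdd en; rewrite c0 in n1.
have HQ : an_mx (fun z => p z *m \adj (M z) *m (1%:M - pid_mx k)) 0.
  exact (an_mxM (an_mxM Hp (an_adj HM)) (an_mx_cst _ 0)).
have Q0 : p 0 *m \adj (M 0) *m (1%:M - pid_mx k) = 0.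
  apply: (an_mx_eq_center HQ (an_mx_cst 0 0)).
  have W := dnearC_and pF (nearC_dnearC (nearC_and n1 frame_dnear)).
  apply: filterS W => z [pz [ez [cy zz ey uz]]].
  have uepz := (eh _ ez).1.
  rewrite (eqmxP (FE _ ez)) in pz; have /submxP[u uE] := pz.
  have -> : p z = u *m pid_mx k *m M z.
    by rewrite /M mulmxA -[u *m _ *m ep.2 _]mulmxA -uE mulmxK.
  rewrite -[_ *m M z *m _]mulmxA mul_mx_adj mul_mx_scalar -scalemxAl -mulmxA mulmxBr mulmx1.
  by rewrite pid_mx_id// subrr mulmx0 scaler0.
have uM : M 0 \in unitmx by rewrite /M param0 unitmx_mul uep unitmx_inv.
have Q1 : p 0 *m invmx (M 0) *m (1%:M - pid_mx k) = 0.
  by rewrite /invmx uM -scalemxAr -scalemxAl Q0 scaler0.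
have pE : p 0 *m e.2 d = (p 0 *m invmx (M 0)) *m (pid_mx k *m ep.2 d).
  have -> : ep.2 d = M 0 *m e.2 d by rewrite /M param0 mulmxKV.
  rewrite !mulmxA; congr (_ *m _).
  move/eqP: Q1; rewrite mulmxBr mulmx1 subr_eq0 => /eqP <-.
  by rewrite -[RHS]mulmxA -/(M 0) mulmxKV.
by rewrite (eqmxP (FE _ epd)) pE submxMl.
Qed.

(** The rank is constant on the domain of an adapted frame, which contains points off [D] where it
    is known. *)
Lemma rank_Fhat j : (j <= r)%N -> \rank (Fhat (r%:Z - j%:Z)%R d) = j.
Proof.
move=> jr; have [ca cdd c0] := cd.
have [ep [k [[oe _ eh] epd kr FE]]] := he_subbundle extF (r%:Z - j%:Z) (I : [set: X] d).
have rk y : ep.1 y -> \rank (Fhat (r%:Z - j%:Z)%R y) = k.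
  move=> ey; rewrite (eqmx_rank (FE y ey)) mxrankMfree ?rank_pid_mx//.
  by rewrite row_free_unit; exact: (eh y ey).1.
have en : \forall y \near d^', ep.1 y.
  have H : \forall y \near d, ep.1 y by exact: (open_nbhs_nbhs (conj oe epd)).
  have H' : \forall y \near d, y != d -> ep.1 y by apply: filterS H.
  exact H'.
have [y _ [ey [cy Dy U]]] := dnear_point (dnearX_and en (iter_unit_near finD vhs canH cyc cd)).
rewrite (rk d epd) -(rk y ey) (eqmx_rank (he_restriction extF _ Dy)).
exact (rank_filtration finD vhs cyc ca cy Dy U jr).
Qed.

(** Row i is a limit of combinations of the first i + 1 derivatives of omega, so the rows before [j]
    lie in the extended F^(r-j) at [d]; the ranks then force equality. *)
Lemma Fhat_flag (S P : C -> 'M[C]_r) : an_mx P 0 -> P 0 \in unitmx ->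
  (\forall z \near (0 : R[i]^o)^', S z = P z) ->
  (\forall z \near (0 : R[i]^o)^', forall i : 'I_r, exists k : nat -> C,
     row i (S z) = \sum_(j < i.+1) k j *: iter j (theta A) v0 z) ->
  forall j, (j <= r)%N ->
    (Fhat (r%:Z - j%:Z)%R d == (pid_mx j : 'M[C]_r) *m (P 0 *m e.2 d))%MS.
Proof.
move=> HP UP SP HS j jr; have [ca cdd c0] := cd.
have ue := Hhat_frame_unit He ed.
have sub : ((pid_mx j : 'M[C]_r) *m (P 0 *m e.2 d) <= Fhat (r%:Z - j%:Z)%R d)%MS.
  apply/row_subP => i; rewrite row_mul.
  have [ij|ij] := ltnP i j; last first.
    have -> : row i (pid_mx j : 'M[C]_r) = 0 by apply/rowP => k; rewrite !mxE ltnNge ij andbF.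
    by rewrite mul0mx sub0mx.
  have -> : row i (pid_mx j : 'M[C]_r) = delta_mx 0 i.
    by apply/rowP => k; rewrite !mxE ij andbT eq_sym.
  rewrite -rowE row_mul.
  apply: (Fhat_limit (p := fun z => row i (P z))).
    by move=> a k; under eq_fun do rewrite mxE; exact (HP i k).
  have W := dnearC_and (dnearC_and SP HS) (dnearC_and (dnearC_forall (fun l : 'I_r => iter_omega_coord l))
    (dnearC_and notD_dnear (nearC_dnearC frame_dnear))).
  apply: filterS W => z [[SPz HSz] [Iz [Dy [cy zz ey uz]]]].
  have [k rE] := HSz i.
  rewrite -SPz rE mulmx_suml; apply: summx_sub => l _.
  have lr : (l < r)%N by apply: leq_trans (ltn_ord l) (ltn_ord i).
  rewrite -scalemxAl scalemx_sub// -(Iz (Ordinal lr)) (eqmxP (he_restriction extF _ Dy)).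
  apply: submx_trans (iter_filtration finD vhs cyc (Ordinal lr) ca cy Dy) _ => /=.
  have lj : (l < j)%N by apply: leq_trans ij; exact: ltn_ord.
  have -> : w%:Z - l%:Z = (r%:Z - j%:Z) + (j - l.+1)%N%:Z by lia.
  exact (filtration_le vhs _ _ Dy).
apply/eqmxP/eqmx_sym/eqmxP; rewrite -(geq_leqif (mxrank_leqif_eq sub)).
rewrite rank_Fhat// mxrankMfree ?rank_pid_mx// row_free_unit unitmx_mul UP.
exact: ue.
Qed.

End Frame.
End Local.

(** * The weight at a puncture *)

Section LocalWeights.
Variables (R : realType) (X : riemannSurface R).
Local Notation C := R[i].
Variables (D : set X) (w : nat).
Hypothesis finD : finite_set D.
Local Notation r := w.+1.
Variables (L : set (frame int X r)) (F : int -> X -> 'M[C]_r).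
Hypothesis vhs : is_VHS D w L F.
Variables (Hhat : set (frame C X r)) (Fhat : int -> X -> 'M[C]_r).
Hypothesis canH : is_canonical_extension D L Hhat.
Hypothesis extF : is_hodge_extension D Hhat F Fhat.
Variable omega : X -> 'rV[C]_r.
Hypothesis cyc : is_generic_cyclic_vector D w L F Hhat omega.
Variables (d : X) (mu : r.-tuple R).
Hypothesis Dd : D d.
Hypothesis expo : is_exponents L omega d mu.

Lemma exponents_sorted (i j : 'I_r) : (i <= j)%N -> tnth mu i <= tnth mu j.
Proof.
move=> ij; rewrite !(tnth_nth 0).
by apply: (sorted_leq_nth le_trans lexx 0 expo.1); rewrite ?inE ?size_tuple.
Qed.

(* The twist [f] is [0] at apparent singularities and the floor of the exponents elsewhere. *)
Lemma adapted_frame (f : nat -> int) :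
  (forall i, (i < w)%N -> f i <= f i.+1) -> (forall i, (i <= w)%N -> f w <= f i + 1) ->
  exists c (e : frame C X r) (A A' S : C -> 'M[C]_r),
  [/\ [/\ coordinate_at d c, Hhat e, e.1 d & an_mx A 0],
      (\forall z \near (0 : R[i]^o)^', nabla_log L c e.2 (cparam c z) = A z *m e.2 (cparam c z)) /\
      residue L Hhat d = invmx (e.2 d) *m A 0 *m e.2 d,
      [/\ an_mx A' 0, mero_mx S, \forall z \near (0 : R[i]^o)^', S z \in unitmx &
          \forall z \near (0 : R[i]^o)^', z *: cder_mx S z + S z *m A z = A' z *m S z],
      (forall i, A' 0 i i = ((tnth mu i - (f i)%:~R)%:C)%C) /\
      (forall i j : 'I_r, A' 0 i j != 0 -> i != j ->
         (f i = f j /\ (i < j)%N) \/ f j < f i) &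
      \forall z \near (0 : R[i]^o)^', forall i : 'I_r, exists k : nat -> C,
        row i (S z) = \sum_(j < i.+1) k j *: iter j (theta A) (omega_coord omega c e) z].
Proof.
move=> fS fw; have [_ [c [b [cd Hb Hrel Hind]]]] := expo.
have [ca cdd c0] := cd.
have [e [A [[He ed] HA EA NE]]] := residue_model finD vhs canH Dd cd.
pose bn (j : nat) z := b (inord j) (cparam c z).
pose m (j : nat) : C := ((tnth mu (inord j))%:C)%C.
have pd := param0 cd.
have Hbn j : (j < r)%N -> analytic_at (bn j) 0.
  by move=> _; have := Hb (inord j) c ca cdd; rewrite c0 => H; exact H.
have bnE (j : 'I_r) : bn j 0 = b j d by rewrite /bn inord_val pd.
have HE : \forall z \near (0 : R[i]^o)^',
    iter r (theta A) (omega_coord omega c e) z +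
    \sum_(j < r) bn j z *: iter j (theta A) (omega_coord omega c e) z = 0.
  have /(dnear_chartP _ ca cdd) Hrel' := Hrel; rewrite c0 in Hrel'.
  have It := iter_omega_coord finD vhs canH cyc Dd cd He ed HA EA.
  have W := dnearC_and (dnearC_and Hrel' (It r)) (dnearC_and (dnearC_forall (fun j : 'I_r => It j))
    (nearC_dnearC (frame_dnear canH cd He ed))).
  apply: filterS W => z [[E Ir] [Ij [cz zz ez ue]]].
  apply: (can_inj (mulmxK ue)); rewrite mul0mx -[RHS]E mulmxDl Ir; congr (_ + _).
  rewrite mulmx_suml; apply: eq_bigr => j _.
  by rewrite /bn inord_val Ij scalemxAl.
have Hind' : 'X^r + \sum_(j < r) bn j 0 *: 'X^j = \prod_(j < r) ('X - (m j)%:P).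
  under eq_bigr do rewrite bnE; rewrite Hind.
  by apply: eq_bigr => j _; rewrite /m inord_val.
have HU := omega_coord_unit finD vhs canH cyc Dd cd He ed HA EA.
have Hv0 := omega_coord_mero cyc Dd cd He ed.
have [A' [S [[HA' HS] SU ES [Adiag Atri] Srow]]] :=
  shear_frame HA Hv0 Hbn HE Hind' HU fS fw.
exists c, e, A, A', S; split; [by []|by []|by []| |exact Srow].
split=> // i; rewrite Adiag /m inord_val rmorphB /= rmorph_int.
by [].
Qed.

(** With zero twist A'(0) is triangular with the integers mu_j on its diagonal, so every eigenvalue
    of the residue, being congruent to one of them, is an integer of [0, 1). *)
Lemma apparent_weight q : (forall j, tnth mu j \is a Num.int) ->
  induced_weight (residue L Hhat d) (fun p => Fhat p d) q = 0.
Proof.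
move=> mu_int.
have [//|//|c [e [A [A' [S [[cd He ed HA] [EA NE] [HA' HS SU ES] [Adiag Atri] _]]]]]] :=
  @adapted_frame (fun=> 0).
have ev0 a : eigenvalue (residue L Hhat d) a -> a = 0.
  move=> Ha; have ue := Hhat_frame_unit canH He ed.
  have HaA : eigenvalue (A 0) a.
    have /eigenvalueP[v vN v0] := Ha; apply/eigenvalueP; exists (v *m invmx (e.2 d)).
      apply: (can_inj (mulmxK ue)); rewrite -scalemxAl mulmxKV// -vN NE !mulmxA.
      by [].
    by apply: contra_neq v0 => /(congr1 (mulmx^~ (e.2 d))); rewrite mulmxKV// mul0mx.
  have /andP[a0 a1] := ce_eigenvalue canH Dd Ha.
  (* No resonance: a - (j+1) is negative, hence outside [0, 1). *)
  have nev (j : nat) : ~~ eigenvalue (A 0) (a - j.+1%:R).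
    apply/negP => /(eigenvalue_residue_model canH Dd He ed NE)/andP[h _].
    have : (1 : C) <= a by apply: le_trans (_ : j.+1%:R <= a); rewrite ?ler1n// -subr_ge0.
    by move=> /le_lt_trans /(_ a1); rewrite ltxx.
  have [k Hk] := eigenvalue_mod_Z HA HA' HS SU ES HaA nev.
  have tri (i j : 'I_r) : A' 0 i j != 0 -> i != j -> (i < j)%N.
    by move=> h1 h2; have [[]|] := Atri i j h1 h2; rewrite ?ltxx.
  have [i ai] := tri_eigenvalueP (@ord_inj r) tri (fun i => erefl (A' 0 i i)) _ Hk.
  move: ai; rewrite Adiag subr0 => /eqP; rewrite subr_eq => /eqP aE.
  have /intrP[n nE] := mu_int i.
  have {aE} aE : a = (n + k)%:~R by rewrite aE nE rmorph_int rmorphD.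
  move: a0 a1; rewrite aE ler0z ltrz1 => n0 n1.
  by have -> : n + k = 0 by lia.
rewrite /induced_weight; set al := parabolic_weights _.
have Ex : exists al : seq R, sorted <%R al /\ forall a : C, eigenvalue (residue L Hhat d) a = (a \in [seq (t%:C)%C | t <- al]).
  have [H|H] := boolP (eigenvalue (residue L Hhat d) 0).
    exists [:: 0]; split=> // a; rewrite inE; apply/idP/eqP => [/ev0 ->//|->]; exact H.
  exists [::]; split=> // a; rewrite in_nil.
  apply: (contraNF _ H) => Ha; have a0 := ev0 a Ha.
  by rewrite a0 in Ha.
have [_ h2] := xgetPex [::] Ex; rewrite -/al in h2.
(* Past the end of the list the default value of [nth] is 0 as well, so the index of the induced
   weight is immaterial. *)
have nth0 (j : nat) : nth 0 al j = 0.
  have [js|js] := ltnP j (size al); last by rewrite nth_default.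
  have : eigenvalue (residue L Hhat d) (((nth 0 al j)%:C)%C) by rewrite h2 map_f// mem_nth.
  by move=> /ev0 [].
exact: nth0.
Qed.

Lemma nu_bounds (x : R) : 0 <= - nu x < 1.
Proof.
rewrite /nu opprB subr_ge0 floor_le_tmp ltrBlDl.
by have := floorD1_gt x; rewrite rmorphD /= addrC.
Qed.

(** Twisting by the floors puts the numbers - nu_j on the diagonal of A'(0), in the same interval
    [0, 1) as the eigenvalues of the residue. The change of frame is then invertible at 0 and
    carries the flag and the triangular form to the fibre of the canonical extension. *)
Lemma genuine_weight (k : 'I_r) : 0 <= tnth mu ord_max - tnth mu ord0 < 1 ->
  induced_weight (residue L Hhat d) (fun p => Fhat p d) (w%:Z - k%:Z) = - nu (tnth mu k).
Proof.
move=> /andP[_ mu1].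
have mlt (i j : 'I_r) : tnth mu i < tnth mu j + 1.
  have h1 : tnth mu i <= tnth mu ord_max by apply: exponents_sorted; rewrite -ltnS ltn_ord.
  have h2 : tnth mu ord0 <= tnth mu j by apply: exponents_sorted.
  by lra.
pose f (i : nat) := Num.floor (tnth mu (inord i)).
have fmono (i j : 'I_r) : (i <= j)%N -> f i <= f j.
  by move=> ij; rewrite /f !inord_val; apply: le_floor; exact: exponents_sorted.
(* The gap below 1 confines the floors to two consecutive values. *)
have fle (i j : 'I_r) : f i <= f j + 1.
  have -> : f j + 1 = Num.floor (tnth mu j + 1) by rewrite floorDrz ?rpred1// floor1 /f inord_val.
  rewrite /f inord_val.
  by apply: le_floor; exact/ltW/mlt.
have [||c [e [A [A' [S [[cd He ed HA] [EA NE] [HA' HS SU ES] [Adiag Atri] Srow]]]]]] :=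
  @adapted_frame f.
- move=> i iw; have i1 : (i < r)%N by apply: ltnW.
  exact: (fmono (Ordinal i1) (Ordinal (iw : (i.+1 < r)%N)) (leqnSn i)).
- by move=> i iw; exact: (fle ord_max (Ordinal (iw : (i < r)%N))).
pose de (i : 'I_r) := - nu (tnth mu i).
have Ade i : A' 0 i i = ((de i)%:C)%C by rewrite Adiag /de /nu opprB /f inord_val.
(* [ka] lists first the indices at which the floor has already jumped, so that
   [A' 0] becomes triangular with nondecreasing diagonal [de]. *)
pose ka (i : 'I_r) := (`|(f w - f i)%R|%N * r + i)%N.
have fw0 (i : 'I_r) : f i <= f w by apply: (fmono i ord_max); rewrite -ltnS ltn_ord.
have ka_lt (i j : 'I_r) : f j < f i -> (ka i < ka j)%N.
  move=> fji; rewrite /ka; have := fw0 i; have := fw0 j; have := fle ord_max j => /= h1 h2 h3.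
  have -> : `|(f w - f i)%R|%N = 0%N by lia.
  have -> : `|(f w - f j)%R|%N = 1%N by lia.
  by rewrite mul0n add0n mul1n ltn_addr.
have ka_tri (i j : 'I_r) : A' 0 i j != 0 -> i != j -> (ka i < ka j)%N.
  move=> h1 h2; have [[fij ij]|] := Atri i j h1 h2; last exact: ka_lt.
  by rewrite /ka fij ltn_add2l.
have ka_inj : injective ka.
  move=> i j /(congr1 (modn^~ r)); rewrite /ka !modnMDl !modn_small// => ij.
  exact: val_inj.
(* If the floor has jumped at i but not at j, then mu_i < mu_j + 1 says that the fractional part at
   i is the smaller one. *)
have de_mono (i j : 'I_r) : (ka i < ka j)%N -> de i <= de j.
  move=> kij; rewrite /de /nu !opprB.
  have [fij|fji|fij] := ltgtP (f i) (f j).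
  - by have := ka_lt j i fij; rewrite ltnNge (ltnW kij).
  - have : f i = f j + 1 by have := fle i j; lia.
    rewrite /f !inord_val => ->; rewrite rmorphD /=; have := mlt i j; lra.
  - move: kij; rewrite /ka fij ltn_add2l => ij.
    have := exponents_sorted (ltnW ij); move: fij; rewrite /f !inord_val => ->; lra.
have ue := Hhat_frame_unit canH He ed.
(* Two numbers of [0, 1) that differ by an integer are equal. *)
have spec a a' (n : int) : eigenvalue (A 0) a -> eigenvalue (A' 0) a' -> a + n%:~R = a' -> n = 0.
  move=> /(eigenvalue_residue_model canH Dd He ed NE)/andP[a0 a1].
  move=> /(tri_eigenvalueP ka_inj ka_tri Ade)[i ->] aE.
  have /andP[d0 d1] : 0 <= de i < 1 := nu_bounds _.
  have aE' : a = (((de i - n%:~R)%:C)%C) by rewrite rmorphB /= rmorph_int -aE addrK.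
  move: a0 a1; rewrite aE' lecR ltcR => a0 a1.
  have h1 : (n%:~R : R) < 1 by lra.
  have h2 : (-1 : R) < n%:~R by lra.
  by move: h1 h2; rewrite ltrz1 -[-1]/((-1)%:~R) ltr_int; lia.
have [P [HP SP UP PA]] := gauge_unit HA HA' HS SU ES spec.
have flag := Fhat_flag finD vhs canH extF cyc Dd cd He ed HA EA HP UP SP Srow.
have BU : P 0 *m e.2 d \in unitmx by rewrite unitmx_mul UP.
have BN : (P 0 *m e.2 d) *m residue L Hhat d = A' 0 *m (P 0 *m e.2 d).
  by rewrite NE -!mulmxA mulKVmx// [LHS]mulmxA PA -mulmxA.
(* F^(w-k) is spanned by the first k + 1 rows of P(0) e(d), and F^(w-k+1) by the first k. *)
rewrite (@induced_weight_triangular R w (A' 0) de ka ka_inj ka_tri Ade de_mono _ _ BU BN _ _ k)//.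
  have -> : w%:Z - k%:Z = r%:Z - k.+1%:Z by lia.
  by apply: flag; exact: ltn_ord.
have -> : w%:Z - k%:Z + 1 = r%:Z - k%:Z by lia.
by apply: flag; exact/ltnW/ltn_ord.
Qed.

End LocalWeights.

(** * Summation over the punctures *)

Theorem corollary4p11 (R : realType) (X : riemannSurface R)
    (compactX : compact [set: X])
    (D : set X) (finD : finite_set D)
    (w : nat)
    (L : set (frame int X w.+1)) (F : int -> X -> 'M[R[i]]_w.+1)
    (vhs : is_VHS D w L F) (polF : polarizable D w L F)
    (Hhat : set (frame R[i] X w.+1)) (Fhat : int -> X -> 'M[R[i]]_w.+1)
    (canHhat : is_canonical_extension D L Hhat)
    (extF : is_hodge_extension D Hhat F Fhat)
    (omega : X -> 'rV[R[i]]_w.+1)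
    (cyclic_omega : is_generic_cyclic_vector D w L F Hhat omega)
    (mu : X -> w.+1.-tuple R)
    (exponents_mu : forall u, is_exponents L omega u (mu u)) :
  let Ds := D `\` apparent D L mu in
  (forall u, Ds u -> 0 <= tnth (mu u) ord_max - tnth (mu u) ord0 < 1) ->
  forall k : 'I_w.+1,
    gr_pdegree D L Hhat Fhat (w%:Z - k%:Z) =
    (gr_degree Hhat Fhat (w%:Z - k%:Z))%:~R -
    \sum_(u \in Ds) nu (tnth (mu u) k).
Proof.
move=> Ds mu_gap k; rewrite /gr_pdegree; congr (_ + _).
have DsD : Ds `<=` D by move=> u [].
(* Apparent singularities have weight 0, so the sum over [D] reduces to the genuine ones. *)
rewrite -(fsbig_widen Ds D) //; last first.
  move=> u [Du nDs]; have [[_ mu_int _]|nap] := pselect (apparent D L mu u).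
    exact (apparent_weight finD vhs Fhat canHhat cyclic_omega Du (exponents_mu u) _ mu_int).
  by exfalso; apply: nDs.
have finDs : finite_set Ds by exact: sub_finite_set finD.
rewrite !fsbig_finite//= -sumrN; apply: eq_big_seq => u.
rewrite in_fset_set// inE => -[Du nap].
by apply: (genuine_weight finD vhs canHhat extF cyclic_omega Du (exponents_mu u)); exact: mu_gap.
Qed.
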